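(* Let $1<p<q<\infty$. Let $\sigma$ and $\omega$ be product reverse doubling weights on $\mathbb{R}^m\times\mathbb{R}^n$. Let $K:\mathcal{P}^m\times\mathcal{P}^n\to[0,\infty)$ be given by $K(I\times J)=|I|^{\frac{\alpha}{m}-1}|J|^{\frac{\beta}{n}-1}$ with $0<\frac{\alpha}{m},\frac{\beta}{n}<1$, or more generally let $K$ satisfy the following expectation inequality: there is $c>0$ such that for all $f,g\ge0$ and all partial grids $\mathcal{D}^m\times\mathcal{D}^n$, $$\boldsymbol{E}_{\Omega\times\Omega}\,\mathcal{B}_{\mathcal{G}^m\times\mathcal{G}^n}(f,g)\ \ge\ c\,\mathcal{B}_{\mathcal{D}^m\times\mathcal{D}^n}(f,g),$$ where on the left the expectation is over independent random dyadic grids $\mathcal{G}^m$ in $\mathbb{R}^m$ and $\mathcal{G}^n$ in $\mathbb{R}^n$. Let $\mathbb{N}_K(\sigma,\omega)\in[0,\infty]$ be the smallest constant such that, for all partial grids $\mathcal{R}^{m,n}=\mathcal{D}^m\times\mathcal{D}^n$, $$\sum_{R\in\mathcal{R}^{m,n}}K(R)\left(\int_R f\,d\sigma\right)\left(\int_R g\,d\omega\right)\le\mathbb{N}_K(\sigma,\omega)\,\|f\|_{L^p(\sigma)}\|g\|_{L^{q'}(\omega)},\qquad f,g\ge0 .$$ Then $\mathbb{N}_K(\sigma,\omega)<\infty$ if and only if $$\mathbb{A}_K(\sigma,\omega)\equiv\sup_{R\in\mathcal{P}^m\times\mathcal{P}^n}K(R)\,|R|_\omega^{\frac1q}\,|R|_\sigma^{\frac1{p'}}<\infty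 .$$
   Context: $p'=p/(p-1)$, $q'=q/(q-1)$. $\mathcal{P}^N$ is the collection of all (half-open) cubes in $\mathbb{R}^N$ with sides parallel to the coordinate axes, and $\mathcal{P}^m\times\mathcal{P}^n$ denotes the set of rectangles $I\times J$ with $I\in\mathcal{P}^m$, $J\in\mathcal{P}^n$. $|I|$ is Lebesgue measure; for a measure $\mu$, $|R|_\mu=\mu(R)$. A weight is a locally finite positive Borel measure. A weight $\mu$ on $\mathbb{R}^m\times\mathbb{R}^n$ is product reverse doubling if there are $C,\varepsilon_1,\varepsilon_2>0$ such that $$\left|(2^{-s}I)\times(2^{-t}J)\right|_\mu\le C\,2^{-\varepsilon_1 s-\varepsilon_2 t}\,|I\times J|_\mu\quad\text{for all } s,t>0 \text{ and all cubes } I\subset\mathbb{R}^m,\ J\subset\mathbb{R}^n,$$ where $2^{-s}I$ is the cube concentric with $I$ of side length $2^{-s}\ell(I)$, $\ell(I)$ being the side length of $I$. A dyadic grid $\mathcal{D}^N$ in $\mathbb{R}^N$ is a family of half-open cubes with sides parallel to the axes such that, for some $\lambda>0$, all side lengths are in $\{\lambda2^k\}_{k\in\mathbb{Z}}$; for each $k\in\mathbb{Z}$ the cubes of side length $\lambda2^k$ in the family tile $\mathbb{R}^N$; and any two cubes of the family are either disjoint or one is contained in the other. A partial grid is $\mathcal{R}^{m,n}=\mathcal{D}^m\times\mathcal{D}^n=\{I\times J:I\in\mathcal{D}^m,J\in\mathcal{D}^n\}$ for dyadic grids $\mathcal{D}^m$ in $\mathbb{R}^m$ and $\mathcal{D}^n$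 in $\mathbb{R}^n$. For a partial grid and measurable $f,g\ge0$, $$\mathcal{B}_{\mathcal{D}^m\times\mathcal{D}^n}(f,g)\equiv\sum_{R\in\mathcal{D}^m\times\mathcal{D}^n}K(R)\left(\int_R f\,d\sigma\right)\left(\int_R g\,d\omega\right).$$ Random dyadic grids: for $b=(b_i)_{i\in\mathbb{Z}}$ with $b_i\in\{0,1\}^N$ chosen independently and uniformly, the random dyadic grid in $\mathbb{R}^N$ is $$\mathcal{G}^N_b=\left\{2^{-\ell}\Big([0,1)^N+k+\sum_{i>\ell}2^{-i+\ell}b_i\Big):\ \ell\in\mathbb{Z},\ k\in\mathbb{Z}^N\right\}.$$ $\boldsymbol{E}_{\Omega\times\Omega}$ is expectation over independent choices of such grids in $\mathbb{R}^m$ and in $\mathbb{R}^n$. *)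

(* Defs.v *)
From HB Require Import structures.
From mathcomp Require Import all_boot all_order all_algebra.
From mathcomp Require Import all_classical all_reals all_analysis.
From mathcomp Require Import measurable_realfun.

Set Implicit Arguments.
Unset Strict Implicit.
Unset Printing Implicit Defensive.
Import Order.TTheory GRing.Theory Num.Theory.
Import numFieldTopology.Exports numFieldNormedType.Exports.

Local Open Scope classical_set_scope.
Local Open Scope ring_scope.

(* R^m x R^n with its Borel sigma-algebra, that is, the one generated by the
   open sets of the product topology. *)
Definition borel_prod (R : realType) (m n : nat) : measurableType _ :=
  g_sigma_algebraType (@open ('rV[R]_m * 'rV[R]_n)%type).

Definition conj_exp (R : realType) (p : R) : R := p / (p - 1).

(* Half-open cubes [a_1, a_1 + l) x ... x [a_N, a_N + l), given by a = corner
   and l = side; for 0 < N the correspondence with subsets of R^N is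
   injective. *)
Record cube (R : realType) (N : nat) := Cube {
  corner : 'rV[R]_N;
  side : R;
  side_gt0 : 0 < side }.

HB.instance Definition _ (R : realType) (N : nat) := gen_eqMixin (cube R N).
HB.instance Definition _ (R : realType) (N : nat) := gen_choiceMixin (cube R N).

Definition cube_set (R : realType) (N : nat) (I : cube R N) : set 'rV[R]_N :=
  [set x | forall i, corner I ord0 i <= x ord0 i < corner I ord0 i + side I].

Definition volume (R : realType) (N : nat) (I : cube R N) : R := side I ^+ N.

Lemma volumeE (R : realType) (N : nat) (I : cube R N) :
  (volume I)%:E = (\prod_(i < N) lebesgue_measure
    (`[corner I ord0 i, corner I ord0 i + side I[%classic)%R)%E.
Proof.
under eq_bigr => i _.
  rewrite lebesgue_measure_itv /= lte_fin ltrDl side_gt0 -EFinB addrAC subrr add0r.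
  over.
by rewrite prodEFin prodr_const card_ord.
Qed.

Lemma shrink_gt0 (R : realType) (N : nat) (s : R) (I : cube R N) :
  0 < 2 `^ (- s) * side I.
Proof. by rewrite mulr_gt0 ?powR_gt0 ?side_gt0. Qed.

(* 2^{-s} I: the corner is moved so that the centre of I is kept. *)
Definition shrink (R : realType) (N : nat) (s : R) (I : cube R N) : cube R N :=
  Cube (\row_i (corner I ord0 i + (side I - 2 `^ (- s) * side I) / 2))
       (shrink_gt0 s I).

Definition rect (R : realType) (m n : nat) (I : cube R m) (J : cube R n) :
  set (borel_prod R m n) := cube_set I `*` cube_set J.

Definition locally_finite (R : realType) (m n : nat)
    (mu : {measure set (borel_prod R m n) -> \bar R}) : Prop :=
  forall z : 'rV[R]_m * 'rV[R]_n, exists U : set ('rV[R]_m * 'rV[R]_n),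
    [/\ nbhs z U, measurable (U : set (borel_prod R m n)) & (mu U < +oo)%E].

Definition product_reverse_doubling (R : realType) (m n : nat)
    (mu : {measure set (borel_prod R m n) -> \bar R}) : Prop :=
  exists C e1 e2 : R, [/\ 0 < C, 0 < e1, 0 < e2 &
    forall (s t : R) (I : cube R m) (J : cube R n), 0 < s -> 0 < t ->
      (mu (rect (shrink s I) (shrink t J)) <=
       (C * 2 `^ (- e1 * s - e2 * t))%:E * mu (rect I J))%E].

Definition dyadic_grid (R : realType) (N : nat) (D : set (cube R N)) : Prop :=
  exists lambda : R, [/\ 0 < lambda,
    forall I, D I -> exists k : int, side I = lambda * 2 ^ k,
    forall (k : int) (x : 'rV[R]_N), exists! I : cube R N,
      [/\ D I, side I = lambda * 2 ^ k & cube_set I x] &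
    forall I J, D I -> D J ->
      [\/ cube_set I `&` cube_set J = set0,
          cube_set I `<=` cube_set J | cube_set J `<=` cube_set I]].

Definition dyadic_form (R : realType) (m n : nat)
    (K : cube R m -> cube R n -> R)
    (sigma omega : {measure set (borel_prod R m n) -> \bar R})
    (Dm : set (cube R m)) (Dn : set (cube R n))
    (f g : borel_prod R m n -> \bar R) : \bar R :=
  (\esum_(Q in Dm `*` Dn)
     ((K Q.1 Q.2)%:E * (\int[sigma]_(x in rect Q.1 Q.2) f x)
                     * (\int[omega]_(x in rect Q.1 Q.2) g x)))%E.

(* A probability space carrying independent variables b_i, i : int, uniform
   on {0,1}^N. *)
Record digit_space (R : realType) (N : nat) := DigitSpace {
  ds_disp : measure_display;
  ds_sample : measurableType ds_disp;
  ds_prob : probability ds_sample R;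
  digit : ds_sample -> int -> {ffun 'I_N -> bool};
  digit_measurable : forall i v, measurable [set w | digit w i = v];
  digit_uniform : forall i v,
    ds_prob [set w | digit w i = v] = ((2 ^+ N)^-1)%:E;
  digit_independent : forall (s : seq int) (v : int -> {ffun 'I_N -> bool}),
    uniq s ->
    ds_prob (\bigcap_(i in [set` s]) [set w | digit w i = v i]) =
    (\prod_(i <- s) ds_prob [set w | digit w i = v i])%E }.

(* The sum over i > l of 2^{l-i} b_i, coordinate j, with i = l + t + 1. *)
Definition digit_shift (R : realType) (N : nat)
    (b : int -> {ffun 'I_N -> bool}) (l : int) (j : 'I_N) : R :=
  limn (series (fun t : nat => (2 : R) ^- t.+1 * (b (l + t.+1%:Z) j)%:R)).

Definition shifted_grid (R : realType) (N : nat)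
    (b : int -> {ffun 'I_N -> bool}) : set (cube R N) :=
  [set I | exists (l : int) (k : 'I_N -> int),
    side I = 2 ^ (- l) /\
    corner I = 2 ^ (- l) *: \row_j ((k j)%:~R + digit_shift R b l j)].

(* The joint law of the digits is determined by digit_space, so the choice of
   the two underlying probability spaces is immaterial. The integral of a
   nonnegative function that is not measurable is its lower integral. *)
Definition expectation_inequality (R : realType) (m n : nat)
    (K : cube R m -> cube R n -> R)
    (sigma omega : {measure set (borel_prod R m n) -> \bar R}) : Prop :=
  exists (X : digit_space R m) (Y : digit_space R n) (c : R), 0 < c /\
    forall (Dm : set (cube R m)) (Dn : set (cube R n))
           (f g : borel_prod R m n -> \bar R),
      dyadic_grid Dm -> dyadic_grid Dn ->
      measurable_fun setT f -> measurable_fun [set: borel_prod R m n] g ->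
      (forall x, 0 <= f x)%E -> (forall x, 0 <= g x)%E ->
      (c%:E * dyadic_form K sigma omega Dm Dn f g <=
       \int[ds_prob X \x ds_prob Y]_w
         dyadic_form K sigma omega (shifted_grid (digit w.1))
                                   (shifted_grid (digit w.2)) f g)%E.

Definition fractional_kernel (R : realType) (m n : nat) (alpha beta : R)
    (I : cube R m) (J : cube R n) : R :=
  volume I `^ (alpha / m%:R - 1) * volume J `^ (beta / n%:R - 1).

Definition best_constant (R : realType) (m n : nat) (p q : R)
    (K : cube R m -> cube R n -> R)
    (sigma omega : {measure set (borel_prod R m n) -> \bar R}) : \bar R :=
  ereal_inf [set C : \bar R | (0 <= C)%E /\
    forall (Dm : set (cube R m)) (Dn : set (cube R n))
           (f g : borel_prod R m n -> \bar R),
      dyadic_grid Dm -> dyadic_grid Dn ->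
      measurable_fun setT f -> measurable_fun [set: borel_prod R m n] g ->
      (forall x, 0 <= f x)%E -> (forall x, 0 <= g x)%E ->
      (dyadic_form K sigma omega Dm Dn f g <=
       C * 'N[sigma]_p%:E [f] * 'N[omega]_(conj_exp q)%:E [g])%E].

Definition rect_characteristic (R : realType) (m n : nat) (p q : R)
    (K : cube R m -> cube R n -> R)
    (sigma omega : {measure set (borel_prod R m n) -> \bar R}) : \bar R :=
  ereal_sup [set ((K Q.1 Q.2)%:E * omega (rect Q.1 Q.2) `^ (1 / q)
                   * sigma (rect Q.1 Q.2) `^ (1 / conj_exp p))%E
            | Q in [set: cube R m * cube R n]].

(* Main.v *)
(* In the expectation over random grids the cubes of a given scale are, once the
   digits beyond a finest scale are discarded, equidistributed among all the
   lattice translates of one cube; so the expectation is an average over all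
   lattice cubes and the grid structure disappears. For the fractional kernel a
   cube of a fixed grid is contained in a fixed proportion of the lattice cubes
   of twice its side, which leads to the same average.

   If K(R) <= A |R|_sigma^{-1/p'} |R|_omega^{-1/q}, Young's inequality with an
   exponent a strictly between p and q separates sigma from omega and leaves
     average of |R|_sigma^{a/p} (E_R f)^a  <=  C |f|_{L^p(sigma)}^a.
   In one parameter E_Q f is at most twice the mean over Q of f 1_{E_Q f < 2f},
   and Holder's bound for E_Q f reduces the estimate to the boundedness, for each
   x and tau, of the average over Q containing x of min(|Q|/tau, tau/|Q|)^d. This
   holds because x is deep inside most Q, where reverse doubling applies to cubes
   centred at x. The two-parameter case is iterated: first in x for fixed J, then
   by Minkowski's inequality on the fibres over the atoms of the lattice, which
   inherit reverse doubling in one variable. *)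

Require Import Defs.
From HB Require Import structures.
From mathcomp Require Import all_boot all_order all_algebra.
From mathcomp Require Import all_classical all_reals all_analysis.
From mathcomp Require Import measurable_realfun.
From mathcomp Require Import ring lra zify.
Set Implicit Arguments.
Unset Strict Implicit.
Unset Printing Implicit Defensive.
Import Order.TTheory GRing.Theory Num.Theory.
Import numFieldTopology.Exports numFieldNormedType.Exports.
Local Open Scope classical_set_scope.
Local Open Scope ring_scope.

(** * The discrete embedding *)

(** Averaging over translates is forced: reverse doubling compares concentric cubes only, and along
    the cubes of one grid through a point the mass may stop growing. Lebesgue measure on the
    half-line below 1 is reverse doubling, yet the cubes [0, 2^k), k >= 0, all have mass 1, so for
    them the sum of min(|Q|/tau, tau/|Q|)^d over the scales diverges. The strict inequality p < q
    supplies the decay: with p < a < q both a/p and a'/q' exceed 1, and d may be as large as min(g -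
    1, 1 - 1/p) with g = a/p for sigma, and correspondingly for omega. All estimates are proved for
    finite sums over a mesh of atoms, with constants that do not see the mesh, its origin or the
    number of scales and positions. The mesh can then be fitted to a finite part of a fixed grid,
    while for random grids it is refined to zero and Fatou's lemma concludes. Passing from f to its
    averages over the atoms is free: only integrals of f over unions of atoms enter, and by Jensen's
    inequality the norm does not increase. *)

Section RealInequalities.
Variable R : realType.
Implicit Types p g d t tau M mu E : R.

(** Tangent line of [t ^ p] at 1, read off Young's inequality for the pair (t, 1). Integrated, it
    gives Jensen's inequality, both for finite sums and for integrals. *)
Lemma powR_bernoulli p t : 1 < p -> 0 <= t -> p * t <= t `^ p + (p - 1).
Proof.
move=> p1 t0; have p0 : 0 < p by lra.
have q0 : 0 < p / (p - 1) by rewrite divr_gt0//; lra.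
have e : p^-1 + (p / (p - 1))^-1 = 1 by field; lra.
have := @conjugate_powR R t 1 p (p / (p - 1)) t0 ler01 p0 q0 e.
rewrite mulr1 powR1 mul1r invf_div -mulrDl ler_pdivlMr// => h.
by rewrite mulrC.
Qed.

Lemma powR_le1 d t : 0 <= d -> 0 <= t -> t <= 1 -> t `^ d <= 1.
Proof.
move=> d0 t0 t1; have -> : 1 = 1 `^ d :> R by rewrite powR1.
by rewrite ge0_ler_powR ?nnegrE.
Qed.

Definition balance (d t : R) : R := Num.min t t^-1 `^ d.

Lemma balance_ge0 d t : 0 <= balance d t.
Proof. exact: powR_ge0. Qed.

Lemma balance_le1 d t : 0 <= d -> 0 < t -> balance d t <= 1.
Proof.
move=> d0 t0; have m0 : 0 <= Num.min t t^-1 by rewrite le_min !ltW ?invr_gt0.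
apply: powR_le1 => //.
rewrite ge_min; have [|t1] := leP t 1; first by [].
by rewrite invf_le1 ?ltW// orbT.
Qed.

Lemma balance_small d t : 0 < t -> t <= 1 -> balance d t = t `^ d.
Proof.
by move=> t0 t1; rewrite /balance min_l// (le_trans t1)// -invr1 lef_pV2 ?posrE.
Qed.

Lemma balance_big d t : 1 <= t -> balance d t = t `^ (- d).
Proof.
move=> t1; have t0 : 0 < t by lra.
rewrite /balance min_r ?(le_trans _ t1) ?invf_le1//.
by rewrite -(powR_inv1 (ltW t0)) -powRrM mulN1r.
Qed.

(** Here [mu] and [E] stand for |Q| and E_Q f, and [M] for 2 f(x). By homogeneity only th = mu / tau
    and e = E / M matter: the claim becomes th^(g-1) e^(pg-1) <= balance d th under e <= 1 and th
    e^p <= 1. *)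
Lemma balance_bound p g d tau M mu E :
  1 < p -> 1 < g -> d <= g - 1 -> d <= 1 - p^-1 ->
  0 < tau -> 0 < M -> 0 < mu -> 0 <= E -> E <= M ->
  mu * E `^ p <= tau * M `^ p ->
  mu `^ (g - 1) * E `^ (p * g - 1) <=
  (tau * M `^ p) `^ (g - 1) * M `^ (p - 1) * balance d (mu / tau).
Proof.
move=> p1 g1 dg dp tau0 M0 mu0 E0 EM muE.
have pg1 : 1 < p * g by nra.
have Mp : 0 < M `^ p by rewrite powR_gt0.
set th := mu / tau; set e := E / M.
have th0 : 0 < th by rewrite divr_gt0.
have e0 : 0 <= e by rewrite divr_ge0// ltW.
have e1 : e <= 1 by rewrite ler_pdivrMr// mul1r.
have muth : mu = tau * th by rewrite /th mulrC divfK ?gt_eqF.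
have Ee : E = M * e by rewrite /e mulrC divfK ?gt_eqF.
have the : th * e `^ p <= 1.
  move: muE; rewrite muth Ee powRM ?(ltW M0)// -mulrA ler_pM2l//.
  by rewrite mulrCA -{2}[M `^ p]mulr1 ler_pM2l.
clear muE; clearbody th e.
rewrite muth Ee !powRM ?(ltW th0) ?(ltW tau0) ?(ltW M0) ?(ltW Mp)//.
rewrite -powRrM -!mulrA ler_pM2l ?powR_gt0//.
rewrite [leRHS]mulrA -powRD; last by rewrite (gt_eqF M0) implybT.
have -> : p * (g - 1) + (p - 1) = p * g - 1 by ring.
rewrite mulrCA ler_pM2l ?powR_gt0//.
(* For th <= 1 the power of e is dropped and th^(g-1) <= th^d. For th > 1 the bound e <= th^(-1/p)
   leaves the exponent g - 1 - (pg - 1)/p = -(1 - 1/p). These are the two constraints on d. *)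
have [t1|t1] := leP th 1.
  rewrite balance_small//.
  have e2 : e `^ (p * g - 1) <= 1.
    by apply: powR_le1 => //; lra.
  apply: (@le_trans _ _ (th `^ (g - 1))).
    by rewrite -[leRHS]mulr1 ler_wpM2l// powR_ge0.
  by rewrite ger_powR// th0.
rewrite (balance_big _ (ltW t1)).
have et : e <= th `^ (- p^-1).
  have -> : e = (e `^ p) `^ (p^-1) by rewrite -powRrM mulfV ?powRr1//; lra.
  have -> : th `^ (- p^-1) = (th^-1) `^ (p^-1).
    by rewrite -(powR_inv1 (ltW th0)) -powRrM mulN1r.
  rewrite ge0_ler_powR ?nnegrE ?powR_ge0 ?invr_ge0 ?(ltW th0)//; first lra.
  by rewrite -[leRHS]mul1r ler_pdivlMr// mulrC.
apply: (@le_trans _ _ (th `^ (g - 1) * (th `^ (- p^-1)) `^ (p * g - 1))).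
  by rewrite ler_wpM2l ?powR_ge0// ge0_ler_powR ?nnegrE ?powR_ge0//; lra.
rewrite -powRrM -powRD; last by rewrite (gt_eqF th0) implybT.
have -> : g - 1 + - p^-1 * (p * g - 1) = - (1 - p^-1).
  by field; lra.
by rewrite (ler_powR (ltW t1))//; lra.
Qed.

End RealInequalities.

(** * Embedding inequalities for finite sums *)

Section Embedding.
Variable R : realType.

Lemma powR_split (x a : R) : 0 < x -> x `^ a = x * x `^ (a - 1).
Proof.
move=> x0; rewrite -{2}(powRr1 (ltW x0)) -powRD ?(gt_eqF x0) ?implybT//.
by congr powR; ring.
Qed.

(** Sum the tangent inequality at t = f i / E with weights [mu i], where E is the mean. A zero total
    mass is covered because the quotient is then multiplied by 0. *)
Lemma jensen_powR (I : finType) (P : pred I) (mu f : I -> R) (p : R) :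
  1 < p -> (forall i, 0 <= mu i) -> (forall i, 0 <= f i) ->
  (\sum_(i | P i) mu i) *
    ((\sum_(i | P i) f i * mu i) / (\sum_(i | P i) mu i)) `^ p
  <= \sum_(i | P i) f i `^ p * mu i.
Proof.
move=> p1 mu0 f0; set m := \sum_(i | P i) mu i; set F := \sum_(i | P i) _.
set E := F / m.
have m0 : 0 <= m by apply: sumr_ge0.
have F0 : 0 <= F by apply: sumr_ge0 => i _; rewrite mulr_ge0.
have E0 : 0 <= E by rewrite divr_ge0.
have R0 : 0 <= \sum_(i | P i) f i `^ p * mu i.
  by apply: sumr_ge0 => i _; rewrite mulr_ge0// powR_ge0.
have [mQ|mQ] := eqVneq m 0; first by rewrite mQ mul0r.
have [EQ|EQ] := eqVneq E 0; first by rewrite EQ powR0 ?mulr0//; lra.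
have EQ0 : 0 < E by rewrite lt_neqAle eq_sym EQ E0.
have : \sum_(i | P i) (p * (f i / E) * mu i - (p - 1) * mu i) <=
       \sum_(i | P i) (f i / E) `^ p * mu i.
  apply: ler_sum => x _; rewrite -mulrBl ler_wpM2r// lerBlDr.
  by apply: powR_bernoulli => //; rewrite divr_ge0.
rewrite sumrB -mulr_sumr -/m.
have -> : \sum_(i | P i) p * (f i / E) * mu i = p * m.
  have FE : F = E * m by rewrite /E divfK.
  transitivity (p / E * F); last by rewrite FE; field.
  by rewrite /F mulr_sumr; apply: eq_bigr => x _; ring.
have -> : \sum_(i | P i) (f i / E) `^ p * mu i =
          (\sum_(i | P i) f i `^ p * mu i) / E `^ p.
  rewrite mulr_suml; apply: eq_bigr => x _.
  rewrite powRM// ?invr_ge0// -(powR_inv1 E0) -powRrM mulN1r.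
  by rewrite powRN; ring.
have -> : p * m - (p - 1) * m = m by ring.
by rewrite ler_pdivlMr ?powR_gt0.
Qed.

(** [X] is the set of atoms and [T] a family of cubes. One factor |Q| E_Q f is written as a sum over
    the points where E_Q f < 2 f, the other factors are bounded there by [balance_bound], and after
    exchanging the sums the hypothesis on averages of [balance] applies at each x. *)
Lemma embedding_one (X T : finType) (inc : T -> pred X) (w : T -> R)
    (mu f : X -> R) (p g d C : R) :
  1 < p -> 1 < g -> d <= g - 1 -> d <= 1 - p^-1 ->
  (forall Q, 0 <= w Q) -> (forall x, 0 <= mu x) -> (forall x, 0 <= f x) ->
  (forall x tau, 0 < mu x -> 0 < tau ->
    \sum_(Q | inc Q x) w Q * balance d ((\sum_(y | inc Q y) mu y) / tau) <= C) ->
  \sum_Q w Q * ((\sum_(x | inc Q x) mu x) `^ g *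
    ((\sum_(x | inc Q x) f x * mu x) / (\sum_(x | inc Q x) mu x)) `^ (p * g))
  <= 2 `^ p * C * (\sum_x f x `^ p * mu x) `^ g.
Proof.
move=> p1 g1 dg dp w0 mu0 f0 H.
pose m Q := \sum_(x | inc Q x) mu x.
pose F Q := \sum_(x | inc Q x) f x * mu x.
pose E Q := F Q / m Q.
set N := \sum_x f x `^ p * mu x.
have m0 Q : 0 <= m Q by apply: sumr_ge0.
have fmu0 x : 0 <= f x * mu x by rewrite mulr_ge0.
have F0 Q : 0 <= F Q by apply: sumr_ge0.
have E0 Q : 0 <= E Q by rewrite divr_ge0.
have fpmu0 x : 0 <= f x `^ p * mu x by rewrite mulr_ge0// powR_ge0.
have N0 : 0 <= N by apply: sumr_ge0.
have pg1 : 1 < p * g by nra.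
have pg0 : p * g != 0 by rewrite gt_eqF//; apply: lt_trans pg1.
(* Points with 2 f <= E_Q f carry at most half of the integral over Q. *)
have half Q : F Q <= 2 * \sum_(x | inc Q x && (E Q < 2 * f x)) f x * mu x.
  rewrite {1}/F (bigID (fun x => E Q < 2 * f x))/=.
  set a := \sum_(x | _) _; set b := \sum_(x | _) _.
  suff: 2 * b <= F Q by rewrite /F (bigID (fun x => E Q < 2 * f x))/= -/a -/b; lra.
  have [mQ|mQ] := eqVneq (m Q) 0.
    suff -> : b = 0 by rewrite mulr0.
    rewrite /b big1// => x /andP[ix _].
    move/eqP: mQ; rewrite psumr_eq0// => /allP/(_ x).
    by rewrite mem_index_enum ix/= => /(_ isT)/eqP ->; rewrite mulr0.
  have -> : F Q = E Q * m Q by rewrite /E divfK.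
  rewrite /b mulr_sumr /m mulr_sumr [leRHS](bigID (fun x => E Q < 2 * f x))/=.
  rewrite -[leLHS]add0r lerD//; first by apply: sumr_ge0 => x _; rewrite mulr_ge0.
  apply: ler_sum => x /andP[_]; rewrite -leNgt => h.
  by rewrite mulrA ler_wpM2r.
have jensen Q : m Q * E Q `^ p <= N.
  apply: le_trans (jensen_powR _ p1 _ _) _ => //.
  by rewrite /N [leRHS](bigID (inc Q))/= lerDl sumr_ge0.
have [N00|N00] := eqVneq N 0.
  rewrite N00 powR0 ?mulr0; last lra.
  rewrite big1// => Q _; rewrite -/(m Q) -/(F Q).
  suff -> : F Q = 0 by rewrite mul0r (@powR0 _ (p * g)) ?mulr0.
  rewrite /F big1// => x _; move/eqP: N00; rewrite psumr_eq0// => /allP/(_ x).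
  rewrite mem_index_enum/= => /(_ isT).
  rewrite mulf_eq0 powR_eq0 => /orP[/andP[/eqP-> _]|/eqP->]; first by rewrite mul0r.
  by rewrite mulr0.
have {N00}Np : 0 < N by rewrite lt_neqAle eq_sym N00.
(* [tau x] is chosen so that N = tau (2 f)^p, which turns Jensen's bound |Q| (E_Q f)^p <= N into the
   hypothesis of [balance_bound] with M = 2 f x. The sum of [G] is then 2^(p-1) N^g; the remaining
   factor 2 of the constant comes from [half]. *)
pose G x := f x * mu x * (N `^ (g - 1) * (2 * f x) `^ (p - 1)).
have G0 x : 0 <= G x by rewrite /G !mulr_ge0// powR_ge0.
pose tau x := N / (2 * f x) `^ p.
have tau0 x : 0 < f x -> 0 < tau x.
  by move=> fx; rewrite divr_gt0// powR_gt0//; lra.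
have step Q : m Q `^ g * E Q `^ (p * g) <=
   2 * \sum_(x | inc Q x && (0 < f x * mu x)) G x * balance d (m Q / tau x).
  have R0 : 0 <= 2 * \sum_(x | inc Q x && (0 < f x * mu x)) G x * balance d (m Q / tau x).
    by rewrite mulr_ge0// sumr_ge0// => x _; rewrite mulr_ge0// balance_ge0.
  have [mQ|mQ] := eqVneq (m Q) 0; first by rewrite {1}mQ powR0 ?mul0r// gt_eqF//; lra.
  have [EQ|EQ] := eqVneq (E Q) 0; first by rewrite {1}EQ (@powR0 _ (p * g)) ?mulr0.
  have mQ0 : 0 < m Q by rewrite lt_neqAle eq_sym mQ m0.
  have EQ0 : 0 < E Q by rewrite lt_neqAle eq_sym EQ E0.
  have -> : m Q `^ g * E Q `^ (p * g) = F Q * (m Q `^ (g - 1) * E Q `^ (p * g - 1)).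
    have -> : F Q = m Q * E Q by rewrite /E mulrC divfK.
    by rewrite (powR_split _ mQ0) (powR_split (p * g) EQ0) mulrACA.
  have c0 : 0 <= m Q `^ (g - 1) * E Q `^ (p * g - 1) by rewrite mulr_ge0 ?powR_ge0.
  apply: le_trans (ler_wpM2r c0 (half Q)) _.
  rewrite -mulrA ler_pM2l//.
  rewrite mulr_suml [leRHS]big_mkcondr [leLHS]big_mkcondr/=.
  apply: ler_sum => x _; case: ifPn => Ex; case: ifPn => fx //.
  - have fmux : 0 < f x by move: fx (f0 x) (mu0 x); rewrite le_eqVlt; nra.
    rewrite /G -!mulrA 2?ler_wpM2l// !mulrA.
    have -> : N = tau x * (2 * f x) `^ p by rewrite /tau divfK// gt_eqF// powR_gt0; lra.
    apply: balance_bound => //; first exact: tau0.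
    + lra.
    + exact: ltW.
    + by rewrite /tau divfK; [exact: jensen|rewrite gt_eqF// powR_gt0; lra].
  - have -> : f x * mu x = 0 by apply/eqP; rewrite eq_le fmu0 leNgt fx.
    by rewrite mul0r.
  - by rewrite mulr_ge0// balance_ge0.
apply: (@le_trans _ _ (\sum_Q w Q * (2 * \sum_(x | inc Q x && (0 < f x * mu x)) G x * balance d (m Q / tau x)))).
  by apply: ler_sum => Q _; apply: ler_wpM2l; [exact: w0|exact: step].
have -> : \sum_Q w Q * (2 * \sum_(x | inc Q x && (0 < f x * mu x)) G x * balance d (m Q / tau x))
  = 2 * \sum_(x | 0 < f x * mu x) G x * \sum_(Q | inc Q x) w Q * balance d (m Q / tau x).
  rewrite mulr_sumr.
  under [RHS]eq_bigr do rewrite mulr_sumr mulr_sumr.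
  rewrite (exchange_big_dep predT)//=; apply: eq_bigr => Q _.
  rewrite mulrCA !mulr_sumr; apply: eq_big => x; first by rewrite andbC.
  by move=> _; ring.
have -> : 2 `^ p * C * N `^ g = 2 * \sum_x G x * C.
  rewrite -mulr_suml (powR_split p (ltr0n _ 2))// (powR_split g Np) /G.
  have -> : \sum_x f x * mu x * (N `^ (g - 1) * (2 * f x) `^ (p - 1)) =
            N `^ (g - 1) * 2 `^ (p - 1) * N.
    rewrite {3}/N mulr_sumr; apply: eq_bigr => x _.
    have [->|fx] := eqVneq (f x) 0.
      by rewrite powR0 ?mul0r ?mulr0//; lra.
    have fx0 : 0 < f x by rewrite lt_neqAle eq_sym fx f0.
    by rewrite powRM// (powR_split p fx0); ring.
  by ring.
rewrite ler_pM2l// [leRHS](bigID (fun x => 0 < f x * mu x))/=.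
rewrite [X in _ <= _ + X]big1 ?addr0; last first.
  move=> x; rewrite -leNgt => h.
  have -> : G x = 0; last by rewrite mul0r.
  by rewrite /G (_ : f x * mu x = 0) ?mul0r//; apply/eqP; rewrite eq_le h fmu0.
apply: ler_sum => x fx; rewrite ler_wpM2l//.
have fx0 : 0 < f x by move: fx (f0 x) (mu0 x); rewrite le_eqVlt; nra.
have mux0 : 0 < mu x by move: fx (f0 x) (mu0 x); nra.
by apply: H => //; exact: tau0.
Qed.
(** The triangle inequality in l^g(w): each x contributes a function of P of norm at most D^(1/g) B
    x. It follows from Jensen's inequality for the ratios A x P / B x with weights B x. *)
Lemma minkowski_powR (X T : finType) (w : T -> R) (A : X -> T -> R) (B : X -> R)
    (g D : R) :
  1 < g -> (forall P, 0 <= w P) -> (forall x P, 0 <= A x P) ->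
  (forall x, 0 <= B x) ->
  (forall x, \sum_P w P * A x P `^ g <= D * B x `^ g) ->
  \sum_P w P * (\sum_x A x P) `^ g <= D * (\sum_x B x) `^ g.
Proof.
move=> g1 w0 A0 B0 H; set b := \sum_x B x.
have b0 : 0 <= b by apply: sumr_ge0.
(* Where [B x] vanishes the hypothesis kills the term, so the ratio A / B may take its default value
   0. *)
have Bz x P : B x = 0 -> w P * A x P `^ g = 0.
  move=> Bx; have := H x; rewrite Bx powR0 ?mulr0; last lra.
  move=> h; have h0 Q : 0 <= w Q * A x Q `^ g by rewrite mulr_ge0// powR_ge0.
  have /eqP : \sum_P w P * A x P `^ g = 0 by apply/eqP; rewrite eq_le h sumr_ge0.
  by rewrite psumr_eq0// => /allP/(_ P); rewrite mem_index_enum => /(_ isT)/eqP.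
have [bz|bz] := eqVneq b 0.
  rewrite bz powR0 ?mulr0; last lra.
  rewrite big1// => P _; have [->|wP] := eqVneq (w P) 0; first by rewrite mul0r.
  rewrite big1 ?powR0 ?mulr0//; first lra.
  move=> x _; have Bx : B x = 0.
    move/eqP: bz; rewrite psumr_eq0// => /allP/(_ x).
    by rewrite mem_index_enum => /(_ isT)/eqP.
  by have /eqP := Bz x P Bx; rewrite mulf_eq0 (negPf wP)/= powR_eq0 => /andP[/eqP].
have bp : 0 < b by rewrite lt_neqAle eq_sym bz.
have step P : w P * (\sum_x A x P) `^ g <=
    b `^ (g - 1) * \sum_x w P * A x P `^ g * B x `^ (1 - g).
  have [->|wP] := eqVneq (w P) 0.
    by rewrite mul0r mulr_ge0 ?powR_ge0// sumr_ge0// => x _; rewrite !mul0r.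
  have AB x : A x P = A x P / B x * B x.
    have [Bx|Bx] := eqVneq (B x) 0; last by rewrite divfK.
    have /eqP := Bz x P Bx; rewrite mulf_eq0 (negPf wP)/= powR_eq0.
    by move=> /andP[/eqP-> _]; rewrite !mul0r.
  have f0 x : 0 <= A x P / B x by rewrite divr_ge0.
  have := @jensen_powR X predT B (fun x => A x P / B x) g g1 B0 f0.
  rewrite -/b -(eq_bigr _ (fun x _ => AB x)) => J.
  have -> : (\sum_x A x P) `^ g = b `^ (g - 1) * (b * ((\sum_x A x P) / b) `^ g).
    rewrite mulrA [_ * b]mulrC -powR_split// -powRM// ?divr_ge0// ?sumr_ge0//.
    by rewrite mulrC divfK.
  rewrite mulrCA ler_wpM2l ?powR_ge0//.
  apply: (le_trans (ler_wpM2l (w0 P) J)).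
  rewrite mulr_sumr; apply: ler_sum => x _; rewrite -mulrA ler_wpM2l//.
  have [Bx|Bx] := eqVneq (B x) 0.
    have /eqP := Bz x P Bx; rewrite mulf_eq0 (negPf wP)/= powR_eq0.
    by move=> /andP[/eqP-> _]; rewrite mul0r powR0 ?mul0r//; lra.
  have Bx0 : 0 < B x by rewrite lt_neqAle eq_sym Bx B0.
  rewrite powRM ?invr_ge0// -mulrA ler_wpM2l ?powR_ge0//.
  rewrite -(powR_inv1 (B0 x)) -powRrM mulN1r (powR_split (1 - g) Bx0).
  by have -> : 1 - g - 1 = - g; [ring|rewrite mulrC].
apply: (le_trans (ler_sum _ (fun P _ => step P))).
rewrite -mulr_sumr exchange_big/=.
have -> : b `^ g = b `^ (g - 1) * b by rewrite mulrC -powR_split.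
rewrite mulrCA ler_wpM2l ?powR_ge0// mulr_sumr; apply: ler_sum => x _.
rewrite -mulr_suml; have [Bx|Bx] := eqVneq (B x) 0.
  by rewrite Bx powR0 ?mulr0//; lra.
have Bx0 : 0 < B x by rewrite lt_neqAle eq_sym Bx B0.
apply: (le_trans (ler_wpM2r (powR_ge0 _ _) (H x))).
rewrite -mulrA -powRD ?Bx ?implybT//.
have -> : g + (1 - g) = 1 by ring.
by rewrite powRr1.
Qed.

(** For fixed P, [embedding_one] runs over X with the masses of {x} x P and the averages of f over
    these fibres; this leaves the power g of a sum over x. Minkowski's inequality takes that sum
    out, and [embedding_one] on each row {x} x Y finishes. Each variable costs a factor 2^p C. *)
Lemma embedding_two (X Y S T : finType) (incX : S -> pred X) (incY : T -> pred Y)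
    (v : S -> R) (w : T -> R) (mu f : X -> Y -> R) (p g d C : R) :
  1 < p -> 1 < g -> d <= g - 1 -> d <= 1 - p^-1 -> 0 <= C ->
  (forall Q, 0 <= v Q) -> (forall P, 0 <= w P) ->
  (forall x y, 0 <= mu x y) -> (forall x y, 0 <= f x y) ->
  (forall P x tau, 0 < \sum_(y | incY P y) mu x y -> 0 < tau ->
    \sum_(Q | incX Q x) v Q * balance d
      ((\sum_(x' | incX Q x') \sum_(y | incY P y) mu x' y) / tau) <= C) ->
  (forall x y tau, 0 < mu x y -> 0 < tau ->
    \sum_(P | incY P y) w P * balance d
      ((\sum_(y' | incY P y') mu x y') / tau) <= C) ->
  \sum_Q \sum_P v Q * w P *
    ((\sum_(x | incX Q x) \sum_(y | incY P y) mu x y) `^ g *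
     ((\sum_(x | incX Q x) \sum_(y | incY P y) f x y * mu x y) /
      (\sum_(x | incX Q x) \sum_(y | incY P y) mu x y)) `^ (p * g))
  <= (2 `^ p * C) ^+ 2 * (\sum_x \sum_y f x y `^ p * mu x y) `^ g.
Proof.
move=> p1 g1 dg dp C0 v0 w0 mu0 f0 HX HY.
pose mP P x := \sum_(y | incY P y) mu x y.
pose fP P x := (\sum_(y | incY P y) f x y * mu x y) / mP P x.
have mP0 P x : 0 <= mP P x by apply: sumr_ge0.
have fP0 P x : 0 <= fP P x.
  by rewrite divr_ge0// sumr_ge0// => y _; rewrite mulr_ge0.
have fmP P x : fP P x * mP P x = \sum_(y | incY P y) f x y * mu x y.
  rewrite /fP; have [m0|m0] := eqVneq (mP P x) 0; last by rewrite divfK.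
  rewrite m0 mulr0 big1// => y iy; move/eqP: m0; rewrite psumr_eq0// => /allP/(_ y).
  by rewrite mem_index_enum iy => /(_ isT)/eqP ->; rewrite mulr0.
have D0 : 0 <= 2 `^ p * C by rewrite mulr_ge0 ?powR_ge0.
rewrite exchange_big/=.
apply: (@le_trans _ _ (\sum_P w P * (2 `^ p * C * (\sum_x fP P x `^ p * mP P x) `^ g))).
  apply: ler_sum => P _.
  have := @embedding_one _ _ incX v (mP P) (fP P) p g d C p1 g1 dg dp v0 (mP0 P) (fP0 P) (HX P).
  move=> /(ler_wpM2l (w0 P)); apply: le_trans; rewrite mulr_sumr.
  apply: ler_sum => Q _; rewrite [leRHS]mulrA [w P * v Q]mulrC.
  by rewrite (eq_bigr _ (fun x _ => fmP P x)).
have -> : \sum_P w P * (2 `^ p * C * (\sum_x fP P x `^ p * mP P x) `^ g) =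
  2 `^ p * C * \sum_P w P * (\sum_x fP P x `^ p * mP P x) `^ g.
  by rewrite mulr_sumr; apply: eq_bigr => P _; ring.
rewrite expr2 -[leRHS]mulrA ler_wpM2l//.
apply: minkowski_powR => //.
- by move=> x P; rewrite mulr_ge0// powR_ge0.
- by move=> x; apply: sumr_ge0 => y _; rewrite mulr_ge0// powR_ge0.
move=> x.
have := @embedding_one _ _ incY w (mu x) (f x) p g d C p1 g1 dg dp w0 (mu0 x) (f0 x) (HY x).
apply: le_trans; apply: ler_sum => P _; rewrite ler_wpM2l//.
by rewrite powRM ?powR_ge0// -powRrM mulrC.
Qed.

End Embedding.

(** * Averages over the lattice cubes containing a point *)

Lemma half_twice_le (a b : nat) : (b + a./2 + a./2 <= b + a)%N.
Proof. lia. Qed.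

Section ScaleAverages.
Variable R : realType.

Lemma geometric_sum_le (r : R) (n : nat) :
  0 <= r -> r < 1 -> \sum_(i < n) r ^+ i <= (1 - r)^-1.
Proof.
move=> r0 r1; rewrite -[leRHS]mul1r ler_pdivlMr; last by rewrite subr_gt0.
by rewrite mulrC -opprB mulNr -subrX1 opprB lerBlDr lerDl exprn_ge0.
Qed.

Lemma geometric_half_sum_le (r : R) (n : nat) :
  0 <= r -> r < 1 -> \sum_(i < n) r ^+ i./2 <= 2 / (1 - r).
Proof.
move=> r0 r1.
apply: (@le_trans _ _ (\sum_(i < n.*2) r ^+ i./2)).
  rewrite -addnn big_split_ord/= lerDl sumr_ge0// => i _.
  by rewrite exprn_ge0.
have -> : \sum_(i < n.*2) r ^+ i./2 = 2 * \sum_(i < n) r ^+ i.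
  elim: n => [|n IH]; first by rewrite double0 !big_ord0 mulr0.
  rewrite doubleS !big_ord_recr/= IH uphalf_double doubleK; ring.
by rewrite ler_pM2l// geometric_sum_le.
Qed.

Lemma ord_interval_card (B lo hi : nat) :
  (\sum_(b < B | (lo <= b < hi)%N) 1 = minn B hi - lo)%N.
Proof.
rewrite big_mkcond/=; elim: B => [|B IH]; first by rewrite big_ord0 min0n.
by rewrite big_ord_recr/= IH; case: ifP; lia.
Qed.

Lemma ord_interval_sum (B lo hi : nat) (a : R) : 0 <= a ->
  \sum_(b < B | (lo <= b < hi)%N) a <= (hi - lo)%:R * a.
Proof.
move=> a0; rewrite -[a in leLHS]mul1r -mulr_suml ler_wpM2r//.
have -> : \sum_(b < B | (lo <= b < hi)%N) (1 : R) =
          (\sum_(b < B | (lo <= b < hi)%N) 1)%N%:R by rewrite natr_sum.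
by rewrite ler_nat ord_interval_card leq_sub2r// geq_minr.
Qed.

(** The weight a^m is split evenly over the coordinates, so that counting cube positions reduces to
    one coordinate at a time. *)
Lemma coordinatewise_sum (m B : nat) (pr : 'I_m -> pred 'I_B) (a : R) :
  \sum_(k : {ffun 'I_m -> 'I_B} | [forall c, pr c (k c)]) a ^+ m =
  \prod_(c < m) \sum_(b | pr c b) a.
Proof.
under [RHS]eq_bigr do rewrite big_mkcond.
rewrite bigA_distr_bigA/= big_mkcond/=; apply: eq_bigr => k _.
case: ifPn => [/forallP h|].
  by under eq_bigr do rewrite h; rewrite prodr_const card_ord.
by rewrite negb_forall => /existsP[c /negPf h]; rewrite (bigD1 c)//= h mul0r.
Qed.

(* The atom [x] of the integer lattice and the cube of side [2 ^ j] with corner [k]. *)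
Definition covers (m A B : nat) (j : nat) (k : {ffun 'I_m -> 'I_B})
    (x : {ffun 'I_m -> 'I_A}) : bool :=
  [forall c, (k c <= x c < k c + 2 ^ j)%N].

(** Distance at least 2^i from every face, so that the cube of side 2^(i+1) centred at the atom x
    fits inside. The upper inequality is strict because x stands for the interval [x, x + 1). *)
Definition deep (m A B : nat) (i j : nat) (k : {ffun 'I_m -> 'I_B})
    (x : {ffun 'I_m -> 'I_A}) : bool :=
  [forall c, (k c + 2 ^ i <= x c)%N && (x c + 2 ^ i < k c + 2 ^ j)%N].

Variables (m A B : nat) (x : {ffun 'I_m -> 'I_A}).

Let half0 j : 0 <= (2 : R) ^- j. Proof. by rewrite invr_ge0 exprn_ge0. Qed.

Lemma covers_coord j c :
  \sum_(b < B | (b <= x c < b + 2 ^ j)%N) (2 : R) ^- j <= 1.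
Proof.
apply: (@le_trans _ _ (((x c).+1 - ((x c).+1 - 2 ^ j))%:R * 2 ^- j)).
  apply: le_trans (ord_interval_sum _ _ _ (half0 j)).
  rewrite big_mkcond [leRHS]big_mkcond/=; apply: ler_sum => b _.
  by case: ifPn => h; case: ifPn => // /negP[]; lia.
rewrite ler_pdivrMr ?exprn_gt0// mul1r -natrX ler_nat; lia.
Qed.

Lemma covers_average j :
  \sum_(k : {ffun 'I_m -> 'I_B} | covers j k x) ((2 : R) ^- j) ^+ m <= 1.
Proof.
rewrite (coordinatewise_sum (fun c b => (b <= x c < b + 2 ^ j)%N)).
apply: (@le_trans _ _ (\prod_(c < m) (1 : R))); last by rewrite big1.
by apply: ler_prod => c _; rewrite covers_coord sumr_ge0.
Qed.

(** A union bound over the m coordinates: in the offending coordinate at most 2^i positions put x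
    near the lower face and at most 2^i near the upper one, out of 2^j. *)
Lemma shallow_average i j :
  \sum_(k : {ffun 'I_m -> 'I_B} | covers j k x && ~~ deep i j k x)
    ((2 : R) ^- j) ^+ m <= 2 * m%:R * (2 ^+ i * 2 ^- j).
Proof.
apply: (@le_trans _ _ (\sum_c \sum_(k : {ffun 'I_m -> 'I_B} | covers j k x &&
   ~~ ((k c + 2 ^ i <= x c)%N && (x c + 2 ^ i < k c + 2 ^ j)%N)) ((2 : R) ^- j) ^+ m)).
  under [leRHS]eq_bigr do rewrite big_mkcondr/=.
  rewrite exchange_big/= big_mkcondr/=; apply: ler_sum => k _.
  case: ifPn; last by rewrite sumr_ge0// => *; case: ifP => //; rewrite exprn_ge0.
  rewrite negb_forall => /existsP[c hc]; rewrite (bigD1 c)//= hc lerDl sumr_ge0//.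
  by move=> *; case: ifP => //; rewrite exprn_ge0.
rewrite -mulrA mulrCA mulr_natl -[in leRHS](card_ord m) -sumr_const.
apply: ler_sum => c _.
pose pr (c' : 'I_m) (b : 'I_B) := ((b <= x c' < b + 2 ^ j) &&
  ((c' == c) ==> ~~ ((b + 2 ^ i <= x c') && (x c' + 2 ^ i < b + 2 ^ j))))%N.
rewrite (eq_bigl (fun k : {ffun 'I_m -> 'I_B} => [forall c', pr c' (k c')])); last first.
  move=> k; apply/andP/forallP => [[/forallP h1 h2] c'|h].
    by rewrite /pr h1/=; apply/implyP => /eqP->.
  split; first by apply/forallP => c'; have /andP[] := h c'.
  by have /andP[_] := h c; rewrite eqxx.
rewrite coordinatewise_sum (bigD1 c)//= -[leRHS]mulr1.
apply: ler_pM; rewrite ?sumr_ge0 ?prodr_ge0//.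
- by move=> c' _; rewrite sumr_ge0.
- apply: (@le_trans _ _ (\sum_(b < B | ((x c).+1 - 2 ^ i <= b < (x c).+1)%N) 2 ^- j +
      \sum_(b < B | ((x c).+1 - 2 ^ j <= b < ((x c).+1 + 2 ^ i) - 2 ^ j)%N) 2 ^- j)).
    rewrite big_mkcond [X in _ <= X + _]big_mkcond [X in _ <= _ + X]big_mkcond.
    rewrite -big_split/=; apply: ler_sum => b _.
    rewrite /pr eqxx/=; case: ifPn => [h|h].
      case: ifPn => h1; first by rewrite lerDl; case: ifP.
      case: ifPn => h2; first by rewrite add0r.
      by exfalso; move: h h1 h2; lia.
    by rewrite addr_ge0//; case: ifP.
  rewrite [2 * _](_ : _ = 2 ^+ i * 2 ^- j + 2 ^+ i * 2 ^- j); last by ring.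
  apply: lerD; apply: (le_trans (ord_interval_sum _ _ _ (half0 j)));
    rewrite ler_wpM2r// -natrX ler_nat; lia.
- apply: (@le_trans _ _ (\prod_(c' < m | c' != c) (1 : R))); last by rewrite big1.
  apply: ler_prod => c' c'c; rewrite sumr_ge0//=.
  apply: le_trans (covers_coord j c').
  rewrite big_mkcond [leRHS]big_mkcond/=; apply: ler_sum => b _.
  by rewrite /pr (negPf c'c)/= andbT.
Qed.

Lemma powR_exprn (t d : R) (k : nat) : 0 <= t -> (t ^+ k) `^ d = (t `^ d) ^+ k.
Proof.
move=> t0; elim: k => [|k IH]; first by rewrite !expr0 powR1.
by rewrite !exprS powRM ?exprn_ge0// IH.
Qed.

Lemma balance_le_pow (d t : R) : 0 <= d -> 0 < t -> balance d t <= t `^ d.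
Proof.
move=> d0 t0; have ti0 : 0 <= t^-1 by rewrite invr_ge0 ltW.
by rewrite ge0_ler_powR// ?nnegrE ?ge_min ?lexx// ?le_min ?(ltW t0).
Qed.

Lemma balance_le_powN (d t : R) : 0 <= d -> 0 < t -> balance d t <= t^-1 `^ d.
Proof.
move=> d0 t0; have ti0 : 0 <= t^-1 by rewrite invr_ge0 ltW.
by rewrite ge0_ler_powR// ?nnegrE ?ge_min ?lexx ?orbT// ?le_min ?(ltW t0).
Qed.

(* [phi i] is the mass of the cube of side [2 ^ i] centred at [x]: scales at which
   it is below [tau] contribute geometrically by reverse doubling; at larger
   scales [x] is, except for a small proportion of the positions, so deep inside
   the cube that the latter contains a centred cube of large mass. *)
Lemma balance_average (J : nat) (phi : nat -> R) (D rho d : R)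
    (M : nat -> {ffun 'I_m -> 'I_B} -> R) (tau : R) :
  0 < tau -> 0 < d -> 1 <= D -> 0 <= rho -> rho < 1 ->
  (forall i, 0 < phi i) ->
  (forall i j, (i <= j)%N -> phi i <= D * rho ^+ (j - i) * phi j) ->
  (forall j k, covers j k x -> 0 < M j k <= phi j.+1) ->
  (forall i j k, covers j k x -> deep i j k x -> phi i.+1 <= M j k) ->
  \sum_(j < J) \sum_(k : {ffun 'I_m -> 'I_B} | covers j k x)
     (2 ^- j) ^+ m * balance d (M j k / tau)
  <= (D `^ d + 2 * (D `^ d + 2 * m%:R)) / (1 - Num.max (rho `^ d) 2^-1).
Proof.
move=> tau0 d0 D1 rho0 rho1 phi0 rd Mphi Mdeep.
have D0 : 0 < D by lra.
(* [eta] majorizes both decay rates: th for the masses, 1/2 for the proportion of shallow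
   positions. *)
set th := rho `^ d; set eta := Num.max th 2^-1.
have th0 : 0 <= th by apply: powR_ge0.
have th1 : th < 1.
  rewrite /th; have -> : 1 = 1 `^ d :> R by rewrite powR1.
  by rewrite gt0_ltr_powR ?nnegrE.
have eta0 : 0 <= eta by rewrite le_max th0.
have eta1 : eta < 1 by rewrite gt_max th1/= invf_lt1//; lra.
have the : th <= eta by rewrite le_max lexx.
have he : 2^-1 <= eta by rewrite le_max lexx orbT.
have Dd0 : 0 <= D `^ d by apply: powR_ge0.
pose avg (j : nat) := \sum_(k : {ffun 'I_m -> 'I_B} | covers j k x)
  (2 ^- j) ^+ m * balance d (M j k / tau).
have w0 j : 0 <= ((2 : R) ^- j) ^+ m by rewrite exprn_ge0.
have small j : avg j <= (phi j.+1 / tau) `^ d.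
  have c0 : 0 <= (phi j.+1 / tau) `^ d by apply: powR_ge0.
  rewrite -[leRHS]mul1r; apply: le_trans (ler_wpM2r c0 (covers_average j)).
  rewrite mulr_suml; apply: ler_sum => k ck; rewrite ler_wpM2l//.
  have /andP[M0 Mp] := Mphi j k ck.
  apply: (le_trans (balance_le_pow (ltW d0) _)); first by rewrite divr_gt0.
  rewrite ge0_ler_powR ?nnegrE ?divr_ge0 ?(ltW tau0) ?(ltW d0) ?(ltW (phi0 _)) ?(ltW M0)//.
  by rewrite ler_pM2r ?invr_gt0.
have large i j : avg j <= (tau / phi i.+1) `^ d + 2 * m%:R * (2 ^+ i * 2 ^- j).
  rewrite /avg (bigID (fun k => deep i j k x))/=; apply: lerD.
    have c0 : 0 <= (tau / phi i.+1) `^ d by apply: powR_ge0.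
    rewrite -[leRHS]mul1r; apply: le_trans (ler_wpM2r c0 (covers_average j)).
    rewrite mulr_suml [leRHS](bigID (fun k => deep i j k x))/=.
    rewrite -[leLHS]addr0 lerD//; last by rewrite sumr_ge0// => *; rewrite mulr_ge0.
    apply: ler_sum => k /andP[ck dk]; rewrite ler_wpM2l//.
    have /andP[M0 _] := Mphi j k ck.
    apply: (le_trans (balance_le_powN (ltW d0) _)); first by rewrite divr_gt0.
    rewrite ge0_ler_powR ?nnegrE ?invr_ge0 ?divr_ge0 ?(ltW tau0) ?(ltW d0) ?(ltW (phi0 _)) ?(ltW M0)//.
    by rewrite invf_div ler_pM2l// lef_pV2 ?posrE// Mdeep.
  apply: le_trans (shallow_average i j).
  apply: ler_sum => k /andP[ck _]; rewrite -[leRHS]mulr1 ler_wpM2l//.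
  by have /andP[M0 _] := Mphi j k ck; rewrite balance_le1 ?divr_gt0// ltW.
have decay i j : (i <= j)%N -> (phi i / phi j) `^ d <= D `^ d * th ^+ (j - i).
  move=> ij; have -> : D `^ d * th ^+ (j - i) = (D * rho ^+ (j - i)) `^ d.
    by rewrite powRM ?exprn_ge0 ?(ltW D0)// powR_exprn.
  rewrite ge0_ler_powR ?nnegrE ?divr_ge0 ?mulr_ge0 ?exprn_ge0 ?(ltW d0) ?(ltW (phi0 _)) ?(ltW D0)//.
  by rewrite ler_pdivrMr// rd.
(* [j0] is the first j < J with phi (j + 1) > tau, and J if there is none. The scales before it are
   summed by [small], the others by [large]. *)
pose P j := tau < phi j.+1.
pose j0 := find P (iota 0 J).
have j0J : (j0 <= J)%N by rewrite -[leqRHS](size_iota 0) find_size.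
have below j : (j < j0)%N -> phi j.+1 <= tau.
  move=> jj0; have hP := before_find 0%N jj0.
  rewrite (nth_iota _ _ (leq_trans jj0 j0J)) add0n in hP.
  by rewrite leNgt; move/negbT: hP.
have above : (j0 < J)%N -> tau < phi j0.+1.
  move=> jJ; have hP : has P (iota 0 J) by rewrite has_find size_iota.
  have := nth_find 0%N hP; rewrite -/j0 (nth_iota _ _ jJ) add0n; exact.
clearbody j0.
rewrite -(subnKC j0J).
rewrite big_split_ord/= mulrDl; apply: lerD.
  apply: (@le_trans _ _ (\sum_(j < j0) D `^ d * th ^+ (j0 - j.+1))).
    apply: ler_sum => j _; apply: (le_trans (small j)).
    have j00 : (0 < j0)%N by exact: leq_ltn_trans (leq0n j) (ltn_ord j).
    apply: le_trans (decay j.+1 j0 _); last exact: ltn_ord.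
    rewrite ge0_ler_powR ?nnegrE ?divr_ge0 ?(ltW tau0) ?(ltW d0) ?(ltW (phi0 _))//.
    rewrite ler_pM2l// lef_pV2 ?posrE//.
    by rewrite -(prednK j00) below// prednK.
  rewrite -mulr_sumr ler_wpM2l//.
  have -> : \sum_(j < j0) th ^+ (j0 - j.+1) = \sum_(j < j0) th ^+ j.
    by rewrite (reindex_inj rev_ord_inj)/=; apply: eq_bigr => j _; rewrite subnSK ?subKn// ltnW.
  apply: (le_trans (geometric_sum_le _ th0 th1)).
  by rewrite lef_pV2 ?posrE ?subr_gt0// lerB.
have [jJ|jJ] := ltnP j0 J; last first.
  have -> : (J - j0)%N = 0%N by apply/eqP; rewrite subn_eq0.
  by rewrite big_ord0 divr_ge0 ?subr_ge0 ?(ltW eta1)// mulr_ge0 ?addr_ge0 ?mulr_ge0.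
(* At scale j0 + e the intermediate scale j0 + e/2 is used: the deep positions gain th^(e/2) from
   reverse doubling, the shallow ones have proportion of order 2^(-e/2). With integer halves every
   exponent occurs twice, whence a factor 2. *)
apply: (@le_trans _ _ (\sum_(e < J - j0) (D `^ d + 2 * m%:R) * eta ^+ e./2)).
  apply: ler_sum => e _.
  apply: (le_trans (large (j0 + e./2)%N _)); rewrite [leRHS]mulrDl; apply: lerD.
    apply: (@le_trans _ _ (D `^ d * th ^+ e./2)); last first.
      by rewrite ler_wpM2l// lerXn2r.
    have := decay j0.+1 (j0 + e./2).+1; rewrite subSS addKn ltnS leq_addr.
    move=> /(_ isT)/(le_trans _); apply.
    rewrite ge0_ler_powR ?nnegrE ?divr_ge0 ?(ltW tau0) ?(ltW d0) ?(ltW (phi0 _))//.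
    by rewrite ler_pM2r ?invr_gt0// ltW// above.
  rewrite ler_wpM2l ?mulr_ge0//.
  apply: (@le_trans _ _ (2^-1 ^+ e./2)); last by rewrite lerXn2r ?nnegrE.
  rewrite ler_pdivrMr ?exprn_gt0// exprVn mulrC ler_pdivlMr ?exprn_gt0//.
  by rewrite -exprD ler_eXn2l ?ltr1n// half_twice_le.
rewrite -mulr_sumr [leRHS](_ : _ = (D `^ d + 2 * m%:R) * (2 / (1 - eta))).
  by rewrite ler_wpM2l ?addr_ge0 ?mulr_ge0// geometric_half_sum_le.
by rewrite mulrA [_ * 2]mulrC.
Qed.

End ScaleAverages.

(** * Masses of rectangles and reverse doubling *)

Section SetIntegrals.
Context d (T : measurableType d) (R : realType).
Variables (mu : {measure set T -> \bar R}) (f : T -> \bar R).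
Hypothesis mf : measurable_fun setT f.
Hypothesis f0 : forall x, (0 <= f x)%E.

Let mfD (D : set T) : measurable_fun D f.
Proof. exact: measurable_funS mf. Qed.

(** Dominated convergence with majorant f on B: at each point the indicators of the sets are
    eventually constant. *)
Lemma set_integral_cvg (A_ : (set T)^nat) (A B : set T) :
  (forall k, measurable (A_ k)) -> measurable A -> measurable B ->
  (forall k, A_ k `<=` B) ->
  (\int[mu]_(x in B) f x < +oo)%E ->
  (forall x, \forall k \near \oo, A_ k x <-> A x) ->
  (\int[mu]_(x in A_ k) f x)%E @[k --> \oo] --> (\int[mu]_(x in A) f x)%E.
Proof.
move=> mA_ mA mB AB fB Acvg.
have Bint : mu.-integrable setT (f \_ B).
  apply/integrableP; split.
    exact/(measurable_restrictT f mB).1/mfD.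
  under eq_integral do rewrite gee0_abs ?erestrict_ge0//.
  by rewrite -integral_mkcond.
have [] := @dominated_convergence _ _ _ mu setT measurableT
  (fun k => f \_ (A_ k)) (f \_ A) (f \_ B) _ _ _ Bint.
- by move=> k; exact/(measurable_restrictT f (mA_ k)).1/mfD.
- exact/(measurable_restrictT f mA).1/mfD.
- apply/aeW => x _; apply: cvg_near_cst.
  near=> k; rewrite /patch; suff -> : (x \in A_ k) = (x \in A) by [].
  have e : A_ k x <-> A x by near: k; exact: Acvg.
  by apply/idP/idP => /set_mem/e/mem_set.
- apply/aeW => x k _; rewrite gee0_abs ?erestrict_ge0//.
  rewrite /patch; case: ifPn => [/set_mem/AB/mem_set ->//|_].
  by case: ifP.
move=> _ _; rewrite (integral_mkcond A f).
have -> // : (fun k => \int[mu]_(x in A_ k) f x)%E = (fun k => \int[mu]_x (f \_ (A_ k)) x)%E.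
by apply/funext => k; rewrite integral_mkcond.
Unshelve. all: by end_near. Qed.

Lemma set_integral_packing (I : choiceType) (s : seq I) (F : I -> set T) (A : set T) :
  (forall i, measurable (F i)) -> measurable A -> uniq s ->
  trivIset [set` s] F -> (forall i, i \in s -> F i `<=` A) ->
  (\sum_(i <- s) \int[mu]_(x in F i) f x <= \int[mu]_(x in A) f x)%E.
Proof.
move=> mF mA us tF FA.
have sub : \big[setU/set0]_(i <- s) F i `<=` A.
  by rewrite -bigcup_seq => x [i /= /FA]; apply.
rewrite -ge0_integral_bigsetU//.
apply: ge0_subset_integral => //; exact: bigsetU_measurable.
Qed.

Lemma set_integral_partition (I : choiceType) (s : seq I) (F : I -> set T) (A : set T) :
  (forall i, measurable (F i)) -> uniq s ->
  trivIset [set` s] F -> A = \big[setU/set0]_(i <- s) F i ->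
  (\int[mu]_(x in A) f x = \sum_(i <- s) \int[mu]_(x in F i) f x)%E.
Proof. by move=> mF us tF ->; rewrite ge0_integral_bigsetU. Qed.

End SetIntegrals.

Section Rectangles.
Variables (R : realType) (m n : nat).
Local Notation T := (borel_prod R m n).

Lemma measurable_open_borel (A : set ('rV[R]_m * 'rV[R]_n)) :
  open A -> measurable (A : set T).
Proof. by move=> oA; apply: sub_sigma_algebra. Qed.

Lemma measurable_coord (h : 'rV[R]_m * 'rV[R]_n -> R) (a b : R) :
  continuous h -> measurable ([set z | a <= h z < b] : set T).
Proof.
move=> ch.
have -> : [set z | a <= h z < b] = ~` [set z | h z < a] `&` [set z | h z < b].
  apply/seteqP; split => z /=.
    by move=> /andP[? ?]; split => //; apply/negP; rewrite -leNgt.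
  by move=> [/negP]; rewrite -leNgt => -> ->.
apply: (@measurableI _ T); first apply: (@measurableC _ T).
  apply: measurable_open_borel; apply: (@open_comp _ _ h [set x | x < a]) => [z _|].
    exact: ch.
  exact: open_lt.
apply: measurable_open_borel; apply: (@open_comp _ _ h [set x | x < b]) => [z _|].
  exact: ch.
exact: open_lt.
Qed.

Lemma measurable_rect (I : cube R m) (J : cube R n) : measurable (rect I J).
Proof.
have -> : rect I J =
   (\bigcap_(i in [set: 'I_m]) [set z : T | corner I ord0 i <= z.1 ord0 i < corner I ord0 i + side I]) `&`
   (\bigcap_(i in [set: 'I_n]) [set z : T | corner J ord0 i <= z.2 ord0 i < corner J ord0 i + side J]).
  apply/seteqP; split => [z [h1 h2]|z [h1 h2]].
    by split => i _ /=; [exact: h1|exact: h2].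
  by split => i /=; [exact: h1|exact: h2].
apply: measurableI; apply: fin_bigcap_measurable => // i _; apply: measurable_coord => z.
  apply: (@continuous_comp _ _ _ (@fst 'rV[R]_m 'rV[R]_n) (fun v => v ord0 i)).
    exact: cvg_fst.
  exact: coord_continuous.
apply: (@continuous_comp _ _ _ (@snd 'rV[R]_m 'rV[R]_n) (fun v => v ord0 i)).
  exact: cvg_snd.
exact: coord_continuous.
Qed.

(** The closed box around the rectangle is compact. If the rectangle had infinite mass, the sets
    containing the box up to a set of finite mass would form a proper filter, and a cluster point of
    it would have no neighbourhood of finite mass. *)
Lemma locally_finite_rect (mu : {measure set T -> \bar R}) I J :
  locally_finite mu -> (mu (rect I J) < +oo)%E.
Proof.
move=> /choice[U hU].
pose box N (Q : cube R N) := [set v : 'rV[R]_N | forall i,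
   `[corner Q ord0 i, corner Q ord0 i + side Q]%classic (v ord0 i)].
have cbox N (Q : cube R N) : compact (box N Q).
  by apply: (@rV_compact _ _ (fun i => `[corner Q ord0 i, corner Q ord0 i + side Q]%classic)) => i;
    exact: segment_compact.
rewrite ltNge leye_eq; apply/negP => /eqP rectoo.
pose K := box m I `*` box n J.
pose F : set_system ('rV[R]_m * 'rV[R]_n)%type := [set S | exists V : set T,
  [/\ measurable V, (mu V < +oo)%E & K `\` V `<=` S]].
have FF : ProperFilter F.
  split.
    move=> [V [mV Voo KV]]; suff : (mu (rect I J) <= mu V)%E.
      by rewrite rectoo leye_eq => /eqP Vy; rewrite Vy ltxx in Voo.
    rewrite le_measure ?inE//; first exact: measurable_rect.
    move=> z [z1 z2]; apply: contrapT => nVz; apply: (KV z); split => //.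
    by split => i /=; rewrite in_itv/=; [have := z1 i|have := z2 i];
      move=> /andP[-> /ltW ->].
  split.
  - by exists set0; split => //; rewrite measure0.
  - move=> S1 S2 [V1 [mV1 V1oo h1]] [V2 [mV2 V2oo h2]]; exists (V1 `|` V2); split.
    + exact: measurableU.
    + by apply: (le_lt_trans (measureU2 _ _ _)) => //; rewrite lte_add_pinfty.
    + by move=> z [Kz /not_orP[n1 n2]]; split; [apply: h1|apply: h2].
  - move=> S1 S2 S12 [V [mV Voo h]]; exists V; split => //.
    exact: subset_trans S12.
have FK : F K by exists set0; split; rewrite ?measure0// setD0.
have [z [Kz Fz]] := compact_setX (cbox m I) (cbox n J) FF FK.
have [nU mU Uoo] := hU z.
have FU : F (K `\` U z) by exists (U z); split.
by have [w [[_ nUw] /nUw]] := Fz _ _ FU nU.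
Qed.

End Rectangles.

Section Cubes.
Variables (R : realType) (N : nat).

Lemma cube_eq (I J : cube R N) : corner I = corner J -> side I = side J -> I = J.
Proof.
case: I J => [a l l0] [b k k0]/= ab lk; subst; congr Cube.
exact: bool_irrelevance.
Qed.

Lemma cube_set_sub (I J : cube R N) :
  (forall c, corner J ord0 c <= corner I ord0 c /\
             corner I ord0 c + side I <= corner J ord0 c + side J) ->
  cube_set I `<=` cube_set J.
Proof. by move=> h x Ix c; have [h1 h2] := h c; have /andP[] := Ix c; lra. Qed.

End Cubes.

Section Mass.
Variables (R : realType) (m n : nat).
Local Notation T := (borel_prod R m n).
Implicit Types (I : cube R m) (J : cube R n).

Definition mass (mu : {measure set T -> \bar R}) (f : T -> \bar R) I J : R :=
  fine (\int[mu]_(x in rect I J) f x).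

Variables (mu : {measure set T -> \bar R}) (f : T -> \bar R).
Hypothesis mf : measurable_fun setT f.
Hypothesis f0 : forall x, (0 <= f x)%E.
Hypothesis lf : forall I J, (\int[mu]_(x in rect I J) f x < +oo)%E.

Let mfD (D : set T) : measurable_fun D f.
Proof. exact: measurable_funS mf. Qed.

Lemma massE I J : (mass mu f I J)%:E = (\int[mu]_(x in rect I J) f x)%E.
Proof. by rewrite fineK// ge0_fin_numE// integral_ge0. Qed.

Lemma mass_ge0 I J : 0 <= mass mu f I J.
Proof. by rewrite fine_ge0// integral_ge0. Qed.

Lemma mass_le I J I' J' :
  cube_set I `<=` cube_set I' -> cube_set J `<=` cube_set J' ->
  mass mu f I J <= mass mu f I' J'.
Proof.
move=> sI sJ; rewrite -lee_fin !massE ge0_subset_integral//; try exact: measurable_rect.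
by move=> z [z1 z2]; split; [exact: sI|exact: sJ].
Qed.

Lemma mass_cvg (I_ : nat -> cube R m) (J_ : nat -> cube R n) I J I' J' :
  (forall k, cube_set (I_ k) `<=` cube_set I') ->
  (forall k, cube_set (J_ k) `<=` cube_set J') ->
  (forall x, \forall k \near \oo, cube_set (I_ k) x <-> cube_set I x) ->
  (forall x, \forall k \near \oo, cube_set (J_ k) x <-> cube_set J x) ->
  mass mu f (I_ k) (J_ k) @[k --> \oo] --> mass mu f I J.
Proof.
move=> sI sJ cI cJ; apply: fine_cvg; rewrite fineK; last first.
  by rewrite ge0_fin_numE// integral_ge0.
apply: (@set_integral_cvg _ _ _ mu f mf f0 _ _ (rect I' J')) => //.
- by move=> k; exact: measurable_rect.
- exact: measurable_rect.
- exact: measurable_rect.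
- by move=> k z [z1 z2]; split; [exact: sI z1|exact: sJ z2].
- move=> [x y]; near=> k.
  have eI : cube_set (I_ k) x <-> cube_set I x by near: k; exact: cI.
  have eJ : cube_set (J_ k) y <-> cube_set J y by near: k; exact: cJ.
  by split => -[/= /eI ? /eJ ?].
Unshelve. all: by end_near. Qed.

End Mass.

Section InnerApproximation.
Variables (R : realType) (N : nat) (J : cube R N).
Local Notation a := (corner J).
Local Notation l := (side J).
(** The shift by 2 keeps [eps k] below 1 from k = 0 on, so that [inner k] has positive side. *)
Let eps k : R := k.+2%:R^-1.

Let eps0 k : 0 < eps k. Proof. by rewrite invr_gt0 ltr0n. Qed.
Let eps1 k : eps k < 1. Proof. by rewrite invf_lt1 ?ltr0n// ltr1n. Qed.

Let inner_gt0 k : 0 < l * (1 - eps k).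
Proof. by rewrite mulr_gt0 ?side_gt0// subr_gt0. Qed.
Let outer_gt0 k : 0 < l * (1 + eps k).
Proof. by rewrite mulr_gt0 ?side_gt0// addr_gt0. Qed.

(* [inner k] is the dilate of [outer k] by a factor less than one; it increases to
   [J] while [outer k], which extends beyond [J] only on the closed sides of [J],
   decreases to [J]. *)
Definition inner k : cube R N := Cube a (inner_gt0 k).
Definition outer k : cube R N :=
  Cube (\row_c (a ord0 c - l * eps k)) (outer_gt0 k).

Lemma inner_shrink k : exists2 t : R, 0 < t & inner k = shrink t (outer k).
Proof.
pose u := (1 - eps k) / (1 + eps k).
have ep := eps0 k; have e1 := eps1 k.
have u0 : 0 < u by rewrite divr_gt0; lra.
have u1 : u < 1 by rewrite ltr_pdivrMr; lra.
have ln2 : 0 < ln 2 :> R by rewrite ln_gt0// ltr1n.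
(* This t solves 2^(-t) = u. The centres agree because [outer k] extends l eps below J and [inner k]
   stops l eps short of its upper end. *)
exists (- ln u / ln 2).
  by rewrite divr_gt0// oppr_gt0 ln_lt0// u0.
have e : 2 `^ (- (- ln u / ln 2)) = u.
  rewrite /powR pnatr_eq0/= (_ : - (- ln u / ln 2) * ln 2 = ln u) ?lnK//.
  by field; rewrite gt_eqF.
have e2 : u * (l * (1 + eps k)) = l * (1 - eps k).
  by rewrite /u; field; lra.
apply: cube_eq; rewrite /= e e2//.
by apply/rowP => c; rewrite !mxE; field.
Qed.

Lemma inner_sub k : cube_set (inner k) `<=` cube_set J.
Proof.
have ep := eps0 k; have e1 := eps1 k; have l0 := side_gt0 J.
by apply: cube_set_sub => c /=; split; [|nra].
Qed.

Definition doubled_gt0 : 0 < 2 * l := mulr_gt0 (ltr0n _ 2) (side_gt0 J).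

Lemma outer_sub k : cube_set (outer k) `<=`
  cube_set (Cube (\row_c (a ord0 c - l)) doubled_gt0).
Proof.
have ep := eps0 k; have e1 := eps1 k; have l0 := side_gt0 J.
by apply: cube_set_sub => c /=; rewrite !mxE; split; nra.
Qed.

Let eps_small (e : R) : 0 < e -> \forall k \near \oo, l * eps k < e.
Proof.
move=> e0; have l0 := side_gt0 J; have el : 0 < e / l by rewrite divr_gt0.
near=> k; rewrite mulrC -ltr_pdivlMr//.
apply: (@le_lt_trans _ _ (k.+1%:R^-1)); first by rewrite lef_pV2 ?posrE ?ltr0n// ler_nat.
by near: k; exact: (near_infty_natSinv_lt (PosNum el)).
Unshelve. all: by end_near. Qed.

Lemma inner_cvg x : \forall k \near \oo, cube_set (inner k) x <-> cube_set J x.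
Proof.
have [Jx|nJx] := pselect (cube_set J x); last first.
  by apply: nearW => k; split => [/inner_sub|].
near=> k; split => // _; near: k.
apply: filter_forall => c; have /andP[h1 h2] := Jx c.
have := @eps_small (a ord0 c + l - x ord0 c); rewrite subr_gt0 => /(_ h2) h.
by near=> k; have : l * eps k < a ord0 c + l - x ord0 c; [near: k|move=> h3 /=; lra].
Unshelve. all: by end_near. Qed.

Lemma outer_cvg x : \forall k \near \oo, cube_set (outer k) x <-> cube_set J x.
Proof.
have l0 := side_gt0 J.
have [Jx|nJx] := pselect (cube_set J x).
  apply: nearW => k; split => // _ c; have := Jx c; have ep := eps0 k.
  by rewrite /= mxE; nra.
have [c nc] : exists c, ~~ (a ord0 c <= x ord0 c < a ord0 c + l).
  by apply/existsP; rewrite -negb_forall; apply/negP => /forallP.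
have [h|h] := ltP (x ord0 c) (a ord0 c); last first.
  apply: nearW => k; split => // /(_ c); move: nc; rewrite h/= -leNgt mxE; nra.
have := @eps_small (a ord0 c - x ord0 c); rewrite subr_gt0 => /(_ h) h1.
near=> k; split => // /(_ c); rewrite /= mxE => /andP[h2 _].
have : l * eps k < a ord0 c - x ord0 c by near: k.
lra.
Unshelve. all: by end_near. Qed.

End InnerApproximation.

(** * Reverse doubling in one variable *)

Section OneVariable.
Variables (R : realType) (m n : nat).
Local Notation T := (borel_prod R m n).
Variable mu : {measure set T -> \bar R}.
Hypothesis lf : locally_finite mu.
Local Notation rmass := (mass mu (cst 1%E)).

Lemma integral_one (A : set T) : measurable A -> (\int[mu]_(x in A) cst 1%E x = mu A)%E.
Proof. by move=> mA; rewrite integral_cst// mul1e. Qed.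

Lemma rmassE I J : (rmass I J)%:E = mu (rect I J).
Proof.
rewrite /mass (integral_one (measurable_rect I J)) fineK// ge0_fin_numE//.
exact: locally_finite_rect.
Qed.

Lemma mass_eq0 f I J : measurable_fun setT f -> rmass I J = 0 -> mass mu f I J = 0.
Proof.
move=> mf s0; rewrite /mass null_set_integral//.
- exact: measurable_rect.
- exact: measurable_funS mf.
- by rewrite -rmassE s0.
Qed.

Lemma rmass_lf I J : (\int[mu]_(x in rect I J) cst 1%E x < +oo)%E.
Proof. by rewrite integral_one; [exact: locally_finite_rect|exact: measurable_rect]. Qed.

Let one0 (x : T) : (0 <= cst 1%E x :> \bar R)%E. Proof. exact: lee01. Qed.
Let mone : measurable_fun [set: T] (cst 1%E : T -> \bar R). Proof. exact: measurable_cst. Qed.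

Let near_const N (I : cube R N) x :
  \forall k \near \oo, (fun _ : nat => cube_set I x) k <-> cube_set I x.
Proof. exact: nearW. Qed.

(* In each variable separately: the definition requires both cubes to shrink
   strictly, and the half-open cube kept fixed is exhausted by its inner cubes. *)
Lemma one_variable_reverse_doubling :
  product_reverse_doubling mu ->
  exists C e1 e2 : R, [/\ 1 <= C, 0 < e1, 0 < e2,
    forall s I J, 0 < s -> rmass (shrink s I) J <= C * 2 `^ (- e1 * s) * rmass I J &
    forall s I J, 0 < s -> rmass I (shrink s J) <= C * 2 `^ (- e2 * s) * rmass I J].
Proof.
move=> [C0 [e1 [e2 [C00 e10 e20 rd0]]]].
(* A constant at least 1 also covers equal scales, where nothing is gained. *)
pose C := Num.max C0 1.
have C1 : 1 <= C by rewrite le_max lexx orbT.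
have CC : C0 <= C by rewrite le_max lexx.
have rd s t I J : 0 < s -> 0 < t ->
    rmass (shrink s I) (shrink t J) <= C * 2 `^ (- e1 * s - e2 * t) * rmass I J.
  move=> s0 t0; rewrite -lee_fin EFinM !rmassE; apply: (le_trans (rd0 s t I J s0 t0)).
  by apply: lee_wpmul2r => //; rewrite lee_fin ler_wpM2r// powR_ge0.
have exp_le (x y : R) : 0 <= y -> 2 `^ (x - y) <= 2 `^ x :> R.
  by move=> y0; rewrite ler_powR ?ler1n//; lra.
exists C, e1, e2; split => // s I J s0.
- have cv1 := mass_cvg mone one0 rmass_lf (I_ := fun=> shrink s I)
    (fun k => @subset_refl _ _) (@inner_sub _ _ J)
    (near_const _) (@inner_cvg _ _ J).
  have cv2 := mass_cvg mone one0 rmass_lf (I_ := fun=> I)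
    (fun k => @subset_refl _ _) (@outer_sub _ _ J)
    (near_const _) (@outer_cvg _ _ J).
  apply: (ler_cvg_to cv1 (cvgMl_tmp cv2)).
  (* For each k the definition applies to [inner k], a strict shrinking of [outer k]; the gain in t,
     which degenerates as k grows, is bounded by 1. *)
  apply: nearW => k; have [t t0 ->] := inner_shrink J k.
  apply: (le_trans (rd s t I _ s0 t0)).
  rewrite ler_wpM2r ?mass_ge0// ler_wpM2l//; first lra.
  by apply: exp_le; rewrite mulr_ge0// ltW.
- have cv1 := mass_cvg mone one0 rmass_lf (J_ := fun=> shrink s J)
    (@inner_sub _ _ I) (fun k => @subset_refl _ _) (@inner_cvg _ _ I)
    (near_const _).
  have cv2 := mass_cvg mone one0 rmass_lf (J_ := fun=> J)
    (@outer_sub _ _ I) (fun k => @subset_refl _ _) (@outer_cvg _ _ I)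
    (near_const _).
  apply: (ler_cvg_to cv1 (cvgMl_tmp cv2)).
  apply: nearW => k; have [t t0 ->] := inner_shrink I k.
  apply: (le_trans (rd t s _ J t0 s0)).
  rewrite ler_wpM2r ?mass_ge0// ler_wpM2l//; first lra.
  have -> : - e1 * t - e2 * s = - e2 * s - e1 * t by ring.
  by apply: exp_le; rewrite mulr_ge0// ltW.
Qed.

End OneVariable.

Section Lattice.
Variables (R : realType) (N : nat) (v : 'rV[R]_N) (h : R) (h0 : 0 < h).

Lemma lattice_side_gt0 (j : nat) : 0 < h * 2 ^+ j.
Proof. by rewrite mulr_gt0 ?exprn_gt0. Qed.

Definition lattice_cube (j : nat) (k : 'I_N -> nat) : cube R N :=
  Cube (\row_c (v ord0 c + h * (k c)%:R)) (lattice_side_gt0 j).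

(* The cube of side [h 2 ^ i] concentric with the atom [lattice_cube 0 x]. *)
Definition centred_cube (i : nat) (x : 'I_N -> nat) : cube R N :=
  Cube (\row_c (v ord0 c + h * ((x c)%:R + 2^-1 - 2 ^+ i / 2)))
       (lattice_side_gt0 i).

Lemma centred_cube0 x : centred_cube 0 x = lattice_cube 0 x.
Proof.
apply: cube_eq => //=; apply/rowP => c; rewrite !mxE expr0; congr (_ + _ * _).
by rewrite mul1r addrK.
Qed.

Lemma centred_cube_shrink i j x : (i <= j)%N ->
  centred_cube i x = shrink (j - i)%:R (centred_cube j x).
Proof.
move=> ij.
have e : 2 `^ (- (j - i)%:R) * (h * 2 ^+ j) = h * 2 ^+ i :> R.
  have -> : h * 2 ^+ j = 2 ^+ (j - i) * (h * 2 ^+ i) by rewrite mulrCA -exprD subnK.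
  by rewrite powRN powR_mulrn// mulKf// expf_neq0// pnatr_eq0.
apply: cube_eq; rewrite /= e//.
by apply/rowP => c; rewrite !mxE; field.
Qed.

(** A cube of side 2^j through the atom x reaches less than 2^j mesh units from the centre of x;
    this accounts for the index j + 1 in [balance_average]. *)
Lemma lattice_sub_centred j (k x : 'I_N -> nat) :
  (forall c, (k c <= x c < k c + 2 ^ j)%N) ->
  cube_set (lattice_cube j k) `<=` cube_set (centred_cube j.+1 x).
Proof.
move=> kx; apply: cube_set_sub => c /=; rewrite !mxE.
have /andP[k1 k2] := kx c.
have h1 : ((k c)%:R : R) <= (x c)%:R by rewrite ler_nat.
have h2 : ((x c)%:R : R) + 1 <= (k c)%:R + 2 ^+ j.
  by rewrite -natrX -natrD natr1 ler_nat.
rewrite exprS.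
split; last rewrite -!addrA -mulrDr; rewrite lerD2l ?ler_pM2l//; last first.
  by rewrite -mulrDr ler_pM2l//; lra.
lra.
Qed.

Lemma centred_sub_lattice i j (k x : 'I_N -> nat) :
  (forall c, (k c + 2 ^ i <= x c)%N && (x c + 2 ^ i < k c + 2 ^ j)%N) ->
  cube_set (centred_cube i.+1 x) `<=` cube_set (lattice_cube j k).
Proof.
move=> kx; apply: cube_set_sub => c /=; rewrite !mxE.
have /andP[k1 k2] := kx c.
have h1 : ((k c)%:R : R) + 2 ^+ i <= (x c)%:R by rewrite -natrX -natrD ler_nat.
have h2 : ((x c)%:R : R) + 2 ^+ i + 1 <= (k c)%:R + 2 ^+ j.
  by rewrite -!natrX -!natrD natr1 ler_nat.
rewrite exprS; split; first by rewrite lerD2l ler_pM2l//; lra.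
by rewrite -!addrA -!mulrDr lerD2l ler_pM2l//; lra.
Qed.

End Lattice.

(** * The embedding for lattice rectangles *)

Section SetIntegralJensen.
Context d (T : measurableType d) (R : realType).
Variables (mu : {measure set T -> \bar R}) (f : T -> \bar R) (p : R).
Hypotheses (mf : measurable_fun setT f) (f0 : forall x, (0 <= f x)%E) (p1 : 1 < p).

Let mfD (D : set T) : measurable_fun D f.
Proof. exact: measurable_funS mf. Qed.

Lemma measurable_abse_poweR (D : set T) :
  measurable_fun D (fun x => `|f x| `^ p)%E.
Proof.
apply: measurable_funS (measurableT) (@subsetT _ _) _.
apply: (measurableT_comp (measurable_poweR p)).
exact: (measurableT_comp (@abse_measurable R setT) mf).
Qed.

Let mfp := measurable_abse_poweR.

Let p0 : 0 < p. Proof. exact: lt_trans p1. Qed.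
Let pm1 : 0 <= p - 1. Proof. by rewrite subr_ge0 ltW. Qed.

Lemma poweR_bernoulli (E : R) (x : \bar R) : 0 < E -> (0 <= x)%E ->
  ((p * E `^ (p - 1))%:E * x <= `|x| `^ p + ((p - 1) * E `^ p)%:E)%E.
Proof.
move=> E0 x0; rewrite gee0_abs//; case: x x0 => [x x0| _|//]; last first.
  by rewrite poweRE (gt_eqF (lt_trans ltr01 p1)) eqxx addye// leey.
rewrite poweR_EFin -EFinM -EFinD lee_fin; rewrite lee_fin in x0.
have hb := powR_bernoulli p1 (divr_ge0 x0 (ltW E0)).
have Ep : 0 < E `^ p by rewrite powR_gt0.
have -> : p * E `^ (p - 1) * x = p * (x / E) * E `^ p.
  by rewrite (powR_split p E0); field; rewrite gt_eqF.
have xE : (x / E) `^ p * E `^ p = x `^ p.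
  by rewrite -powRM ?divr_ge0 ?(ltW E0)// divfK ?gt_eqF.
by rewrite -(ler_pM2r Ep) mulrDl xE in hb.
Qed.

(** The tangent at 1 dominates p f by |f|^p + p - 1, which is integrable over a set of finite
    mass. *)
Lemma set_integral_lfin (A : set T) : measurable A -> (mu A < +oo)%E ->
  (\int[mu]_x `|f x| `^ p < +oo)%E -> (\int[mu]_(x in A) f x < +oo)%E.
Proof.
move=> mA muA fp.
rewrite -(lte_pmul2l (_ : p%:E \is a fin_num)) ?lte_fin// gt0_muley ?lte_fin//.
rewrite -ge0_integralZl// ?lee_fin ?(ltW p0)//.
apply: (@le_lt_trans _ _ (\int[mu]_(x in A) (`|f x| `^ p + (p - 1)%:E))%E).
  apply: ge0_le_integral => //.
  - by move=> x _; rewrite mule_ge0// lee_fin ltW.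
  - exact: measurable_funeM.
  - by apply: emeasurable_funD => //; exact: measurable_cst.
  - move=> x _; have := @poweR_bernoulli 1 (f x) ltr01 (f0 x).
    by rewrite !powR1 !mulr1.
have -> : (\int[mu]_(x in A) (`|f x| `^ p + (p - 1)%:E) =
  \int[mu]_(x in A) `|f x| `^ p + \int[mu]_(x in A) (cst (p - 1)%:E) x)%E.
  by rewrite ge0_integralD// => x _; rewrite poweR_ge0.
rewrite lte_add_pinfty//.
  apply: le_lt_trans fp; apply: ge0_subset_integral => //.
  by move=> x _; rewrite poweR_ge0.
by rewrite integral_cst// lte_mul_pinfty ?lee_fin.
Qed.

Lemma set_integral_jensen (A : set T) (s F : R) : measurable A -> 0 < s ->
  mu A = s%:E -> (\int[mu]_(x in A) f x)%E = F%:E ->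
  (((F / s) `^ p * s)%:E <= \int[mu]_(x in A) `|f x| `^ p)%E.
Proof.
move=> mA s0 muA intA.
have F0 : 0 <= F by rewrite -lee_fin -intA integral_ge0.
have I0 : (0 <= \int[mu]_(x in A) `|f x| `^ p)%E.
  by rewrite integral_ge0// => x _; rewrite poweR_ge0.
have [->|Fn] := eqVneq F 0; first by rewrite mul0r powR0 ?mul0r// gt_eqF.
have Fp : 0 < F by rewrite lt_neqAle eq_sym Fn.
set E := F / s; have E0 : 0 < E by rewrite divr_gt0.
have : (\int[mu]_(x in A) ((p * E `^ (p - 1))%:E * f x) <=
    \int[mu]_(x in A) (`|f x| `^ p + ((p - 1) * E `^ p)%:E))%E.
  apply: ge0_le_integral => //.
  - by move=> x _; rewrite mule_ge0// lee_fin mulr_ge0 ?powR_ge0// ?(ltW p0).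
  - exact: measurable_funeM.
  - by apply: emeasurable_funD => //; exact: measurable_cst.
  - by move=> x _; exact: poweR_bernoulli.
rewrite ge0_integralZl//; last by rewrite lee_fin mulr_ge0 ?powR_ge0// ?(ltW p0).
have -> : (\int[mu]_(x in A) (`|f x| `^ p + ((p - 1) * E `^ p)%:E) =
  \int[mu]_(x in A) `|f x| `^ p + \int[mu]_(x in A) (cst ((p - 1) * E `^ p)%:E) x)%E.
  by rewrite ge0_integralD// => x _; rewrite ?poweR_ge0// lee_fin mulr_ge0 ?powR_ge0.
rewrite integral_cst// muA intA.
case: (\int[mu]_(x in A) _)%E I0 => [r _| _ _|//]; last by rewrite leey.
rewrite -!EFinM -EFinD !lee_fin.
have FE : F = E * s by rewrite /E divfK ?gt_eqF.
by rewrite {1}FE (powR_split p E0); lra.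
Qed.

End SetIntegralJensen.

Definition nats (N B : nat) (k : {ffun 'I_N -> 'I_B}) : 'I_N -> nat :=
  fun c => k c.
Arguments nats N B k /.

Section LatticePartition.
Variables (R : realType) (N : nat) (v : 'rV[R]_N) (h : R) (h0 : 0 < h).
Local Notation cubeat := (lattice_cube v h0).

Lemma atom_inj (A : nat) (x y : {ffun 'I_N -> 'I_A}) z :
  cube_set (cubeat 0 (nats x)) z -> cube_set (cubeat 0 (nats y)) z -> x = y.
Proof.
move=> hx hy; apply/ffunP => c; apply: val_inj; apply/eqP.
have := hx c; have := hy c; rewrite /= !mxE expr0 mulr1.
move=> /andP[a1 a2] /andP[b1 b2].
have h1 : h * (x c)%:R < h * (y c).+1%:R by rewrite -natr1 mulrDr mulr1; lra.
have h2 : h * (y c)%:R < h * (x c).+1%:R by rewrite -natr1 mulrDr mulr1; lra.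
by move: h1 h2; rewrite !ltr_pM2l// !ltr_nat; lia.
Qed.

Lemma atom_sub (A B j : nat) (k : {ffun 'I_N -> 'I_B}) (x : {ffun 'I_N -> 'I_A}) :
  covers j k x -> cube_set (cubeat 0 (nats x)) `<=` cube_set (cubeat j (nats k)).
Proof.
move=> /forallP kx; apply: cube_set_sub => c /=; rewrite !mxE expr0 mulr1.
have /andP[k1 k2] := kx c.
have h1 : ((k c)%:R : R) <= (x c)%:R by rewrite ler_nat.
have h2 : ((x c)%:R : R) + 1 <= (k c)%:R + 2 ^+ j.
  by rewrite -natrX -natrD natr1 ler_nat.
split; first by rewrite lerD2l ler_pM2l.
by rewrite -!addrA lerD2l -{2}[h]mulr1 -!mulrDr ler_pM2l.
Qed.

Variables (J B A : nat).
Hypothesis BA : (B + 2 ^ J <= A)%N.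

(** The atom is found by rounding down the coordinates of z in mesh units. [BA] leaves room in
    ['I_A] for all atoms of a cube with corner below B and side below 2^J. *)
Lemma lattice_cover (j : 'I_J) (k : {ffun 'I_N -> 'I_B}) z :
  cube_set (cubeat j (nats k)) z ->
  exists x : {ffun 'I_N -> 'I_A}, covers j k x /\ cube_set (cubeat 0 (nats x)) z.
Proof.
move=> kz.
pose t c := (z ord0 c - v ord0 c) / h.
have tz c : z ord0 c = v ord0 c + h * t c by rewrite /t mulrC divfK ?gt_eqF// addrC subrK.
have kt c : ((k c)%:R <= t c) && (t c < (k c)%:R + 2 ^+ j).
  have := kz c; rewrite /= !mxE tz -addrA -mulrDr !lerD2l ltrD2l ler_pM2l//.
  by rewrite ltr_pM2l.
have t0 c : 0 <= t c by have /andP[+ _] := kt c; apply: le_trans.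
have xk c : (k c <= Num.truncn (t c) < k c + 2 ^ j)%N.
  have /andP[h1 h2] := truncn_itv (t0 c); have /andP[h3 h4] := kt c.
  rewrite -ltnS -!(ltr_nat R) natrD natrX (le_lt_trans h3 h2)/=.
  exact: le_lt_trans h4.
have xA c : (Num.truncn (t c) < A)%N.
  have /andP[_ h2] := xk c; have := ltn_ord (k c).
  have : (2 ^ j <= 2 ^ J)%N by rewrite leq_exp2l// ltnW.
  lia.
exists [ffun c => Ordinal (xA c)]; split.
  by apply/forallP => c; rewrite ffunE.
move=> c; rewrite /= !mxE ffunE/= tz expr0 mulr1 lerD2l ler_pM2l//.
rewrite -addrA ltrD2l -{3}[h]mulr1 -mulrDr ltr_pM2l// natr1.
exact: truncn_itv.
Qed.

End LatticePartition.

Section MassPartition.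
Variables (R : realType) (m n : nat).
Local Notation T := (borel_prod R m n).
Variables (mu : {measure set T -> \bar R}) (f : T -> \bar R).
Hypothesis mf : measurable_fun setT f.
Hypothesis f0 : forall x, (0 <= f x)%E.
Hypothesis lf : forall I J, (\int[mu]_(x in rect I J) f x < +oo)%E.

Lemma mass_partition (I : finType) (P : pred I) (F : I -> cube R m * cube R n)
    (Q : cube R m * cube R n) :
  (forall i j z, P i -> P j -> rect (F i).1 (F i).2 z -> rect (F j).1 (F j).2 z -> i = j) ->
  (forall i, P i -> rect (F i).1 (F i).2 `<=` rect Q.1 Q.2) ->
  (forall z, rect Q.1 Q.2 z -> exists2 i, P i & rect (F i).1 (F i).2 z) ->
  mass mu f Q.1 Q.2 = \sum_(i | P i) mass mu f (F i).1 (F i).2.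
Proof.
move=> inj sub cov; apply: EFin_inj.
rewrite -sumEFin massE//; under [RHS]eq_bigr do rewrite massE//.
rewrite -big_filter.
apply: set_integral_partition => //.
- by move=> i; exact: measurable_rect.
- by rewrite filter_uniq// index_enum_uniq.
- apply/trivIsetP => i j /=; rewrite !mem_filter => /andP[Pi _] /andP[Pj _] /eqP ij.
  by apply/seteqP; split => // z [zi zj]; apply: ij; exact: (inj _ _ z).
apply/seteqP; split => z.
  move=> /cov[i Pi zi]; rewrite -bigcup_seq; exists i => //=.
  by rewrite mem_filter Pi mem_index_enum.
by rewrite -bigcup_seq => -[i /=]; rewrite mem_filter => /andP[Pi _]; exact: sub.
Qed.

Lemma mass_packing (s : seq (cube R m * cube R n)) (Q : cube R m * cube R n) :
  uniq s ->
  (forall i j z, i \in s -> j \in s -> rect i.1 i.2 z -> rect j.1 j.2 z -> i = j) ->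
  (forall i, i \in s -> rect i.1 i.2 `<=` rect Q.1 Q.2) ->
  \sum_(i <- s) mass mu f i.1 i.2 <= mass mu f Q.1 Q.2.
Proof.
move=> us inj sub; rewrite -lee_fin.
rewrite -sumEFin massE//; under eq_bigr do rewrite massE//.
apply: set_integral_packing => //.
- by move=> i; exact: measurable_rect.
- exact: measurable_rect.
- apply/trivIsetP => i j /= si sj /eqP ij.
  by apply/seteqP; split => // z [zi zj]; apply: ij; exact: (inj _ _ z).
Qed.

Variables (J B A : nat).
Hypothesis BA : (B + 2 ^ J <= A)%N.

Lemma mass_partition_left (v : 'rV[R]_m) (h : R) (h0 : 0 < h) (j : 'I_J)
    (k : {ffun 'I_m -> 'I_B}) (P : cube R n) :
  mass mu f (lattice_cube v h0 j (nats k)) P =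
  \sum_(x : {ffun 'I_m -> 'I_A} | covers j k x) mass mu f (lattice_cube v h0 0 (nats x)) P.
Proof.
apply: (@mass_partition _ (fun x : {ffun 'I_m -> 'I_A} => covers j k x)
  (fun x => (lattice_cube v h0 0 (nats x), P)) (lattice_cube v h0 j (nats k), P)) => /=.
- by move=> x y z _ _ [zx _] [zy _]; exact: atom_inj zx zy.
- by move=> x kx z [zx zP]; split => //; exact: (atom_sub kx) zx.
- by move=> z [/(lattice_cover BA)[x [kx zx]] zP]; exists x.
Qed.

Lemma mass_partition_right (v : 'rV[R]_n) (h : R) (h0 : 0 < h) (j : 'I_J)
    (k : {ffun 'I_n -> 'I_B}) (P : cube R m) :
  mass mu f P (lattice_cube v h0 j (nats k)) =
  \sum_(x : {ffun 'I_n -> 'I_A} | covers j k x) mass mu f P (lattice_cube v h0 0 (nats x)).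
Proof.
apply: (@mass_partition _ (fun x : {ffun 'I_n -> 'I_A} => covers j k x)
  (fun x => (P, lattice_cube v h0 0 (nats x))) (P, lattice_cube v h0 j (nats k))) => /=.
- by move=> x y z _ _ [_ zx] [_ zy]; exact: atom_inj zx zy.
- by move=> x kx z [zP zx]; split => //; exact: (atom_sub kx) zx.
- by move=> z [zP /(lattice_cover BA)[x [kx zx]]]; exists x.
Qed.

End MassPartition.

Section LatticeEmbedding.
Variables (R : realType) (m n : nat).
Local Notation T := (borel_prod R m n).
Local Notation rmass mu := (mass mu (cst 1%E)).

Lemma common_upper_bound (x y : R) : exists C, [/\ 0 <= C, x <= C & y <= C].
Proof.
exists (`|x| + `|y|); split; first by rewrite addr_ge0.
  by rewrite (le_trans (ler_norm x))// lerDl.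
by rewrite (le_trans (ler_norm y))// lerDr.
Qed.

(* [N] is the dimension of the running variable; [Q] is the mass of a cube of that
   variable, the other cube being fixed. *)
Lemma lattice_balance (N : nat) (Q : cube R N -> R) (C e d : R)
    (v : 'rV[R]_N) (h : R) (h0 : 0 < h) (J B A : nat)
    (x : {ffun 'I_N -> 'I_A}) (tau : R) :
  1 <= C -> 0 < e -> 0 < d -> 0 < tau ->
  (forall I, 0 <= Q I) ->
  (forall I I', cube_set I `<=` cube_set I' -> Q I <= Q I') ->
  (forall s I, 0 < s -> Q (shrink s I) <= C * 2 `^ (- e * s) * Q I) ->
  0 < Q (lattice_cube v h0 0 (nats x)) ->
  \sum_(jk : 'I_J * {ffun 'I_N -> 'I_B} | covers jk.1 jk.2 x)
    (2 ^- jk.1) ^+ N * balance d (Q (lattice_cube v h0 jk.1 (nats jk.2)) / tau)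
  <= (C `^ d + 2 * (C `^ d + 2 * N%:R)) /
     (1 - Num.max ((2 `^ (- e)) `^ d) 2^-1).
Proof.
move=> C1 e0 d0 tau0 Q0 Qle rd Qx.
have rho0 : 0 <= 2 `^ (- e) :> R by apply: powR_ge0.
have rho1 : 2 `^ (- e) < 1 :> R.
  rewrite powRN invf_lt1 ?powR_gt0//.
  have h2e : 1 `^ e < 2 `^ e :> R by rewrite gt0_ltr_powR ?nnegrE// ltr1n.
  by rewrite powR1 in h2e.
pose phi i := Q (centred_cube v h0 i (nats x)).
have decay i j : (i <= j)%N -> phi i <= C * (2 `^ (- e)) ^+ (j - i) * phi j.
  rewrite leq_eqVlt => /orP[/eqP->|ij].
    by rewrite subnn expr0 mulr1 -[leLHS]mul1r ler_wpM2r ?Q0.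
  rewrite /phi (centred_cube_shrink _ h0 _ (ltnW ij)).
  rewrite -powR_mulrn// -powRrM; apply: rd.
  by rewrite ltr0n subn_gt0.
have phi0 i : 0 < phi i.
  have : 0 < phi 0%N by rewrite /phi centred_cube0.
  move=> /lt_le_trans/(_ (decay _ _ (leq0n i))).
  have := Q0 (centred_cube v h0 i (nats x)); rewrite -/(phi i) le_eqVlt.
  by move=> /orP[/eqP<-|//]; rewrite mulr0 ltxx.
have -> : \sum_(jk : 'I_J * {ffun 'I_N -> 'I_B} | covers jk.1 jk.2 x)
    (2 ^- jk.1) ^+ N * balance d (Q (lattice_cube v h0 jk.1 (nats jk.2)) / tau) =
  \sum_(j < J) \sum_(k : {ffun 'I_N -> 'I_B} | covers j k x)
    (2 ^- j) ^+ N * balance d (Q (lattice_cube v h0 j (nats k)) / tau).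
  by rewrite pair_big_dep.
apply: (balance_average (M := fun j k => Q (lattice_cube v h0 j (nats k)))
  J tau0 d0 C1 rho0 rho1 phi0 decay).
- move=> j k /forallP ck; apply/andP; split.
    apply: (lt_le_trans Qx); apply: Qle; apply: atom_sub; exact/forallP.
  by apply: Qle; apply: lattice_sub_centred.
- move=> i j k _ /forallP dk; apply: Qle; exact: centred_sub_lattice.
Qed.

Variable mu : {measure set T -> \bar R}.
Hypotheses (lf : locally_finite mu) (rd : product_reverse_doubling mu).

Let one0 (x : T) : (0 <= cst 1%E x :> \bar R)%E. Proof. exact: lee01. Qed.
Let mone : measurable_fun [set: T] (cst 1%E : T -> \bar R).
Proof. exact: measurable_cst. Qed.

(** [C] is chosen before the mesh sizes, the base points, J and B. The sum is that of
    [embedding_two] for the atoms of the mesh and the averages of f on them; Jensen's inequality on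
    each atom and disjointness bring back the norm of f. *)
Lemma lattice_embedding (p g : R) : 1 < p -> 1 < g ->
  exists2 C, 0 <= C & forall (f : T -> \bar R) (L : R)
    (v1 : 'rV[R]_m) (v2 : 'rV[R]_n) (h1 h2 : R) (h10 : 0 < h1) (h20 : 0 < h2)
    (J B : nat),
    measurable_fun setT f -> (forall x, (0 <= f x)%E) -> 0 <= L ->
    (\int[mu]_x `|f x| `^ p)%E = (L `^ p)%:E ->
    \sum_(a : 'I_J * {ffun 'I_m -> 'I_B}) \sum_(b : 'I_J * {ffun 'I_n -> 'I_B})
      (2 ^- a.1) ^+ m * (2 ^- b.1) ^+ n *
      (let I := lattice_cube v1 h10 a.1 (nats a.2) in
       let J := lattice_cube v2 h20 b.1 (nats b.2) in
       rmass mu I J `^ g * (mass mu f I J / rmass mu I J) `^ (p * g))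
    <= C * L `^ (p * g).
Proof.
move=> p1 g1; have [C0 [e1 [e2 [C01 e10 e20 rd1 rd2]]]] := one_variable_reverse_doubling lf rd.
set d := Num.min (g - 1) (1 - p^-1).
have pV : p^-1 < 1 by rewrite invf_lt1//; lra.
have d0 : 0 < d by rewrite lt_min; apply/andP; split; lra.
have dg : d <= g - 1 by rewrite ge_min lexx.
have dp : d <= 1 - p^-1 by rewrite ge_min lexx orbT.
pose K N e : R := (C0 `^ d + 2 * (C0 `^ d + 2 * N%:R)) /
     (1 - Num.max ((2 `^ (- e)) `^ d) 2^-1).
have g0 : 0 <= g by lra.
have [C [C00 CK1 CK2]] := common_upper_bound (K m e1) (K n e2).
exists ((2 `^ p * C) ^+ 2); first by rewrite sqr_ge0.
move=> f L v1 v2 h1 h2 h10 h20 J B mf f0 L0 intf.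
have lff (I : cube R m) (J' : cube R n) : (\int[mu]_(x in rect I J') f x < +oo)%E.
  apply: (@set_integral_lfin _ _ _ mu f p) => //.
  - exact: measurable_rect.
  - exact: locally_finite_rect.
  - by rewrite intf ltry.
have lf1 := rmass_lf lf.
pose A := (B + 2 ^ J)%N.
pose at1 (x : {ffun 'I_m -> 'I_A}) := lattice_cube v1 h10 0 (nats x).
pose at2 (y : {ffun 'I_n -> 'I_A}) := lattice_cube v2 h20 0 (nats y).
pose q1 (a : 'I_J * {ffun 'I_m -> 'I_B}) := lattice_cube v1 h10 a.1 (nats a.2).
pose q2 (b : 'I_J * {ffun 'I_n -> 'I_B}) := lattice_cube v2 h20 b.1 (nats b.2).
pose s x y := rmass mu (at1 x) (at2 y).
pose F x y := mass mu f (at1 x) (at2 y) / s x y.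
have s0 x y : 0 <= s x y by exact: mass_ge0.
have F0 x y : 0 <= F x y by rewrite divr_ge0// mass_ge0.
(* A null atom gets the average 0, consistently, because f integrates to 0 over it. *)
have Fs x y : F x y * s x y = mass mu f (at1 x) (at2 y).
  rewrite /F; have [sz|sz] := eqVneq (s x y) 0; last by rewrite divfK.
  by rewrite sz mulr0 (mass_eq0 lf mf sz).
have part (ff : T -> \bar R) (mff : measurable_fun setT ff)
   (ff0 : forall x, (0 <= ff x)%E)
   (lff' : forall I J', (\int[mu]_(x in @rect R m n I J') ff x < +oo)%E) a b :
  mass mu ff (q1 a) (q2 b) =
  \sum_(x | covers a.1 a.2 x) \sum_(y | covers b.1 b.2 y) mass mu ff (at1 x) (at2 y).
  rewrite (mass_partition_left mff ff0 lff' (leqnn A)); apply: eq_bigr => x _.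
  by rewrite (mass_partition_right mff ff0 lff' (leqnn A)).
have partr (ff : T -> \bar R) (mff : measurable_fun setT ff)
   (ff0 : forall x, (0 <= ff x)%E)
   (lff' : forall I J', (\int[mu]_(x in @rect R m n I J') ff x < +oo)%E) I b :
  mass mu ff I (q2 b) = \sum_(y | covers b.1 b.2 y) mass mu ff I (at2 y).
  by rewrite (mass_partition_right mff ff0 lff' (leqnn A)).
have HX (P : 'I_J * {ffun 'I_n -> 'I_B}) (x : {ffun 'I_m -> 'I_A}) tau :
    0 < \sum_(y | covers P.1 P.2 y) s x y -> 0 < tau ->
    \sum_(Q : 'I_J * {ffun 'I_m -> 'I_B} | covers Q.1 Q.2 x) (2 ^- Q.1) ^+ m * balance d
      ((\sum_(x' | covers Q.1 Q.2 x') \sum_(y | covers P.1 P.2 y) s x' y) / tau) <= C.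
  rewrite -partr// => sx tau0; apply: le_trans CK1.
  under eq_bigr do rewrite -part//.
  apply: (@lattice_balance m (fun I => rmass mu I (q2 P))) => //.
  - by move=> I; exact: mass_ge0.
  - by move=> I I' II'; apply: mass_le.
  - by move=> s' I s'0; exact: rd1.
have HY (x : {ffun 'I_m -> 'I_A}) (y : {ffun 'I_n -> 'I_A}) tau :
    0 < s x y -> 0 < tau ->
    \sum_(P : 'I_J * {ffun 'I_n -> 'I_B} | covers P.1 P.2 y) (2 ^- P.1) ^+ n * balance d
      ((\sum_(y' | covers P.1 P.2 y') s x y') / tau) <= C.
  move=> sx tau0; apply: le_trans CK2.
  under eq_bigr do rewrite -partr//.
  apply: (@lattice_balance n (fun J => rmass mu (at1 x) J)) => //.
  - by move=> I; exact: mass_ge0.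
  - by move=> I I' II'; apply: mass_le.
  - by move=> s' I s'0; exact: rd2.
have w0 (N : nat) (Q : 'I_J * {ffun 'I_N -> 'I_B}) : 0 <= ((2 : R) ^- Q.1) ^+ N.
  by rewrite exprn_ge0// invr_ge0 exprn_ge0.
have := embedding_two p1 g1 dg dp C00 (@w0 m) (@w0 n) s0 F0 HX HY.
under eq_bigr => a _.
  under eq_bigr => b _.
    rewrite -part//.
    under [X in (X / _) `^ _]eq_bigr => x _ do under eq_bigr => y _ do rewrite Fs.
    rewrite -part//.
    over.
  over.
move=> /le_trans; apply; rewrite ler_wpM2l ?sqr_ge0// powRrM.
have LHS0 : 0 <= \sum_x \sum_y F x y `^ p * s x y.
  by apply: sumr_ge0 => x _; apply: sumr_ge0 => y _; rewrite mulr_ge0// powR_ge0.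
apply: ge0_ler_powR; [exact: g0|by rewrite nnegrE|by rewrite nnegrE powR_ge0|].
rewrite pair_big/= -lee_fin -intf -sumEFin.
pose fp x := (`|f x| `^ p)%E.
have mfp : measurable_fun setT fp by exact: measurable_abse_poweR.
apply: le_trans (@set_integral_packing _ _ _ mu fp mfp _ _
   (index_enum _) (fun xy => rect (at1 xy.1) (at2 xy.2)) setT _ measurableT _ _ _).
- apply: lee_sum => -[x y] _ /=.
  have [sz|sz] := eqVneq (s x y) 0.
    by rewrite sz mulr0 integral_ge0// => z _; rewrite poweR_ge0.
  apply: set_integral_jensen => //.
  + exact: measurable_rect.
  + by rewrite lt_neqAle eq_sym sz s0.
  + by rewrite -(rmassE lf).
  + by rewrite -massE.
- by move=> x; rewrite poweR_ge0.
- by move=> xy; exact: measurable_rect.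
- exact: index_enum_uniq.
- apply/trivIsetP => -[x y] [x' y'] _ _ /eqP ne; apply/seteqP; split => // z [[/= z1 z2] [z3 z4]].
  apply: ne; congr pair; [exact: atom_inj z1 z3|exact: atom_inj z2 z4].
- by [].
Qed.

End LatticeEmbedding.

(** * Separation of the two weights *)

Section TwoWeight.
Variables (R : realType) (m n : nat).
Local Notation T := (borel_prod R m n).
Local Notation rmass mu := (mass mu (cst 1%E)).

(** For e = 1/p' this is |R|^(1/p) E_R f, the share of f that remains once the kernel is bounded
    through the characteristic. *)
Definition normalized_mass (mu : {measure set T -> \bar R}) (e : R)
    (f : T -> \bar R) (I : cube R m) (J : cube R n) : R :=
  rmass mu I J `^ (- e) * mass mu f I J.

Lemma mass_cst_ge0 (mu : {measure set T -> \bar R}) (I : cube R m) (J : cube R n) :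
  0 <= rmass mu I J.
Proof. by apply: mass_ge0 => x; exact: lee01. Qed.

Lemma normalized_mass_ge0 mu e f I J :
  (forall x, (0 <= f x)%E) -> 0 <= normalized_mass mu e f I J.
Proof. by move=> f0; rewrite mulr_ge0 ?powR_ge0// mass_ge0. Qed.

(** For s > 0 the two sides are equal, both being s^(g-a) F^a. For s = 0 the left one vanishes,
    since [powR] sends 0 to 0 for every nonzero exponent, negative ones included. *)
Lemma powR_normalized (e a g s F : R) : 0 <= s -> 0 <= F ->
  0 < e -> 0 < a -> e * a = a - g -> (s `^ (- e) * F) `^ a <= s `^ g * (F / s) `^ a.
Proof.
move=> s0 F0 e0 a0 ea.
have [->|sz] := eqVneq s 0.
  rewrite powR0 ?oppr_eq0 ?gt_eqF// mul0r (@powR0 _ a) ?gt_eqF//.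
  by rewrite mulr_ge0 ?powR_ge0.
rewrite !powRM ?powR_ge0 ?invr_ge0// -powRrM mulNr ea -(powR_inv1 s0) -powRrM mulN1r.
rewrite [leRHS]mulrCA [leRHS]mulrC -powRD ?sz ?implybT//.
by have -> : - (a - g) = g - a by ring.
Qed.

Lemma normalized_massX mu e f I J (a g : R) : (forall x, (0 <= f x)%E) ->
  0 < e -> 0 < a -> e * a = a - g ->
  normalized_mass mu e f I J `^ a <= rmass mu I J `^ g * (mass mu f I J / rmass mu I J) `^ a.
Proof.
by move=> f0; apply: powR_normalized; [exact: mass_cst_ge0|exact: mass_ge0].
Qed.

Variables sigma omega : {measure set T -> \bar R}.
Hypotheses (lfs : locally_finite sigma) (lfo : locally_finite omega).
Hypotheses (rds : product_reverse_doubling sigma).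
Hypotheses (rdo : product_reverse_doubling omega).
Variables p q : R.
Hypotheses (p1 : 1 < p) (pq : p < q).

Definition two_weight_mass (f g : T -> \bar R) I J : R :=
  normalized_mass sigma (1 / conj_exp p) f I J * normalized_mass omega (1 / q) g I J.

(** Scales are summed and positions averaged: 2^(-j) to the power of the dimension is the
    probability that a uniformly shifted grid contains a given lattice cube of side 2^j mesh
    units. *)
Definition lattice_average (J B : nat) (v1 : 'rV[R]_m) (v2 : 'rV[R]_n) (h1 h2 : R)
    (h10 : 0 < h1) (h20 : 0 < h2) (F : cube R m -> cube R n -> R) : R :=
  \sum_(a : 'I_J * {ffun 'I_m -> 'I_B}) \sum_(b : 'I_J * {ffun 'I_n -> 'I_B})
    (2 ^- a.1) ^+ m * (2 ^- b.1) ^+ n *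
    F (lattice_cube v1 h10 a.1 (nats a.2)) (lattice_cube v2 h20 b.1 (nats b.2)).

Lemma lattice_average_bound : exists2 C, 0 <= C &
  forall (f g : T -> \bar R) (Lf Lg : R),
    measurable_fun setT f -> (forall x, (0 <= f x)%E) -> 0 < Lf ->
    measurable_fun setT g -> (forall x, (0 <= g x)%E) -> 0 < Lg ->
    (\int[sigma]_x `|f x| `^ p)%E = (Lf `^ p)%:E ->
    (\int[omega]_x `|g x| `^ (conj_exp q))%E = (Lg `^ (conj_exp q))%:E ->
    forall J B v1 v2 h1 h2 (h10 : 0 < h1) (h20 : 0 < h2),
    lattice_average J B v1 v2 h10 h20 (two_weight_mass f g) <= C * Lf * Lg.
Proof.
have p1' := p1; have pq' := pq.
(* [g1] and [g2] are determined by p g1 = a and q' g2 = a', so that the embeddings produce the two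
   powers in Young's inequality. *)
pose a := (p + q) / 2; pose a' := a / (a - 1).
pose g1 := a / p; pose q' := conj_exp q; pose g2 := a' / q'.
have q1 : 1 < q by lra.
have a1 : 1 < a by rewrite /a; lra.
have pa : p < a by rewrite /a; lra.
have aq : a < q by rewrite /a; lra.
have a'0 : 0 < a' by rewrite divr_gt0; lra.
have a0 : 0 < a by lra.
have ai : 0 <= a^-1 by rewrite invr_ge0 ltW.
have ai' : 0 <= a'^-1 by rewrite invr_ge0 ltW.
have cq : 0 < 1 / q by rewrite divr_gt0; lra.
have q'1 : 1 < q' by rewrite ltr_pdivlMr; lra.
have qa' : q' < a'.
  rewrite /q' /a' /conj_exp ltr_pdivrMr; last lra.
  by rewrite mulrAC ltr_pdivlMr; [nra|lra].
have g11 : 1 < g1 by rewrite ltr_pdivlMr; lra.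
have g21 : 1 < g2 by rewrite ltr_pdivlMr; lra.
have aa' : a^-1 + a'^-1 = 1 by rewrite /a'; field; lra.
have pg1 : p * g1 = a by rewrite /g1 mulrC divfK//; lra.
have qg2 : q' * g2 = a' by rewrite /g2 mulrC divfK// gt_eqF//; lra.
have cp : 0 < 1 / conj_exp p by rewrite !divr_gt0//; lra.
have ea1 : 1 / conj_exp p * a = a - g1.
  by rewrite /g1 /conj_exp; field; lra.
have ea2 : 1 / q * a' = a' - g2.
  by rewrite /g2 /q' /conj_exp; field; lra.
have [C1 C10 emb1] := lattice_embedding lfs rds p1 g11.
have [C2 C20 emb2] := lattice_embedding lfo rdo q'1 g21.
exists (C1 / a + C2 / a'); first by rewrite addr_ge0// mulr_ge0.
move=> f g Lf Lg mf f0 Lf0 mg g0 Lg0 intf intg J B v1 v2 h1 h2 h10 h20.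
have := emb1 f Lf v1 v2 h1 h2 h10 h20 J B mf f0 (ltW Lf0) intf.
have := emb2 g Lg v1 v2 h1 h2 h10 h20 J B mg g0 (ltW Lg0) intg.
rewrite /= pg1 qg2 => E2 E1.
have Lfa : 0 < Lf `^ a by rewrite powR_gt0.
have Lga : 0 < Lg `^ a' by rewrite powR_gt0.
rewrite -mulrA -ler_pdivrMr; last by rewrite mulr_gt0.
rewrite /lattice_average mulr_suml.
under eq_bigr do rewrite mulr_suml.
rewrite -(ler_pdivrMr _ _ Lfa) in E1; rewrite -(ler_pdivrMr _ _ Lga) in E2.
apply: le_trans (lerD (ler_wpM2r ai E1) (ler_wpM2r ai' E2)).
rewrite !mulr_suml -big_split/=; apply: ler_sum => x _.
rewrite !mulr_suml -big_split/=; apply: ler_sum => y _.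
set I := lattice_cube v1 h10 _ _; set I' := lattice_cube v2 h20 _ _.
set w := _ ^+ m * _ ^+ n.
have w0 : 0 <= w by rewrite mulr_ge0 ?exprn_ge0 ?invr_ge0 ?exprn_ge0.
(* Young's inequality is applied to X / Lf and Y / Lg, so that the resulting bound is linear in each
   norm. *)
suff key : two_weight_mass f g I I' / (Lf * Lg) <=
    rmass sigma I I' `^ g1 * (mass sigma f I I' / rmass sigma I I') `^ a / Lf `^ a / a +
    rmass omega I I' `^ g2 * (mass omega g I I' / rmass omega I I') `^ a' / Lg `^ a' / a'.
  have := ler_wpM2l w0 key.
  move: (two_weight_mass f g I I') (_ `^ g1 * _) (_ `^ g2 * _) => tw A1 A2.
  by rewrite mulrDr !mulrA.
set X := normalized_mass sigma (1 / conj_exp p) f I I'.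
set Y := normalized_mass omega (1 / q) g I I'.
have X0 : 0 <= X by exact: normalized_mass_ge0.
have Y0 : 0 <= Y by exact: normalized_mass_ge0.
have -> : two_weight_mass f g I I' / (Lf * Lg) = X / Lf * (Y / Lg).
  by rewrite /two_weight_mass -/X -/Y invfM mulrACA.
have XL : 0 <= X / Lf by rewrite divr_ge0// ltW.
have YL : 0 <= Y / Lg by rewrite divr_ge0// ltW.
apply: (le_trans (conjugate_powR XL YL a0 a'0 aa')).
have split_div (z L b : R) : 0 <= z -> 0 < L -> (z / L) `^ b = z `^ b / L `^ b.
  move=> z0 L0; rewrite powRM ?invr_ge0 ?(ltW L0)//.
  by rewrite -(powR_inv1 (ltW L0)) -powRrM mulN1r powRN.
apply: lerD; rewrite ler_wpM2r// split_div// ler_wpM2r ?invr_ge0 ?(ltW Lfa) ?(ltW Lga)//.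
  exact: normalized_massX.
exact: normalized_massX.
Qed.

End TwoWeight.

(** * Covering grid cubes by lattice cubes *)

Lemma seq_nat_bound (T : eqType) (s : seq T) (u : T -> nat) :
  exists n, forall x, x \in s -> (u x <= n)%N.
Proof.
elim: s => [|x s [n hn]]; first by exists 0%N.
exists (maxn (u x) n) => y; rewrite in_cons leq_max => /orP[/eqP->|/hn->].
  by rewrite leqnn.
by rewrite orbT.
Qed.

(** Per coordinate, 2^i corners of weight 2^(-i-1) add up to one half. Positions are counted for
    side 2^i but weighted for side 2^(i+1): these are the doubled cubes that contain a grid cube
    with corner in x. The hypothesis keeps the corners at nonnegative indices. *)
Lemma half_weight (R : realType) (N B i : nat) (x : {ffun 'I_N -> 'I_B}) :
  (forall c, (2 ^ i <= (x c).+1)%N) ->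
  2 ^- N <= \sum_(k : {ffun 'I_N -> 'I_B} | covers i k x) ((2 : R) ^- i.+1) ^+ N.
Proof.
move=> xi; rewrite (coordinatewise_sum (fun c (b : 'I_B) => (b <= x c < b + 2 ^ i)%N)).
have -> : (2 : R) ^- N = \prod_(c < N) 2^-1 by rewrite prodr_const card_ord exprVn.
apply: ler_prod => c _; rewrite invr_ge0 ler0n/=.
have -> : \sum_(b < B | (b <= x c < b + 2 ^ i)%N) (2 : R) ^- i.+1 =
    (\sum_(b < B | ((x c).+1 - 2 ^ i <= b < (x c).+1)%N) 1)%N%:R * 2 ^- i.+1.
  rewrite natr_sum mulr_suml; apply: eq_big => [b|b _]; last by rewrite mul1r.
  by have := xi c; move: (expn_gt0 2 i) (nat_of_ord (x c)) (nat_of_ord b) (2 ^ i)%N;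
    clear; lia.
rewrite ord_interval_card (minn_idPr (ltn_ord (x c))) subKn ?xi// natrX exprS invfM mulrCA mulfV ?mulr1//.
Qed.

Section GridLattice.
Variables (R : realType) (N : nat).

(** The corner of I lies anywhere in the atom x; doubling the side absorbs both this offset and the
    freedom in k. *)
Lemma lattice_contains (v : 'rV[R]_N) (h : R) (h0 : 0 < h) (I : cube R N) (i B : nat)
    (k x : {ffun 'I_N -> 'I_B}) :
  side I = h * 2 ^+ i ->
  (forall c, (x c)%:R <= (corner I ord0 c - v ord0 c) / h < (x c).+1%:R) ->
  covers i k x -> cube_set I `<=` cube_set (lattice_cube v h0 i.+1 (nats k)).
Proof.
move=> sI xI /forallP kx; apply: cube_set_sub => c /=; rewrite !mxE sI.
have /andP[k1 k2] := kx c; have := xI c.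
set t := (_ - _) / h.
have -> : corner I ord0 c = v ord0 c + h * t.
  by rewrite /t mulrC divfK ?gt_eqF// addrC subrK.
move=> /andP[t1 t2].
have h1 : ((k c)%:R : R) <= (x c)%:R by rewrite ler_nat.
have h2 : ((x c).+1%:R : R) <= (k c)%:R + 2 ^+ i.
  by rewrite -natrX -natrD ler_nat.
rewrite exprS -!addrA !lerD2l -!mulrDr !ler_pM2l//; split; lra.
Qed.

(** Sides in one grid differ by powers of 2, so those of a finite subfamily are dyadic multiples of
    one mesh size. The corners need not lie on the mesh, which is why covering cubes are one scale
    larger. *)
Lemma grid_lattice (D : set (cube R N)) (s : seq (cube R N)) :
  dyadic_grid D -> (forall I, I \in s -> D I) ->
  exists (h : R) (h0 : 0 < h) (v : 'rV[R]_N) (M : nat) (i : cube R N -> nat),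
  [/\ forall I, I \in s -> side I = h * 2 ^+ i I,
      forall I, I \in s -> (i I < M)%N,
      forall I I' z, I \in s -> I' \in s -> i I = i I' ->
        cube_set I z -> cube_set I' z -> I = I' &
      forall B I, (M <= B)%N -> I \in s ->
        2 ^- N <= \sum_(k : {ffun 'I_N -> 'I_B} |
          `[< cube_set I `<=` cube_set (lattice_cube v h0 (i I).+1 (nats k)) >])
          ((2 : R) ^- (i I).+1) ^+ N].
Proof.
move=> [lambda [l0 sides tile _]] sD.
have /choice[k hk] : forall I, exists k : int, D I -> side I = lambda * 2 ^ k.
  move=> I; have [/sides[k ->]|nD] := pselect (D I); first by exists k.
  by exists 0.
have [L hL] := seq_nat_bound s (fun I => absz (k I)).
pose i I := absz (k I + L%:Z).
pose h := lambda / 2 ^+ L.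
have h0 : 0 < h by rewrite divr_gt0// exprn_gt0.
have iE I : I \in s -> k I = (i I)%:Z - L%:Z.
  by move=> /hL; rewrite /i; lia.
have side_i I : I \in s -> side I = h * 2 ^+ i I.
  move=> sI; rewrite (hk _ (sD _ sI)) (iE _ sI) expfzDr// -exprnN /h.
  by rewrite mulrAC mulrA.
have [iM hiM] := seq_nat_bound s i.
have [m1 hm1] := seq_nat_bound s
  (fun I => \sum_c (Num.truncn (`|corner I ord0 c| / h)).+1)%N.
(* [m1] bounds the corners in mesh units. Moving the base point down by a further 2^iM gives every
   corner an index at least 2^iM, as [half_weight] asks. *)
pose M0 := (m1 + 2 ^ iM)%N.
have cornerM I c : I \in s -> `|corner I ord0 c| / h < m1%:R.
  move=> /hm1 H; have t0 : 0 <= `|corner I ord0 c| / h by rewrite divr_ge0// ltW.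
  have /andP[_ /lt_le_trans] := truncn_itv t0; apply; rewrite ler_nat.
  by apply: leq_trans H; rewrite (bigD1 c)//= leq_addr.
pose v : 'rV[R]_N := \row__ (- (h * M0%:R)).
pose M := (maxn iM.+1 (m1 + M0))%N.
exists h, h0, v, M, i; split => //.
- by move=> I /hiM iI; rewrite /M; lia.
- move=> I I' z sI sI' ii zI zI'.
  have [J [_ uJ]] := tile (k I) z.
  rewrite -(uJ I); last by split => //; [exact: sD|rewrite (hk _ (sD _ sI))].
  rewrite (uJ I')//; split => //; first exact: sD.
  by rewrite (hk _ (sD _ sI')) iE// -ii -iE.
move=> B I MB sI.
pose t c := (corner I ord0 c - v ord0 c) / h.
have tE c : t c = corner I ord0 c / h + M0%:R.
  by rewrite /t mxE opprK mulrDl [h * _]mulrC mulfK ?gt_eqF.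
have bnd c : - m1%:R < corner I ord0 c / h < m1%:R.
  have := cornerM I c sI; rewrite -{1}(gtr0_norm h0) -normf_div => /ltr_normlP[].
  by rewrite ltrNl => -> ->.
have M0E : (M0%:R : R) = m1%:R + 2 ^+ iM by rewrite natrD natrX.
have te0 : (0 : R) <= 2 ^+ iM by rewrite exprn_ge0.
have t1 c : 2 ^+ iM < t c by have /andP[] := bnd c; rewrite tE M0E; lra.
have t0 c : 0 <= t c by apply/ltW/(le_lt_trans te0 (t1 c)).
have t2 c : t c < m1%:R + M0%:R by have /andP[] := bnd c; rewrite tE; lra.
have xB c : (Num.truncn (t c) < B)%N.
  apply: leq_trans MB; apply: leq_trans (leq_maxr _ _).
  have /andP[h1 _] := truncn_itv (t0 c).
  by rewrite -(ltr_nat R) natrD (le_lt_trans h1).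
pose x : {ffun 'I_N -> 'I_B} := [ffun c => Ordinal (xB c)].
have xI c : (2 ^ i I <= (x c).+1)%N.
  have /andP[_ h2] := truncn_itv (t0 c).
  rewrite ffunE/= -(ler_nat R) natrX (le_trans _ (ltW h2))// (le_trans _ (ltW (t1 c)))//.
  by rewrite ler_eXn2l ?ltr1n// hiM.
apply: (le_trans (half_weight R xI)).
rewrite big_mkcond [leRHS]big_mkcond/=; apply: ler_sum => kk _.
case: ifPn => [kx|_]; last by case: ifPn => // _; rewrite exprn_ge0// invr_ge0 exprn_ge0.
rewrite ifT//; apply/asboolP.
apply: (lattice_contains (v := v) h0 (side_i I sI) _ kx).
by move=> c; rewrite ffunE/=; exact: truncn_itv.
Qed.

End GridLattice.

(** * The form over a fixed grid and a doubling kernel *)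

Section DyadicForm.
Variables (R : realType) (m n : nat).
Local Notation T := (borel_prod R m n).
Local Notation rmass mu := (mass mu (cst 1%E)).
Variables sigma omega : {measure set T -> \bar R}.
Hypotheses (lfs : locally_finite sigma) (lfo : locally_finite omega).
Variables p q : R.
Hypotheses (p1 : 1 < p) (pq : p < q).
Variable K : cube R m -> cube R n -> R.
Hypothesis K0 : forall I J, 0 <= K I J.

(** For rectangles of positive mass one divides by the powers in the characteristic. On a null
    rectangle the characteristic says nothing about K, but there the integral of f or of g
    vanishes. *)
Lemma kernel_bound : (rect_characteristic p q K sigma omega < +oo)%E ->
  exists2 A, 0 <= A & forall f g I J,
    measurable_fun setT f -> measurable_fun setT g ->
    (forall x, (0 <= f x)%E) -> (forall x, (0 <= g x)%E) ->
    K I J * mass sigma f I J * mass omega g I J <=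
    A * two_weight_mass sigma omega p q f g I J.
Proof.
move=> charoo.
have char I J : ((K I J * rmass omega I J `^ (1 / q) *
    rmass sigma I J `^ (1 / conj_exp p))%:E <= rect_characteristic p q K sigma omega)%E.
  apply: ereal_sup_ubound; exists (I, J) => //=.
  by rewrite -!rmassE// !poweR_EFin.
have [A A0 charA] : exists2 A, 0 <= A & forall I J, K I J * rmass omega I J `^ (1 / q) *
    rmass sigma I J `^ (1 / conj_exp p) <= A.
  case: (rect_characteristic _ _ _ _ _) charoo char => [r| |]// _ char.
    exists (Num.max 0 r); first by rewrite le_max lexx.
    by move=> I J; have := char I J; rewrite lee_fin le_max => ->; rewrite orbT.
  by exists 0 => // I J; have := char I J; rewrite leeNy_eq.
exists A => // f g I J mf mg f0 g0.
have F0 := mass_ge0 sigma f0 I J; have G0 := mass_ge0 omega g0 I J.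
have s0 := mass_cst_ge0 sigma I J; have o0 := mass_cst_ge0 omega I J.
have [sz|sz] := eqVneq (rmass sigma I J) 0.
  rewrite (mass_eq0 lfs mf sz) mulr0 mul0r mulr_ge0// mulr_ge0//;
    exact: normalized_mass_ge0.
have [oz|oz] := eqVneq (rmass omega I J) 0.
  rewrite (mass_eq0 lfo mg oz) mulr0 mulr_ge0// mulr_ge0//;
    exact: normalized_mass_ge0.
have sp : 0 < rmass sigma I J by rewrite lt_neqAle eq_sym sz.
have op : 0 < rmass omega I J by rewrite lt_neqAle eq_sym oz.
have := charA I J; rewrite -ler_pdivlMr ?powR_gt0// -ler_pdivlMr ?powR_gt0// => h.
rewrite -mulrA; apply: (le_trans (ler_wpM2r (mulr_ge0 F0 G0) h)).
rewrite /two_weight_mass /normalized_mass !powRN.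
move: (_ `^ _) (_ `^ _) (mass _ f _ _) (mass _ g _ _) => a b c d.
by rewrite le_eqVlt; apply/orP; left; apply/eqP; ring.
Qed.

Section TestFunctions.
Variables f g : T -> \bar R.
Hypotheses (mf : measurable_fun setT f) (f0 : forall x, (0 <= f x)%E).
Hypotheses (mg : measurable_fun setT g) (g0 : forall x, (0 <= g x)%E).
Hypothesis lff : forall I J, (\int[sigma]_(x in rect I J) f x < +oo)%E.
Hypothesis lfg : forall I J, (\int[omega]_(x in rect I J) g x < +oo)%E.

Lemma dyadic_form_le (Dm : set (cube R m)) (Dn : set (cube R n)) (b : \bar R) :
  (forall s : seq (cube R m * cube R n), uniq s ->
    (forall Q, Q \in s -> Dm Q.1 /\ Dn Q.2) ->
    ((\sum_(Q <- s) K Q.1 Q.2 * mass sigma f Q.1 Q.2 * mass omega g Q.1 Q.2)%:E <= b)%E) ->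
  (dyadic_form K sigma omega Dm Dn f g <= b)%E.
Proof.
move=> H; apply: ge_ereal_sup => _ [X [finX XD] <-].
rewrite fsbig_finite//=.
have := H (finmap.enum_fset (fset_set X)); rewrite finmap.fset_uniq => /(_ isT).
have XQ Q : Q \in finmap.enum_fset (fset_set X) -> Dm Q.1 /\ Dn Q.2.
  by move=> QX; apply: XD; move: QX; rewrite in_fset_set// => /set_mem.
move=> /(_ XQ); apply: le_trans; rewrite -sumEFin le_eqVlt; apply/orP; left; apply/eqP.
by apply: eq_bigr => Q _; rewrite !EFinM !massE.
Qed.

Variable kk : R.
Hypothesis kk0 : 0 <= kk.
Hypothesis Kd : forall I J I' J',
  side I' = 2 * side I -> side J' = 2 * side J -> K I J <= kk * K I' J'.

(** Each grid rectangle is charged to the lattice rectangles of doubled sides containing it, whose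
    weights add up to at least 2^(-m-n). K and the integral of f are moved to the lattice rectangle;
    the integral of g stays on the grid rectangle, so that it can be summed over disjoint
    rectangles. *)
Lemma doubling_kernel_form_bound (A b : R) :
  (forall I J, K I J * mass sigma f I J * mass omega g I J <=
    A * two_weight_mass sigma omega p q f g I J) -> 0 <= A ->
  (forall J B v1 v2 h1 h2 (h10 : 0 < h1) (h20 : 0 < h2),
    lattice_average J B v1 v2 h10 h20 (two_weight_mass sigma omega p q f g) <= b) ->
  forall Dm Dn, dyadic_grid Dm -> dyadic_grid Dn ->
    (dyadic_form K sigma omega Dm Dn f g <= (2 ^+ m * 2 ^+ n * kk * A * b)%:E)%E.
Proof.
move=> KA A0 avg Dm Dn gm gn; apply: dyadic_form_le => s us sD; rewrite lee_fin.
have [|h1 [h10 [v1 [M1 [i1 [side1 i1M inj1 half1]]]]]] :=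
    grid_lattice (s := [seq Q.1 | Q <- s]) gm.
  by move=> I /mapP[Q Qs ->]; have [] := sD Q Qs.
have [|h2 [h20 [v2 [M2 [i2 [side2 i2M inj2 half2]]]]]] :=
    grid_lattice (s := [seq Q.2 | Q <- s]) gn.
  by move=> I /mapP[Q Qs ->]; have [] := sD Q Qs.
have Q1s Q : Q \in s -> Q.1 \in [seq Q.1 | Q <- s] by exact: map_f.
have Q2s Q : Q \in s -> Q.2 \in [seq Q.2 | Q <- s] by exact: map_f.
pose B := maxn M1 M2; pose J := B.+1.
pose l1 (a : 'I_J * {ffun 'I_m -> 'I_B}) := lattice_cube v1 h10 a.1 (nats a.2).
pose l2 (a : 'I_J * {ffun 'I_n -> 'I_B}) := lattice_cube v2 h20 a.1 (nats a.2).
pose c1 (Q : cube R m * cube R n) (a : 'I_J * {ffun 'I_m -> 'I_B}) :=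
  (a.1 == (i1 Q.1).+1 :> nat) && `[< cube_set Q.1 `<=` cube_set (l1 a) >].
pose c2 (Q : cube R m * cube R n) (a : 'I_J * {ffun 'I_n -> 'I_B}) :=
  (a.1 == (i2 Q.2).+1 :> nat) && `[< cube_set Q.2 `<=` cube_set (l2 a) >].
pose W N (a : 'I_J * {ffun 'I_N -> 'I_B}) : R := (2 ^- a.1) ^+ N.
have W0 N (a : 'I_J * {ffun 'I_N -> 'I_B}) : 0 <= W N a.
  by rewrite exprn_ge0// invr_ge0 exprn_ge0.
have fix_scale N (j0 : nat) (P : {ffun 'I_N -> 'I_B} -> nat -> bool) : (j0 < J)%N ->
    \sum_(a : 'I_J * {ffun 'I_N -> 'I_B} | (a.1 == j0 :> nat) && P a.2 a.1) W N a =
    \sum_(k : {ffun 'I_N -> 'I_B} | P k j0) ((2 : R) ^- j0) ^+ N.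
  move=> jJ; rewrite -(pair_big_dep (fun j : 'I_J => j == j0 :> nat)
    (fun j k => P k j) (fun j k => ((2 : R) ^- j) ^+ N))/=.
  by rewrite (big_pred1 (Ordinal jJ)).
have cov1 Q : Q \in s -> 1 <= 2 ^+ m * \sum_(a | c1 Q a) W m a.
  move=> Qs; rewrite mulrC -ler_pdivrMr ?exprn_gt0// mul1r.
  apply: le_trans (half1 B _ (leq_maxl _ _) (Q1s _ Qs)) _.
  rewrite -(fix_scale m (i1 Q.1).+1 (fun k j =>
    `[< cube_set Q.1 `<=` cube_set (lattice_cube v1 h10 j (nats k)) >]))//.
  by rewrite ltnS; apply: leq_trans (leq_maxl _ _); exact: i1M (Q1s _ Qs).
have cov2 Q : Q \in s -> 1 <= 2 ^+ n * \sum_(a | c2 Q a) W n a.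
  move=> Qs; rewrite mulrC -ler_pdivrMr ?exprn_gt0// mul1r.
  apply: le_trans (half2 B _ (leq_maxr _ _) (Q2s _ Qs)) _.
  rewrite -(fix_scale n (i2 Q.2).+1 (fun k j =>
    `[< cube_set Q.2 `<=` cube_set (lattice_cube v2 h20 j (nats k)) >]))//.
  by rewrite ltnS; apply: leq_trans (leq_maxr _ _); exact: i2M (Q2s _ Qs).
pose KF a c := K (l1 a) (l2 c) * mass sigma f (l1 a) (l2 c).
have KF0 a c : 0 <= KF a c by rewrite mulr_ge0// mass_ge0.
have G0 Q : 0 <= mass omega g Q.1 Q.2 by exact: mass_ge0.
apply: (@le_trans _ _ (\sum_(Q <- s) 2 ^+ m * 2 ^+ n * kk *
   \sum_a \sum_c (if c1 Q a && c2 Q c then W m a * W n c * KF a c * mass omega g Q.1 Q.2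
     else 0))).
  rewrite big_seq [leRHS]big_seq; apply: ler_sum => Q Qs.
  set t := K Q.1 Q.2 * mass sigma f Q.1 Q.2 * mass omega g Q.1 Q.2.
  have t0 : 0 <= t by rewrite !mulr_ge0// mass_ge0.
  have := ler_wpM2r t0 (ler_pM ler01 ler01 (cov1 Q Qs) (cov2 Q Qs)).
  rewrite !mul1r => /le_trans; apply.
  rewrite [leLHS](_ : _ = 2 ^+ m * 2 ^+ n *
    (t * ((\sum_(a | c1 Q a) W m a) * (\sum_(c | c2 Q c) W n c)))); last by ring.
  rewrite -[leRHS]mulrA ler_wpM2l ?mulr_ge0 ?exprn_ge0//.
  rewrite mulr_suml !mulr_sumr big_mkcond/=; apply: ler_sum => a _.
  case: ifPn => c1a; last by rewrite mulr_ge0// sumr_ge0// => c _; case: ifP.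
  rewrite !mulr_sumr big_mkcond/=; apply: ler_sum => c _.
  case: ifPn => c2c //=; last by rewrite mulr0.
  move: c1a c2c => /andP[/eqP e1 /asboolP s1] /andP[/eqP e2 /asboolP s2].
  have -> : kk * (W m a * W n c * KF a c * mass omega g Q.1 Q.2) =
    W m a * W n c * (kk * KF a c * mass omega g Q.1 Q.2) by ring.
  rewrite mulrC ler_wpM2l ?mulr_ge0// /t ler_wpM2r// /KF mulrA.
  apply: ler_pM => //; first exact: mass_ge0.
    apply: Kd; rewrite /= ?e1 ?e2 ?(side1 _ (Q1s _ Qs)) ?(side2 _ (Q2s _ Qs));
      by rewrite exprS mulrCA.
  by apply: mass_le.
rewrite -mulr_sumr -[leRHS]mulrA ler_wpM2l ?mulr_ge0 ?exprn_ge0//.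
apply: le_trans (ler_wpM2l A0 (avg J B v1 v2 h1 h2 h10 h20)).
rewrite /lattice_average mulr_sumr exchange_big/=; apply: ler_sum => a _.
rewrite mulr_sumr exchange_big/=; apply: ler_sum => c _.
rewrite -big_mkcond/= -mulr_sumr -/(l1 a) -/(l2 c) [leRHS]mulrCA
  -[leLHS]mulrA ler_wpM2l ?mulr_ge0//.
apply: le_trans (KA (l1 a) (l2 c)); rewrite /KF ler_wpM2l ?KF0//.
(* For fixed a and c the charged rectangles share one pair of scales, so distinct ones are
   disjoint. *)
rewrite -big_filter.
apply: (@mass_packing _ _ _ omega g mg g0 lfg _ (l1 a, l2 c)) => /=.
- exact: filter_uniq.
- move=> Q Q' z; rewrite !mem_filter.
  move=> /andP[/andP[/andP[/eqP e1 _] /andP[/eqP e2 _]] Qs].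
  move=> /andP[/andP[/andP[/eqP e1' _] /andP[/eqP e2' _]] Qs'] [z1 z2] [z3 z4].
  case: Q Q' e1 e2 e1' e2' Qs Qs' z1 z2 z3 z4 => [I I'] [L L']/= e1 e2 e1' e2' Qs Qs' z1 z2 z3 z4.
  congr pair.
    by apply: (inj1 _ _ z.1 (Q1s _ Qs) (Q1s _ Qs')) => //=; apply: succn_inj; rewrite -e1.
  by apply: (inj2 _ _ z.2 (Q2s _ Qs) (Q2s _ Qs')) => //=; apply: succn_inj; rewrite -e2.
move=> Q; rewrite mem_filter => /andP[/andP[/andP[_ /asboolP s1] /andP[_ /asboolP s2]] _] z [z1 z2].
by split; [exact: s1|exact: s2].
Qed.

End TestFunctions.

End DyadicForm.

Section FractionalKernel.
Variables (R : realType) (m n : nat).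

(** Doubling multiplies the volume by 2^N; as e >= -1, its power e loses at most the factor 2^N. *)
Lemma volume_power_double (N : nat) (e : R) (I I' : cube R N) : - 1 <= e ->
  side I' = 2 * side I -> volume I `^ e <= 2 ^+ N * volume I' `^ e.
Proof.
move=> e1 s; have V0 : 0 < volume I by rewrite exprn_gt0// side_gt0.
have T1 : (1 : R) <= 2 ^+ N by rewrite exprn_ege1// ler1n.
have T0 : (0 : R) < 2 ^+ N by rewrite exprn_gt0.
have -> : volume I' = 2 ^+ N * volume I by rewrite /volume s exprMn.
rewrite powRM ?(ltW V0) ?(ltW T0)// mulrA -[leLHS]mul1r ler_wpM2r ?powR_ge0//.
apply: (@le_trans _ _ (2 ^+ N * (2 ^+ N) `^ (- 1))).
  by rewrite powR_inv1 ?(ltW T0)// mulfV ?gt_eqF.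
by rewrite ler_wpM2l ?(ltW T0)// ler_powR.
Qed.

Lemma fractional_kernel_double (alpha beta : R) :
  0 < alpha / m%:R < 1 -> 0 < beta / n%:R < 1 ->
  exists2 k : R, 0 <= k & forall (I : cube R m) (J : cube R n) (I' : cube R m) (J' : cube R n),
    side I' = 2 * side I -> side J' = 2 * side J ->
    fractional_kernel alpha beta I J <= k * fractional_kernel alpha beta I' J'.
Proof.
move=> /andP[a0 _] /andP[b0 _]; exists (2 ^+ m * 2 ^+ n).
  by rewrite mulr_ge0// exprn_ge0.
move=> I J I' J' sI sJ; rewrite /fractional_kernel [leRHS]mulrACA.
apply: ler_pM; [exact: powR_ge0|exact: powR_ge0| |].
  by apply: volume_power_double => //; lra.
by apply: volume_power_double => //; lra.
Qed.

End FractionalKernel.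

(** * Random grids *)

(* The integer with binary digits [b 0], ..., [b j.-1], leading digit first. *)
Fixpoint binary (j : nat) (b : nat -> bool) : nat :=
  if j is j'.+1 then ((binary j' b).*2 + b j')%N else 0%N.

Lemma binary_lt j b : (binary j b < 2 ^ j)%N.
Proof. by elim: j => //= j IH; rewrite expnS; case: (b j); lia. Qed.

Lemma binary_inj j b b' : binary j b = binary j b' ->
  forall t, (t < j)%N -> b t = b' t.
Proof.
elim: j => //= j IH h t.
have [e1 e2] : binary j b = binary j b' /\ b j = b' j.
  by move: h; case: (b j); case: (b' j) => /=; lia.
by rewrite ltnS leq_eqVlt => /orP[/eqP->//|]; exact: IH.
Qed.

Lemma eq_binary j b b' : (forall t, (t < j)%N -> b t = b' t) -> binary j b = binary j b'.
Proof.
elim: j => //= j IH h; rewrite h// IH// => t tj; apply: h; exact: ltnW.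
Qed.

Lemma binary_series (R : realType) (b : nat -> bool) j :
  series (fun t : nat => (2 : R) ^- t.+1 * (b t)%:R) j = 2 ^- j * (binary j b)%:R.
Proof.
elim: j => [|j IH]; first by rewrite /series/= big_geq// mulr0.
rewrite /series/= big_nat_recr//= -[X in X + _]/(series _ j) IH.
rewrite natrD -muln2 natrM exprS invfM.
by move: (2 ^- j) => z; field.
Qed.

Section DigitShift.
Variables (R : realType) (N : nat) (b : int -> {ffun 'I_N -> bool}).

Definition digit_seq (l : int) (c : 'I_N) (t : nat) : bool := b (l + t.+1%:Z) c.

Let u l c (j : nat) : R := 2 ^- j * (binary j (digit_seq l c))%:R.

Lemma digit_shift_cvg l c :
  u l c j @[j --> \oo] --> digit_shift R b l c.
Proof.
have -> : u l c = series (fun t : nat => (2 : R) ^- t.+1 * (b (l + t.+1%:Z) c)%:R).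
  by apply/funext => j; rewrite /u -binary_series.
apply: nondecreasing_is_cvgn.
  apply/nondecreasing_seqP => j; rewrite /series/= big_nat_recr//= lerDl.
  by rewrite mulr_ge0// invr_ge0 exprn_ge0.
exists 1 => _ [j _ <-]; rewrite (binary_series R (digit_seq l c)).
rewrite mulrC ler_pdivrMr ?exprn_gt0// mul1r -natrX ler_nat ltnW//.
exact: binary_lt.
Qed.

Lemma digit_shift_ge l c j : u l c j <= digit_shift R b l c.
Proof.
have nd : nondecreasing_seq (u l c).
  have -> : u l c = series (fun t : nat => (2 : R) ^- t.+1 * (b (l + t.+1%:Z) c)%:R).
    by apply/funext => k; rewrite /u -binary_series.
  apply/nondecreasing_seqP => k; rewrite /series/= big_nat_recr//= lerDl.
  by rewrite mulr_ge0// invr_ge0 exprn_ge0.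
have cv := @digit_shift_cvg l c.
have := nondecreasing_cvgn_le nd (cvgP _ cv) j.
by rewrite (cvg_lim _ cv).
Qed.

Definition grid_side_gt0 (l : int) : 0 < (2 : R) ^ (- l) := exprz_gt0 _ (ltr0n _ 2).

Definition grid_cube (l : int) (k : 'I_N -> int) : cube R N :=
  Cube (2 ^ (- l) *: \row_c ((k c)%:~R + digit_shift R b l c)) (grid_side_gt0 l).

Lemma shifted_gridP (I : cube R N) : shifted_grid b I ->
  exists l k, I = grid_cube l k.
Proof. by move=> [l [k [sI cI]]]; exists l, k; apply: cube_eq. Qed.

(* [grid_cube l k] with the digits beyond the [j]-th discarded. *)
Definition truncated_cube (l : int) (k : 'I_N -> int) (j : nat) : cube R N :=
  Cube (2 ^ (- l) *: \row_c ((k c)%:~R + u l c j)) (grid_side_gt0 l).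

(** Discarding digits lowers the corners, so they converge from below; since cubes are closed below
    and open above, membership of a fixed point is eventually that in the limit cube. *)
Lemma truncated_cube_cvg l k x :
  \forall j \near \oo, cube_set (truncated_cube l k j) x <-> cube_set (grid_cube l k) x.
Proof.
have s0 := grid_side_gt0 l.
suff H c : \forall j \near \oo,
    (2 ^ (- l) * ((k c)%:~R + u l c j) <= x ord0 c <
       2 ^ (- l) * ((k c)%:~R + u l c j) + 2 ^ (- l)) =
    (2 ^ (- l) * ((k c)%:~R + digit_shift R b l c) <= x ord0 c <
       2 ^ (- l) * ((k c)%:~R + digit_shift R b l c) + 2 ^ (- l)).
  near=> j.
  have E : forall c, (2 ^ (- l) * ((k c)%:~R + u l c j) <= x ord0 c <
       2 ^ (- l) * ((k c)%:~R + u l c j) + 2 ^ (- l)) =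
    (2 ^ (- l) * ((k c)%:~R + digit_shift R b l c) <= x ord0 c <
       2 ^ (- l) * ((k c)%:~R + digit_shift R b l c) + 2 ^ (- l)).
    by near: j; apply: filter_forall.
  by split => h c; have := h c; rewrite /= !mxE E.
set S := digit_shift R b l c; set K : R := (k c)%:~R; set y := x ord0 c.
pose e := 2 ^ (- l) * (K + S); pose h : R := 2 ^ (- l).
have cv : 2 ^ (- l) * (K + u l c j) @[j --> \oo] --> e.
  by apply: cvgMl_tmp; apply: cvgD; [exact: cvg_cst|exact: digit_shift_cvg].
have le_e j : 2 ^ (- l) * (K + u l c j) <= e.
  by rewrite ler_pM2l// lerD2l digit_shift_ge.
rewrite -/e -/h in cv le_e *.
have [ye|ye] := ltP y e.
  near=> j; have h1 : y < 2 ^ (- l) * (K + u l c j) by near: j; exact: (cvgr_gt _ cv _ ye).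
  by have -> : (2 ^ (- l) * (K + u l c j) <= y) = false by rewrite leNgt h1.
have [yh|yh] := ltP y (e + h); last first.
  apply: nearW => j /=; apply/negbTE; rewrite negb_and -!leNgt.
  by rewrite [X in _ || X](le_trans _ yh) ?orbT//; exact: (lerD (le_e j) (lexx h)).
have yh' : y - h < e by rewrite ltrBlDr.
near=> j; have h1 : y - h < 2 ^ (- l) * (K + u l c j) by near: j; exact: (cvgr_gt _ cv _ yh').
by rewrite (le_trans (le_e j))//= -ltrBlDr.
Unshelve. all: by end_near. Qed.

(** A container common to all j, as domination requires: partial and full digit sums lie in [0, 1],
    hence within 1 of each other. *)
Lemma truncated_cube_sub l k j : cube_set (truncated_cube l k j) `<=`
  cube_set (Cube (2 ^ (- l) *: \row_c ((k c)%:~R + digit_shift R b l c - 1))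
    (mulr_gt0 (ltr0n _ 2) (grid_side_gt0 l))).
Proof.
have s0 := grid_side_gt0 l.
apply: cube_set_sub => c /=; rewrite !mxE.
have h1 := digit_shift_ge l c j.
have h2 : digit_shift R b l c <= 1.
  have cv := @digit_shift_cvg l c; rewrite -(cvg_lim _ cv)//.
  apply: limr_le; first exact: cvgP cv.
  apply: nearW => i; rewrite /u mulrC ler_pdivrMr ?exprn_gt0// mul1r -natrX ler_nat ltnW//.
  exact: binary_lt.
have h3 : 0 <= u l c j by rewrite mulr_ge0// invr_ge0 exprn_ge0.
split; first by rewrite ler_pM2l//; lra.
have -> (z : R) : 2 ^ (- l) * z + 2 * 2 ^ (- l) = 2 ^ (- l) * (z + 2) by ring.
have -> (z : R) : 2 ^ (- l) * z + 2 ^ (- l) = 2 ^ (- l) * (z + 1) by ring.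
by rewrite ler_pM2l//; lra.
Qed.

End DigitShift.

Lemma sum_uniq_le (R : realType) (I : finType) (s : seq I) (F : I -> R) :
  (forall i, 0 <= F i) -> uniq s -> \sum_(i <- s) F i <= \sum_i F i.
Proof.
move=> F0 us; rewrite big_uniq//= [leRHS](bigID (fun i => i \in s))/=.
by rewrite lerDl sumr_ge0.
Qed.

Lemma sum_inj_le (R : realType) (I U : finType) (h : I -> U) (F : U -> R) :
  (forall i, 0 <= F i) -> injective h -> \sum_i F (h i) <= \sum_u F u.
Proof.
move=> F0 hi; rewrite -(big_map h predT F); apply: sum_uniq_le => //.
by rewrite map_inj_uniq// index_enum_uniq.
Qed.

Definition digit_block (N j : nat) := {ffun 'I_j -> {ffun 'I_N -> bool}}.

Definition block_digit (N j : nat) (d : digit_block N j) (c : 'I_N) (t : nat) : bool :=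
  oapp (fun i : 'I_j => d i c) false (insub t).

Lemma block_digitE (N j : nat) (d : digit_block N j) c (i : 'I_j) :
  block_digit d c i = d i c.
Proof. by rewrite /block_digit valK. Qed.

(* Positions, in units of the mesh, of the cubes of side [2 ^ j] of a grid. *)
Definition grid_index (N j : nat) (K : 'I_N -> nat) (b : 'I_N -> nat -> bool) :
  'I_N -> nat := fun c => (2 ^ j * K c + binary j (b c))%N.

(** * Random grids cut off at a finest and a coarsest scale *)

Section FinestScale.
Variables (R : realType) (N T : nat).

Definition mesh : R := 2 ^- T.
Lemma mesh_gt0 : 0 < mesh. Proof. by rewrite invr_gt0 exprn_gt0. Qed.
(** The origin is moved by a multiple of every admissible cube side, so truncated cubes keep integer
    positions; the factor T makes these nonnegative for |k| < T. *)
Definition base_point : 'rV[R]_N := \row__ (- (mesh * (T * 2 ^ (2 * T))%:R)).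
Definition grid_bound : nat := (2 * T * 2 ^ (2 * T))%N.
Definition lattice_bound : nat := (2 ^ (2 * T) * grid_bound)%N.
(** Also the number of digits b_i with l < i <= T: with just these kept, the corner of a grid cube
    lies on the mesh. *)
Definition level (l : int) : nat := absz (T%:Z - l).
Definition position (l : int) (k : 'I_N -> int) (c : 'I_N) : nat :=
  absz (k c + (T * 2 ^ (2 * T - level l))%:Z).

Variables (l : int) (k : 'I_N -> int).
Hypotheses (l1 : - T%:Z < l) (l2 : l <= T%:Z).
Hypothesis kT : forall c, (absz (k c) < T)%N.

Lemma level_lt : (level l < 2 * T)%N.
Proof. by move: l1 l2; rewrite /level; lia. Qed.

Lemma levelE : l = T%:Z - (level l)%:Z.
Proof. by move: l1 l2; rewrite /level; lia. Qed.

Lemma positionE c : (position l k c)%:Z = k c + (T * 2 ^ (2 * T - level l))%:Z.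
Proof.
have := kT c; rewrite /position.
have : (T <= T * 2 ^ (2 * T - level l))%N by rewrite leq_pmulr// expn_gt0.
by move: (T * _)%N => X; lia.
Qed.

Lemma position_lt c : (position l k c < grid_bound)%N.
Proof.
have := kT c; have := positionE c; rewrite /grid_bound.
have h1 : (T <= T * 2 ^ (2 * T))%N by rewrite leq_pmulr// expn_gt0.
have h2 : (T * 2 ^ (2 * T - level l) <= T * 2 ^ (2 * T))%N.
  by rewrite leq_mul2l leq_exp2l// leq_subr orbT.
move: h1 h2; rewrite -mulnA; move: (T * 2 ^ (2 * T - level l))%N (T * 2 ^ (2 * T))%N => X Y.
by move: (position l k c); lia.
Qed.

Lemma truncated_cubeE (b : int -> {ffun 'I_N -> bool}) :
  truncated_cube R b l k (level l) =
  lattice_cube base_point mesh_gt0 (level l)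
    (grid_index (level l) (position l k) (digit_seq b l)).
Proof.
have two0 : (2 : R) != 0 by rewrite pnatr_eq0.
have sideE : 2 ^ (- l) = mesh * 2 ^+ level l :> R.
  by rewrite {1}levelE opprB expfzDr// /mesh mulrC exprnN.
apply: cube_eq; rewrite /= sideE//.
apply/rowP => c; rewrite !mxE /grid_index natrD [(_ * position _ _ _)%:R]natrM natrX.
have -> : ((position l k c)%:R : R) = (k c)%:~R + (T * 2 ^ (2 * T - level l))%:R.
  by rewrite -[LHS]/((position l k c)%:Z%:~R) positionE intrD.
have -> : (T * 2 ^ (2 * T))%N = (2 ^ level l * (T * 2 ^ (2 * T - level l)))%N.
  rewrite mulnCA -expnD subnKC// ltnW//; exact: level_lt.
rewrite natrM natrX; have e0 : (2 : R) ^+ level l != 0 by rewrite expf_neq0.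
move: (_ ^+ level l) (_%:~R) ((T * _)%:R) ((binary _ _)%:R) e0 => z x y w e0.
by field.
Qed.

End FinestScale.

Section BlockSums.
Variables (R : realType) (N T j : nat).

Lemma grid_index_lt (K : 'I_N -> nat) b c : (j <= 2 * T)%N ->
  (K c < grid_bound T)%N -> (grid_index j K b c < lattice_bound T)%N.
Proof.
move=> jT Kc; rewrite /grid_index /lattice_bound.
apply: (@leq_trans (2 ^ j * (K c).+1)); first by rewrite mulnS addnC ltn_add2r binary_lt.
by apply: leq_mul => //; rewrite leq_exp2l.
Qed.

(** Position K and the number coded by the digits d are quotient and remainder of the lattice index
    in the division by 2^j, so every lattice cube arises at most once. This is the equidistribution
    of random grids. *)
Lemma block_sum_le (F : cube R N -> R) (h : R) (h0 : 0 < h) v : (j <= 2 * T)%N ->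
  (forall I, 0 <= F I) ->
  \sum_(d : digit_block N j) \sum_(K : {ffun 'I_N -> 'I_(grid_bound T)})
    F (lattice_cube v h0 j (grid_index j (nats K) (block_digit d)))
  <= \sum_(k : {ffun 'I_N -> 'I_(lattice_bound T)}) F (lattice_cube v h0 j (nats k)).
Proof.
move=> jT F0; rewrite pair_big/=.
pose h' (x : digit_block N j * {ffun 'I_N -> 'I_(grid_bound T)}) :
    {ffun 'I_N -> 'I_(lattice_bound T)} :=
  [ffun c => Ordinal (@grid_index_lt (nats x.2) (block_digit x.1) c jT (ltn_ord _))].
have h'E x : nats (h' x) = grid_index j (nats x.2) (block_digit x.1).
  by apply/funext => c; rewrite /nats ffunE.
under eq_bigr do rewrite -h'E.
apply: (@sum_inj_le _ _ _ h' (fun k => F (lattice_cube v h0 j (nats k)))) => //.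
move=> [d K] [d' K'] /ffunP e.
have ec c : (2 ^ j * K c + binary j (block_digit d c) =
    2 ^ j * K' c + binary j (block_digit d' c))%N.
  by have := congr1 val (e c); rewrite !ffunE.
have eK c : K c = K' c.
  apply: val_inj => /=; have := congr1 (divn^~ (2 ^ j)%N) (ec c).
  by rewrite ![(2 ^ j * _)%N]mulnC !divnMDl ?expn_gt0// !divn_small ?binary_lt// !addn0.
congr pair; last by apply/ffunP.
apply/ffunP => t; apply/ffunP => c.
rewrite -!block_digitE; apply: (@binary_inj j) => //.
by have := ec c; rewrite eK => /addnI.
Qed.

End BlockSums.

Section BlockEvents.
Variables (R : realType) (N : nat) (X : digit_space R N).

Definition block_event (l : int) (j : nat) (d : digit_block N j) : set (ds_sample X) :=
  [set w | forall t : 'I_j, digit w (l + t.+1%:Z) = d t].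

Definition block_of (l : int) (j : nat) (w : ds_sample X) : digit_block N j :=
  [ffun t : 'I_j => digit w (l + t.+1%:Z)].

Lemma block_ofP l j w : block_event l (block_of l j w) w.
Proof. by move=> t; rewrite ffunE. Qed.

Lemma binary_block_of l j w c :
  binary j (block_digit (block_of l j w) c) = binary j (digit_seq (digit w) l c).
Proof.
apply: eq_binary => t tj.
by rewrite (block_digitE _ c (Ordinal tj)) ffunE.
Qed.

Lemma block_event_bigcap l j (d : digit_block N j) : exists v,
  block_event l d = \bigcap_(i in [set` [seq l + t.+1%:Z | t <- iota 0 j]])
    [set w | digit w i = v i].
Proof.
(* The digit of index i = l + t + 1 sits at place t = |i - l| - 1 of the block. *)
exists (fun i => oapp d [ffun=> false] (insub (absz (i - l)).-1)).
apply/seteqP; split => [w h i /= /mapP[t]|w h t].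
  rewrite mem_iota add0n => /= tj ->; rewrite addrAC subrr add0r/=.
  by rewrite (insubT (fun t => t < j)%N tj)/= -h.
have /= -> := h (l + t.+1%:Z).
  by rewrite addrAC subrr add0r/= valK.
by apply/mapP; exists (val t) => //; rewrite mem_iota add0n ltn_ord.
Qed.

Lemma measurable_block_event l j (d : digit_block N j) : measurable (block_event l d).
Proof.
have [v ->] := block_event_bigcap l d.
by apply: fin_bigcap_measurable => // i _; exact: digit_measurable.
Qed.

Lemma block_event_prob l j (d : digit_block N j) :
  ds_prob X (block_event l d) = ((2 ^- j) ^+ N)%:E.
Proof.
have [v ->] := block_event_bigcap l d.
rewrite digit_independent; last first.
  by rewrite map_inj_uniq ?iota_uniq// => s t /addrI/eqP; rewrite eqz_nat eqSS => /eqP.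
under eq_bigr do rewrite digit_uniform.
rewrite prodEFin big_const_seq count_predT size_map size_iota iter_mulr_1.
by rewrite !exprVn -!exprM mulnC.
Qed.

End BlockEvents.
Arguments block_event {R N} X l {j} d.

Section LowerLimits.
Variable R : realType.

Lemma le_limn_einf (a : R) (u : nat -> R) (H : (\bar R)^nat) :
  u @ \oo --> a -> (\forall k \near \oo, ((u k)%:E <= H k)%E) ->
  (a%:E <= limn_einf H)%E.
Proof.
move=> ua uH; have ua' : (EFin \o u) @ \oo --> a%:E.
  by apply: cvg_EFin => //; exact: nearW.
rewrite -(cvg_limn_einf_sup ua').1 !limn_einf_lim.
apply: lee_lim; [exact: is_cvg_einfs|exact: is_cvg_einfs|].
case: uH => k0 _ uH; near=> k.
apply: le_ereal_inf_tmp => _ [j /= kj <-].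
apply: (@le_trans _ _ ((EFin \o u) j)); first by apply: ereal_inf_lbound; exists j.
apply: uH; apply: leq_trans kj; near: k; exact: nbhs_infty_ge.
Unshelve. all: by end_near. Qed.

(* [psi] is a lower approximation; it need not be [Phi] itself, which may be
   discontinuous where a mass vanishes. *)
Lemma sum_lower_limit (I : eqType) (s : seq I) (Phi : I -> R) (Phi_ : nat -> I -> R) :
  (forall i, i \in s -> exists psi : nat -> R, psi @ \oo --> Phi i /\
     \forall k \near \oo, psi k <= Phi_ k i) ->
  exists psi : nat -> R, psi @ \oo --> \sum_(i <- s) Phi i /\
     \forall k \near \oo, psi k <= \sum_(i <- s) Phi_ k i.
Proof.
elim: s => [|i s IH] H.
  exists (fun=> 0); rewrite big_nil; split; first exact: cvg_cst.
  by apply: nearW => k; rewrite big_nil.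
have [psi1 [c1 l1]] := H i (mem_head _ _).
have [|psi2 [c2 l2]] := IH; first by move=> j js; apply: H; rewrite in_cons js orbT.
exists (psi1 \+ psi2); rewrite big_cons; split; first exact: cvgD.
by near=> k; rewrite big_cons; apply: lerD; near: k.
Unshelve. all: by end_near. Qed.

End LowerLimits.

Section ExactIntegrals.
Context d (T : measurableType d) (R : realType) (mu : {measure set T -> \bar R}).

(** Measurability and sign travel with the value, because additivity of the integral asks for them
    at each level of a nested sum. *)
Definition has_integral (f : T -> \bar R) (v : \bar R) : Prop :=
  [/\ measurable_fun setT f, forall x, (0 <= f x)%E & (\int[mu]_x f x = v)%E].

Lemma has_integral_sum (I : finType) (f : I -> T -> \bar R) (v : I -> \bar R) :
  (forall i, has_integral (f i) (v i)) ->
  has_integral (fun x => \sum_i f i x)%E (\sum_i v i)%E.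
Proof.
move=> H; split.
- by apply: emeasurable_sum => i; have [] := H i.
- by move=> x; apply: sume_ge0 => i _; have [_ ] := H i.
rewrite ge0_integral_sum//.
- by apply: eq_bigr => i _; have [] := H i.
- by move=> i; have [] := H i.
- by move=> i x _; have [_] := H i.
Qed.

Lemma has_integral_indic (A : set T) (c : R) : measurable A -> 0 <= c ->
  has_integral (fun x => c%:E * (\1_A x)%:E)%E (c%:E * mu A)%E.
Proof.
move=> mA c0.
have mI : measurable_fun setT (fun x => (\1_A x)%:E : \bar R).
  by apply/measurable_EFinP; exact: measurable_indic.
split.
- exact: measurable_funeM.
- by move=> x; rewrite mule_ge0// lee_fin.
by rewrite ge0_integralZl// integral_indic// setIT.
Qed.

(* When [f] is not measurable its integral is a lower integral. *)
Lemma le_lower_integral (f g : T -> \bar R) : (forall x, (0 <= f x)%E) ->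
  (forall x, (f x <= g x)%E) -> (\int[mu]_x f x <= \int[mu]_x g x)%E.
Proof.
move=> f0 fg; have g0 x : (0 <= g x)%E by exact: le_trans (fg x).
rewrite !ge0_integralTE//; apply: ereal_sup_le => _ [h /= hf <-].
by exists h => // x; apply: (le_trans (hf x)).
Qed.

End ExactIntegrals.

(** * Expectation of the truncated forms *)

Section RandomGrids.
Variables (R : realType) (m n : nat).
Variables (X : digit_space R m) (Y : digit_space R n).
Variable Phi : cube R m -> cube R n -> R.
Hypothesis Phi0 : forall I J, 0 <= Phi I J.
Local Notation P := (ds_prob X \x ds_prob Y)%E.

Section FixedFinestScale.
Variable T : nat.
Local Notation h0 := (mesh_gt0 R T).
Local Notation v N := (base_point R N T).

Definition block_form (j j' : nat) (a : digit_block m j) (b : digit_block n j') : R :=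
  \sum_(K : {ffun 'I_m -> 'I_(grid_bound T)}) \sum_(K' : {ffun 'I_n -> 'I_(grid_bound T)})
    Phi (lattice_cube (v m) h0 j (grid_index j (nats K) (block_digit a)))
        (lattice_cube (v n) h0 j' (grid_index j' (nats K') (block_digit b))).

Lemma block_form_ge0 j j' a b : 0 <= @block_form j j' a b.
Proof. by do 2 (apply: sumr_ge0 => ? _). Qed.

Definition block_set (j j' : nat) (a : digit_block m j) (b : digit_block n j') :
  set (ds_sample X * ds_sample Y) :=
  block_event X (T%:Z - j%:Z) a `*` block_event Y (T%:Z - j'%:Z) b.

(** For each pair of scales exactly one pair of blocks occurs at w, so this is a form over the
    truncated grids at w, written as a simple function with explicit integral. *)
Definition truncated_form (w : ds_sample X * ds_sample Y) : \bar R :=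
  (\sum_(j < 2 * T) \sum_(j' < 2 * T) \sum_(a : digit_block m j) \sum_(b : digit_block n j')
    (block_form a b)%:E * (\1_(block_set a b) w)%:E)%E.

Lemma truncated_form_integral : has_integral P truncated_form
  (\sum_(j < 2 * T) \sum_(j' < 2 * T) \sum_(a : digit_block m j) \sum_(b : digit_block n j')
    (block_form a b)%:E * ((2 ^- j) ^+ m * (2 ^- j') ^+ n)%:E)%E.
Proof.
apply: has_integral_sum => j; apply: has_integral_sum => j'.
apply: has_integral_sum => a; apply: has_integral_sum => b.
rewrite EFinM -(block_event_prob X (T%:Z - j%:Z) a) -(block_event_prob Y (T%:Z - j'%:Z) b).
rewrite -product_measure1E; try exact: measurable_block_event.
apply: has_integral_indic; last exact: block_form_ge0.
by apply: measurableX; exact: measurable_block_event.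
Qed.

(** Each block event has probability 2^(-jm) 2^(-j'n), the weight in [lattice_average], and by
    [block_sum_le] blocks and positions together meet each lattice rectangle at most once. *)
Lemma truncated_form_expectation (b : R) :
  lattice_average (2 * T) (lattice_bound T) (v m) (v n) h0 h0 Phi <= b ->
  (\int[P]_w truncated_form w <= b%:E)%E.
Proof.
move=> avg; have [_ _ ->] := truncated_form_integral.
under eq_bigr => j _ do under eq_bigr => j' _ do
  (under eq_bigr => x _ do (under eq_bigr => y _ do rewrite -EFinM; rewrite sumEFin);
   rewrite sumEFin).
under eq_bigr => j _ do rewrite sumEFin.
rewrite sumEFin lee_fin; apply: le_trans avg.
have -> : lattice_average (2 * T) (lattice_bound T) (v m) (v n) h0 h0 Phi =
  \sum_(j < 2 * T) \sum_(j' < 2 * T) (2 ^- j) ^+ m * (2 ^- j') ^+ n *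
   \sum_(k : {ffun 'I_m -> 'I_(lattice_bound T)})
   \sum_(k' : {ffun 'I_n -> 'I_(lattice_bound T)})
     Phi (lattice_cube (v m) h0 j (nats k)) (lattice_cube (v n) h0 j' (nats k')).
  rewrite /lattice_average.
  rewrite -(pair_big predT predT (fun (j : 'I_(2 * T)) (k : {ffun 'I_m -> 'I_(lattice_bound T)}) =>
    \sum_(b : 'I_(2 * T) * {ffun 'I_n -> 'I_(lattice_bound T)})
    (2 ^- j) ^+ m * (2 ^- b.1) ^+ n *
    Phi (lattice_cube (v m) h0 j (nats k)) (lattice_cube (v n) h0 b.1 (nats b.2))))/=.
  apply: eq_bigr => j _.
  under eq_bigr => k _.
    rewrite -(pair_big predT predT (fun (j' : 'I_(2 * T)) (k' : {ffun 'I_n -> 'I_(lattice_bound T)}) =>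
      (2 ^- j) ^+ m * (2 ^- j') ^+ n *
      Phi (lattice_cube (v m) h0 j (nats k)) (lattice_cube (v n) h0 j' (nats k'))))/=.
    over.
  rewrite exchange_big/=; apply: eq_bigr => j' _.
  by rewrite mulr_sumr; apply: eq_bigr => k _; rewrite mulr_sumr.
apply: ler_sum => j _; apply: ler_sum => j' _.
have jT : (j <= 2 * T)%N by rewrite ltnW.
have jT' : (j' <= 2 * T)%N by rewrite ltnW.
under eq_bigr => x _ do rewrite -mulr_suml.
rewrite -mulr_suml mulrC ler_wpM2l ?mulr_ge0 ?exprn_ge0 ?invr_ge0 ?exprn_ge0//.
have step1 := @block_sum_le R m T j (fun I =>
   \sum_(k' : {ffun 'I_n -> 'I_(lattice_bound T)}) Phi I (lattice_cube (v n) h0 j' (nats k')))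
   (mesh R T) h0 (v m) jT (fun I => sumr_ge0 _ (fun k' _ => Phi0 _ _)).
apply: le_trans step1; apply: ler_sum => a _; rewrite /block_form exchange_big/=.
apply: ler_sum => K _.
exact: (@block_sum_le R n T j' (fun J => Phi _ J) (mesh R T) h0 (v n) jT').
Qed.

Lemma truncated_form_ge (w : ds_sample X * ds_sample Y) :
  ((\sum_(x : ('I_(2 * T) * {ffun 'I_m -> 'I_(grid_bound T)}) *
              ('I_(2 * T) * {ffun 'I_n -> 'I_(grid_bound T)}))
    Phi (lattice_cube (v m) h0 x.1.1 (grid_index x.1.1 (nats x.1.2)
          (digit_seq (digit w.1) (T%:Z - x.1.1%:Z))))
        (lattice_cube (v n) h0 x.2.1 (grid_index x.2.1 (nats x.2.2)
          (digit_seq (digit w.2) (T%:Z - x.2.1%:Z)))))%:E <= truncated_form w)%E.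
Proof.
pose G (j j' : 'I_(2 * T)) (K : {ffun 'I_m -> 'I_(grid_bound T)})
   (K' : {ffun 'I_n -> 'I_(grid_bound T)}) :=
    Phi (lattice_cube (v m) h0 j (grid_index j (nats K)
          (digit_seq (digit w.1) (T%:Z - j%:Z))))
        (lattice_cube (v n) h0 j' (grid_index j' (nats K')
          (digit_seq (digit w.2) (T%:Z - j'%:Z)))).
have -> : \sum_(x : ('I_(2 * T) * {ffun 'I_m -> 'I_(grid_bound T)}) *
              ('I_(2 * T) * {ffun 'I_n -> 'I_(grid_bound T)}))
    G x.1.1 x.2.1 x.1.2 x.2.2 = \sum_j \sum_j' \sum_K \sum_K' G j j' K K'.
  rewrite -(pair_big predT predT (fun x y => G x.1 y.1 x.2 y.2))/=.
  rewrite -(pair_big predT predT (fun j K => \sum_y G j y.1 K y.2))/=.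
  apply: eq_bigr => j _; rewrite [RHS]exchange_big/=; apply: eq_bigr => K _.
  by rewrite -(pair_big predT predT (fun j' K' => G j j' K K'))/=.
rewrite -sumEFin; apply: lee_sum => j _; rewrite -sumEFin; apply: lee_sum => j' _.
have pos (a : digit_block m j) (b : digit_block n j') :
    (0 <= (block_form a b)%:E * (\1_(block_set a b) w)%:E)%E.
  by rewrite -EFinM lee_fin mulr_ge0 ?block_form_ge0.
pose a := block_of (T%:Z - j%:Z) j w.1; pose b := block_of (T%:Z - j'%:Z) j' w.2.
rewrite (bigD1 a)//= (bigD1 b)//= -addeA.
apply: (@le_trans _ _ ((block_form a b)%:E * (\1_(block_set a b) w)%:E)%E).
  have -> : \1_(block_set a b) w = 1 :> R.
    by rewrite indicE mem_set//; split; exact: block_ofP.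
  rewrite mule1 lee_fin; apply: ler_sum => K _; apply: ler_sum => K' _.
  have eI : grid_index j (nats K) (block_digit a) =
      grid_index j (nats K) (digit_seq (digit w.1) (T%:Z - j%:Z)).
    by apply/funext => c; rewrite /grid_index binary_block_of.
  have eJ : grid_index j' (nats K') (block_digit b) =
      grid_index j' (nats K') (digit_seq (digit w.2) (T%:Z - j'%:Z)).
    by apply/funext => c; rewrite /grid_index binary_block_of.
  by rewrite /G eI eJ.
by rewrite leeDl// adde_ge0// sume_ge0// => a' _; rewrite sume_ge0.
Qed.

End FixedFinestScale.
End RandomGrids.

(** * Passage to the limit as the mesh is refined *)

Section TwoWeightLimit.
Variables (R : realType) (m n : nat).
Local Notation T := (borel_prod R m n).
Variables sigma omega : {measure set T -> \bar R}.
Hypotheses (lfs : locally_finite sigma) (lfo : locally_finite omega).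
Variables p q : R.
Variables f g : T -> \bar R.
Hypotheses (mf : measurable_fun setT f) (f0 : forall x, (0 <= f x)%E).
Hypotheses (mg : measurable_fun setT g) (g0 : forall x, (0 <= g x)%E).
Hypothesis lff : forall I J, (\int[sigma]_(x in rect I J) f x < +oo)%E.
Hypothesis lfg : forall I J, (\int[omega]_(x in rect I J) g x < +oo)%E.
Local Notation Phi := (two_weight_mass sigma omega p q f g).

Let one0 (x : T) : (0 <= cst 1%E x :> \bar R)%E. Proof. exact: lee01. Qed.
Let mone : measurable_fun [set: T] (cst 1%E : T -> \bar R).
Proof. exact: measurable_cst. Qed.

Lemma two_weight_mass_ge0 I J : 0 <= Phi I J.
Proof. by rewrite mulr_ge0// normalized_mass_ge0. Qed.

Lemma powR_cvg (u : nat -> R) (a e : R) : 0 < a -> u @ \oo --> a ->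
  exists2 v : nat -> R, v @ \oo --> a `^ e & \forall k \near \oo, u k `^ e = v k.
Proof.
move=> a0 ua; exists (fun k => expR (e * ln (u k))).
  rewrite /powR gt_eqF//; apply: (continuous_cvg _ (@continuous_expR R _)).
  apply: cvgMl_tmp; exact: (continuous_cvg _ (continuous_ln a0)).
near=> k; rewrite /powR gt_eqF//; near: k; exact: (cvgr_gt _ ua _ a0).
Unshelve. all: by end_near. Qed.

(** All four masses converge. If the sigma or omega mass of the limit rectangle vanishes, so does
    [Phi] there and 0 is a lower approximation; otherwise the negative powers are continuous at the
    limit. *)
Lemma two_weight_lower_limit (I_ : nat -> cube R m) (J_ : nat -> cube R n) I J I' J' :
  (forall k, cube_set (I_ k) `<=` cube_set I') ->
  (forall k, cube_set (J_ k) `<=` cube_set J') ->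
  (forall x, \forall k \near \oo, cube_set (I_ k) x <-> cube_set I x) ->
  (forall x, \forall k \near \oo, cube_set (J_ k) x <-> cube_set J x) ->
  exists psi : nat -> R, psi @ \oo --> Phi I J /\
    \forall k \near \oo, psi k <= Phi (I_ k) (J_ k).
Proof.
move=> sI sJ cI cJ.
have cs := mass_cvg mone one0 (rmass_lf lfs) sI sJ cI cJ.
have co := mass_cvg mone one0 (rmass_lf lfo) sI sJ cI cJ.
have cf := mass_cvg mf f0 lff sI sJ cI cJ.
have cg := mass_cvg mg g0 lfg sI sJ cI cJ.
have zero : Phi I J = 0 -> exists psi : nat -> R, psi @ \oo --> Phi I J /\
    \forall k \near \oo, psi k <= Phi (I_ k) (J_ k).
  move=> ->; exists (fun=> 0); split; first exact: cvg_cst.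
  by apply: nearW => k; exact: two_weight_mass_ge0.
have [sz|sz] := eqVneq (mass sigma (cst 1%E) I J) 0.
  by apply: zero; rewrite /two_weight_mass /normalized_mass (mass_eq0 lfs mf sz) mulr0 mul0r.
have [oz|oz] := eqVneq (mass omega (cst 1%E) I J) 0.
  by apply: zero; rewrite /two_weight_mass /normalized_mass (mass_eq0 lfo mg oz) !mulr0.
have sp : 0 < mass sigma (cst 1%E) I J by rewrite lt_neqAle eq_sym sz mass_cst_ge0.
have op : 0 < mass omega (cst 1%E) I J by rewrite lt_neqAle eq_sym oz mass_cst_ge0.
have [v1 c1 e1] := powR_cvg (- (1 / conj_exp p)) sp cs.
have [v2 c2 e2] := powR_cvg (- (1 / q)) op co.
exists (fun k => v1 k * mass sigma f (I_ k) (J_ k) * (v2 k * mass omega g (I_ k) (J_ k))).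
split; first by apply: cvgM; apply: cvgM.
near=> k; rewrite /two_weight_mass /normalized_mass.
rewrite le_eqVlt; apply/orP; left; apply/eqP; congr (_ * _ * (_ * _)); apply/esym; near: k.
- exact: e1.
- exact: e2.
Unshelve. all: by end_near. Qed.

End TwoWeightLimit.

Section RandomForm.
Variables (R : realType) (m n : nat).
Local Notation T := (borel_prod R m n).
Variables sigma omega : {measure set T -> \bar R}.
Hypotheses (lfs : locally_finite sigma) (lfo : locally_finite omega).
Variables p q : R.
Variable K : cube R m -> cube R n -> R.
Hypothesis K0 : forall I J, 0 <= K I J.
Variables f g : T -> \bar R.
Hypotheses (mf : measurable_fun setT f) (f0 : forall x, (0 <= f x)%E).
Hypotheses (mg : measurable_fun setT g) (g0 : forall x, (0 <= g x)%E).
Hypothesis lff : forall I J, (\int[sigma]_(x in rect I J) f x < +oo)%E.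
Hypothesis lfg : forall I J, (\int[omega]_(x in rect I J) g x < +oo)%E.
Local Notation Phi := (two_weight_mass sigma omega p q f g).
Variables (X : digit_space R m) (Y : digit_space R n).

Let Phi0 I J : 0 <= Phi I J. Proof. exact: two_weight_mass_ge0. Qed.

Lemma level_infty (l : int) (P : nat -> Prop) : (\forall j \near \oo, P j) ->
  \forall S \near \oo, P (level S l).
Proof.
move=> [j0 _ Pj]; exists (j0 + absz l)%N => // S /= jS; apply: Pj => /=.
by rewrite /level; lia.
Qed.

(** A finite part of the grid at w is eventually inside the window of scales and positions seen at
    finest scale 2^(-S), and distinct rectangles keep distinct indices in it. *)
Lemma grid_sum_le (w : ds_sample X * ds_sample Y)
    (s : seq (cube R m * cube R n))
    (l1 : cube R m -> int) (k1 : cube R m -> 'I_m -> int)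
    (l2 : cube R n -> int) (k2 : cube R n -> 'I_n -> int) : uniq s ->
  (forall Q, Q \in s -> Q.1 = grid_cube R (digit w.1) (l1 Q.1) (k1 Q.1)) ->
  (forall Q, Q \in s -> Q.2 = grid_cube R (digit w.2) (l2 Q.2) (k2 Q.2)) ->
  \forall S \near \oo,
    ((\sum_(Q <- s) Phi
      (truncated_cube R (digit w.1) (l1 Q.1) (k1 Q.1) (level S (l1 Q.1)))
      (truncated_cube R (digit w.2) (l2 Q.2) (k2 Q.2) (level S (l2 Q.2))))%:E <=
    truncated_form Phi S w)%E.
Proof.
move=> us g1 g2.
have [N hN] := seq_nat_bound s (fun Q => (absz (l1 Q.1) + absz (l2 Q.2) +
  \sum_c absz (k1 Q.1 c) + \sum_c absz (k2 Q.2 c))%N).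
exists N.+1 => // S /= NS.
have L1 Q : Q \in s -> - S%:Z < l1 Q.1 /\ l1 Q.1 <= S%:Z.
  by move=> /hN h; split; move: h NS; clear; lia.
have L2 Q : Q \in s -> - S%:Z < l2 Q.2 /\ l2 Q.2 <= S%:Z.
  by move=> /hN h; split; move: h NS; clear; lia.
have KS1 Q : Q \in s -> forall c, (absz (k1 Q.1 c) < S)%N.
  move=> /hN; rewrite -addnA => h c; have : (absz (k1 Q.1 c) <= \sum_c absz (k1 Q.1 c))%N.
    by rewrite (bigD1 c)//= leq_addr.
  by move: h NS; clear; lia.
have KS2 Q : Q \in s -> forall c, (absz (k2 Q.2 c) < S)%N.
  move=> /hN h c; have : (absz (k2 Q.2 c) <= \sum_c absz (k2 Q.2 c))%N.
    by rewrite (bigD1 c)//= leq_addr.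
  by move: h NS; clear; lia.
have S0 : (0 < 2 * S)%N by move: NS; clear; lia.
have B0 : (0 < grid_bound S)%N by rewrite /grid_bound muln_gt0 S0 expn_gt0.
(* The defaults of [insubd] are not reached for the cubes of s, since S exceeds all their scales and
   positions. *)
pose lev (l : int) : 'I_(2 * S) := insubd (Ordinal S0) (level S l).
pose pos M (l : int) (k : 'I_M -> int) : {ffun 'I_M -> 'I_(grid_bound S)} :=
  [ffun c => insubd (Ordinal B0) (position S l k c)].
have levE l : - S%:Z < l -> l <= S%:Z -> lev l = level S l :> nat.
  by move=> h1 h2; rewrite /lev val_insubd level_lt.
have posE M (l : int) (k : 'I_M -> int) : - S%:Z < l -> l <= S%:Z ->
    (forall c, (absz (k c) < S)%N) -> nats (pos M l k) = position S l k.
  move=> h1 h2 h3; apply/funext => c.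
  by rewrite /nats ffunE val_insubd position_lt.
have inj M (l l' : int) (k k' : 'I_M -> int) : - S%:Z < l -> l <= S%:Z ->
    (forall c, (absz (k c) < S)%N) -> - S%:Z < l' -> l' <= S%:Z ->
    (forall c, (absz (k' c) < S)%N) ->
    lev l = lev l' -> pos M l k = pos M l' k' -> l = l' /\ k = k'.
  move=> a1 a2 a3 b1 b2 b3 elev epos.
  have e1 : level S l = level S l' by rewrite -levE// elev levE.
  have e2 : l = l' by rewrite (levelE a1 a2) (levelE b1 b2) e1.
  split => //; apply/funext => c.
  have e3 : position S l k = position S l' k' by rewrite -posE// epos posE.
  have := congr1 (fun h => (h c)%:Z) e3; rewrite /= (positionE a1 a2 a3) (positionE b1 b2 b3).
  by rewrite e1 => /addIr.
pose h (Q : cube R m * cube R n) :=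
  ((lev (l1 Q.1), pos m (l1 Q.1) (k1 Q.1)), (lev (l2 Q.2), pos n (l2 Q.2) (k2 Q.2))).
apply: le_trans (truncated_form_ge Phi0 S w).
pose F (x : ('I_(2 * S) * {ffun 'I_m -> 'I_(grid_bound S)}) *
            ('I_(2 * S) * {ffun 'I_n -> 'I_(grid_bound S)})) :=
    Phi (lattice_cube (base_point R m S) (mesh_gt0 R S) x.1.1 (grid_index x.1.1 (nats x.1.2)
          (digit_seq (digit w.1) (S%:Z - x.1.1%:Z))))
        (lattice_cube (base_point R n S) (mesh_gt0 R S) x.2.1 (grid_index x.2.1 (nats x.2.2)
          (digit_seq (digit w.2) (S%:Z - x.2.1%:Z)))).
rewrite lee_fin -/(\sum_x F x).
apply: (@le_trans _ _ (\sum_(x <- [seq h Q | Q <- s]) F x)); last first.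
  apply: sum_uniq_le; first by move=> x; exact: Phi0.
  rewrite map_inj_in_uniq// => Q Q' Qs Qs' /= [].
  have [a1 a2] := L1 _ Qs; have [b1 b2] := L1 _ Qs'.
  have [a3 a4] := L2 _ Qs; have [b3 b4] := L2 _ Qs'.
  move=> e1 e2 e3 e4.
  have [u1 u2] := inj _ _ _ _ _ a1 a2 (KS1 _ Qs) b1 b2 (KS1 _ Qs') e1 e2.
  have [u3 u4] := inj _ _ _ _ _ a3 a4 (KS2 _ Qs) b3 b4 (KS2 _ Qs') e3 e4.
  case: Q Q' Qs Qs' u1 u2 u3 u4 {e1 e2 e3 e4 a1 a2 a3 a4 b1 b2 b3 b4} =>
    [I J] [I' J'] Qs Qs'/= u1 u2 u3 u4.
  congr pair.
    transitivity (grid_cube R (digit w.1) (l1 I) (k1 I)); first exact: (g1 _ Qs).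
    by rewrite u1 u2; apply/esym; exact: (g1 _ Qs').
  transitivity (grid_cube R (digit w.2) (l2 J) (k2 J)); first exact: (g2 _ Qs).
  by rewrite u3 u4; apply/esym; exact: (g2 _ Qs').
rewrite big_map big_seq [leRHS]big_seq le_eqVlt; apply/orP; left; apply/eqP.
apply: eq_bigr => Q Qs; rewrite /F /h; cbn [fst snd].
have [a1 a2] := L1 _ Qs; have [a3 a4] := L2 _ Qs.
rewrite !levE// !posE// -?levelE//; try exact: KS1; try exact: KS2.
by rewrite !truncated_cubeE//; [exact: KS2|exact: KS1].
Qed.

(** The form at w is at most the lower limit of A times the truncated forms, whose expectations are
    at most A b, and Fatou's lemma applies. That lower limit is measurable in w; for the form itself
    monotonicity of the lower integral suffices. *)
Lemma random_form_bound (A b : R) : 0 <= A ->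
  (forall I J, K I J * mass sigma f I J * mass omega g I J <= A * Phi I J) ->
  (forall J B v1 v2 h1 h2 (h10 : 0 < h1) (h20 : 0 < h2),
    lattice_average J B v1 v2 h10 h20 Phi <= b) ->
  (\int[ds_prob X \x ds_prob Y]_w
     dyadic_form K sigma omega (shifted_grid (digit w.1)) (shifted_grid (digit w.2)) f g
   <= (A * b)%:E)%E.
Proof.
move=> A0 KA avg.
have tf S := truncated_form_integral X Y Phi0 S.
pose H S (w : ds_sample X * ds_sample Y) := (A%:E * truncated_form Phi S w)%E.
have mH S : measurable_fun setT (H S).
  by apply: measurable_funeM; have [] := tf S.
have H0 S w : (0 <= H S w)%E.
  by rewrite mule_ge0//; have [_ + _] := tf S; exact.
apply: (@le_trans _ _ (\int[ds_prob X \x ds_prob Y]_w limn_einf (H^~ w))%E).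
  apply: le_lower_integral => w.
    apply: esum_ge0 => Q _; rewrite !mule_ge0 ?lee_fin ?integral_ge0//.
  apply: (dyadic_form_le f0 g0 lff lfg) => s us sD.
  have /choice[lk1 h1] : forall I, exists lk : int * ('I_m -> int),
      shifted_grid (digit w.1) I -> I = grid_cube R (digit w.1) lk.1 lk.2.
    move=> I; have [/shifted_gridP[l [k ->]]|nG] := pselect (shifted_grid (digit w.1) I).
      by exists (l, k).
    by exists (0, fun=> 0).
  have /choice[lk2 h2] : forall I, exists lk : int * ('I_n -> int),
      shifted_grid (digit w.2) I -> I = grid_cube R (digit w.2) lk.1 lk.2.
    move=> I; have [/shifted_gridP[l [k ->]]|nG] := pselect (shifted_grid (digit w.2) I).
      by exists (l, k).
    by exists (0, fun=> 0).
  have g1 Q : Q \in s -> Q.1 = grid_cube R (digit w.1) (lk1 Q.1).1 (lk1 Q.1).2.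
    by move=> /sD[+ _]; exact: h1.
  have g2 Q : Q \in s -> Q.2 = grid_cube R (digit w.2) (lk2 Q.2).1 (lk2 Q.2).2.
    by move=> /sD[_ +]; exact: h2.
  pose Phi_ S (Q : cube R m * cube R n) := Phi
      (truncated_cube R (digit w.1) (lk1 Q.1).1 (lk1 Q.1).2 (level S (lk1 Q.1).1))
      (truncated_cube R (digit w.2) (lk2 Q.2).1 (lk2 Q.2).2 (level S (lk2 Q.2).1)).
  have [|psi [psic psile]] := @sum_lower_limit R _ s (fun Q => Phi Q.1 Q.2) Phi_.
    move=> Q Qs; rewrite {1}(g1 Q Qs) {1}(g2 Q Qs).
    apply: (two_weight_lower_limit lfs lfo p q mf f0 mg g0 lff lfg).
    - by move=> S; exact: truncated_cube_sub.
    - by move=> S; exact: truncated_cube_sub.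
    - move=> x; apply: (@level_infty _ (fun j => cube_set (truncated_cube R (digit w.1) _ _ j) x <-> _)).
      exact: truncated_cube_cvg.
    - move=> x; apply: (@level_infty _ (fun j => cube_set (truncated_cube R (digit w.2) _ _ j) x <-> _)).
      exact: truncated_cube_cvg.
  have gs := @grid_sum_le w s (fun I => (lk1 I).1) (fun I => (lk1 I).2)
    (fun I => (lk2 I).1) (fun I => (lk2 I).2) us g1 g2.
  apply: (@le_trans _ _ (A * \sum_(Q <- s) Phi Q.1 Q.2)%:E).
    by rewrite lee_fin mulr_sumr; apply: ler_sum => Q _.
  apply: (le_limn_einf (cvgMl_tmp psic)); near=> S.
  rewrite EFinM lee_wpmul2l// ?lee_fin//.
  apply: (@le_trans _ _ (\sum_(Q <- s) Phi_ S Q)%:E); last by near: S; exact: gs.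
  by rewrite lee_fin; near: S.
apply: le_trans (fatou _ _ _ _) _ => //.
rewrite limn_einf_lim; apply: lime_le; first exact: is_cvg_einfs.
apply: nearW => S; apply: (@le_trans _ _ (\int[ds_prob X \x ds_prob Y]_w H S w)%E).
  by apply: ereal_inf_lbound; exists S => /=.
have [mt t0 _] := tf S.
rewrite ge0_integralZl// EFinM lee_wpmul2l// ?lee_fin//.
exact: truncated_form_expectation.
Unshelve. all: by end_near. Qed.

End RandomForm.

(** * Necessity of the rectangle condition *)

Section StandardGrid.
Variables (R : realType) (N : nat) (I0 : cube R N).

(** A translated and dilated standard grid: any given cube thus lies in some dyadic grid, and the
    norm inequality can be tested on it. *)
Definition grid_through : set (cube R N) := [set I | exists (k : int) (z : 'I_N -> int),
  side I = side I0 * 2 ^ k /\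
  forall c, corner I ord0 c = corner I0 ord0 c + side I0 * 2 ^ k * (z c)%:~R].

Lemma grid_through_self : grid_through I0.
Proof. by exists 0, (fun=> 0); rewrite expr0z mulr1; split => // c; rewrite mulr0 addr0. Qed.

Lemma dyadic_grid_through : dyadic_grid grid_through.
Proof.
have l0 := side_gt0 I0.
have h0 (k : int) : 0 < side I0 * 2 ^ k by rewrite mulr_gt0// exprz_gt0.
exists (side I0); split => //.
- by move=> I [k [z [sI _]]]; exists k.
- move=> k x; set h := side I0 * 2 ^ k; have hp : 0 < h by exact: h0.
  pose z c := Num.floor ((x ord0 c - corner I0 ord0 c) / h).
  pose I := @Cube R N (\row_c (corner I0 ord0 c + h * (z c)%:~R)) h hp.
  have xE c : x ord0 c = corner I0 ord0 c + h * ((x ord0 c - corner I0 ord0 c) / h).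
    by rewrite mulrC divfK ?gt_eqF// addrC subrK.
  exists I; split.
    split => //; first by exists k, z; split => // c; rewrite mxE.
    move=> c; rewrite /= mxE {1 2}(xE c) -addrA -[X in _ + (_ + X)]mulr1 -mulrDr.
    have := floor_itv ((x ord0 c - corner I0 ord0 c) / h).
    by rewrite intrD => /andP[h1 h2]; rewrite lerD2l ltrD2l ler_pM2l// ltr_pM2l// h1.
  move=> J [[k' [z' [sJ cJ]]] sJ' Jx].
  apply: cube_eq => /=; last by rewrite sJ'.
  apply/rowP => c; rewrite mxE cJ -sJ sJ'; congr (_ + _ * _%:~R).
  have := Jx c; rewrite cJ -sJ sJ' -/h {1 2}(xE c) -addrA -[X in _ + (_ + X)]mulr1 -mulrDr.
  rewrite lerD2l ltrD2l ler_pM2l// ltr_pM2l// => /andP[h1 h2].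
  by apply: floor_def; rewrite intrD h1.
(* In units of the smaller side, measured from the corner of [I0], all faces are integers; a common
   point gives strict inequalities between them, which integrality turns into containment. *)
have nest (i : nat) (k : int) (I J : cube R N) (z z' : 'I_N -> int) x :
    side I = side I0 * 2 ^ k -> side J = side I0 * 2 ^ k * 2 ^+ i ->
    (forall c, corner I ord0 c = corner I0 ord0 c + side I0 * 2 ^ k * (z c)%:~R) ->
    (forall c, corner J ord0 c = corner I0 ord0 c + side I0 * 2 ^ k * 2 ^+ i * (z' c)%:~R) ->
    cube_set I x -> cube_set J x -> cube_set I `<=` cube_set J.
  move=> sI sJ cI cJ Ix Jx; apply: cube_set_sub => c.
  have := Ix c; have := Jx c; rewrite sI sJ cI cJ.
  set h := side I0 * 2 ^ k; have hp : 0 < h by exact: h0.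
  set a := corner I0 ord0 c; set y := x ord0 c => /andP[j1 j2] /andP[i1 i2].
  have e1 : h * ((2 ^+ i * z' c)%:~R) < h * ((z c + 1)%:~R) :> R.
    by rewrite intrD intrM rmorphXn/=; lra.
  have e2 : h * ((z c)%:~R) < h * ((2 ^+ i * (z' c + 1))%:~R) :> R.
    by rewrite intrM intrD rmorphXn/=; lra.
  move: e1 e2; rewrite !ltr_pM2l// !ltr_int => e1 e2.
  have f1 : 2 ^+ i * z' c <= z c by rewrite -ltzD1.
  have f2 : z c + 1 <= 2 ^+ i * (z' c + 1) by rewrite lezD1.
  have g1 : h * ((2 ^+ i * z' c)%:~R) <= h * ((z c)%:~R) :> R.
    by rewrite ler_pM2l// ler_int.
  have g2 : h * ((z c + 1)%:~R) <= h * ((2 ^+ i * (z' c + 1))%:~R) :> R.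
    by rewrite ler_pM2l// ler_int.
  move: g1 g2; rewrite !intrM !intrD rmorphXn/=; lra.
move=> I J [k [z [sI cI]]] [k' [z' [sJ cJ]]].
have [[x [Ix Jx]]|ne] := pselect (exists x, cube_set I x /\ cube_set J x); last first.
  by apply: Or31; apply/seteqP; split => // x [Ix Jx]; apply: ne; exists x.
have shift (a b : int) : a <= b -> (2 : R) ^ b = 2 ^ a * 2 ^+ absz (b - a).
  move=> ab; have {1}-> : b = a + (absz (b - a))%:Z by lia.
  by rewrite expfzDr.
have [kk|kk] := leP k k'.
  apply: Or32; apply: (nest (absz (k' - k)) k I J z z' x) => //.
    by rewrite -mulrA -shift.
  by move=> c; rewrite cJ (shift _ _ kk) mulrA.
apply: Or33; apply: (nest (absz (k - k')) k' J I z' z x) => //.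
  by rewrite -mulrA -shift// ltW.
by move=> c; rewrite cI (shift _ _ (ltW kk)) mulrA.
Qed.

End StandardGrid.

Section Necessity.
Variables (R : realType) (m n : nat).
Local Notation T := (borel_prod R m n).
Local Notation rmass mu := (mass mu (cst 1%E)).

Lemma integral_indic_rect (mu : {measure set T -> \bar R}) (A : set T) (D : set T) :
  measurable A -> measurable D -> (\int[mu]_(x in D) (\1_A x)%:E = mu (A `&` D))%E.
Proof. by move=> mA mD; rewrite integral_indic. Qed.

Lemma Lnorm_indic (mu : {measure set T -> \bar R}) (A : set T) (r : R) :
  measurable A -> 0 < r -> Lnorm mu r%:E (fun x => (\1_A x)%:E) = (mu A `^ r^-1)%E.
Proof.
move=> mA r0; rewrite unlock.
have -> : (fun x => `|(\1_A x)%:E| `^ r)%E = (fun x => (\1_A x)%:E : \bar R).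
  apply/funext => x; rewrite indicE; case: (_ \in _) => /=.
    by rewrite normr1 powR1.
  by rewrite normr0 powR0// gt_eqF.
by rewrite integral_indic// setIT.
Qed.

Variables sigma omega : {measure set T -> \bar R}.
Hypotheses (lfs : locally_finite sigma) (lfo : locally_finite omega).
Variables p q : R.
Variable K : cube R m -> cube R n -> R.
Hypothesis K0 : forall I J, 0 <= K I J.

(** Test with both functions equal to the indicator of one rectangle and keep only its term: K s o
    <= c s^(1/p) o^(1/q'). Dividing by the powers on the right leaves the characteristic. *)
Lemma rect_characteristic_finite : 1 < p -> 1 < q ->
  (best_constant p q K sigma omega < +oo)%E ->
  (rect_characteristic p q K sigma omega < +oo)%E.
Proof.
move=> p1 q1 /ereal_inf_lt[C [C0 HC] Coo].
have p0 : 0 < p by lra.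
have q0 : 0 < q by lra.
have q'0 : 0 < conj_exp q by rewrite divr_gt0//; lra.
have ep : 1 / conj_exp p = 1 - p^-1 by rewrite /conj_exp; field; lra.
have eq : (conj_exp q)^-1 = 1 - 1 / q by rewrite /conj_exp; field; lra.
have ep0 : 0 < 1 / conj_exp p by rewrite ep subr_gt0 invf_lt1.
have eq0 : 0 < 1 / q by rewrite divr_gt0.
case: C C0 HC Coo => [c| |]//; rewrite lee_fin => c0 HC _.
apply: (@le_lt_trans _ _ c%:E); last by rewrite ltry.
apply: ge_ereal_sup => _ [[I J] _ <-] /=.
set A := rect I J; have mA : measurable A by exact: measurable_rect.
have mi : measurable_fun setT (fun x => (\1_A x)%:E : \bar R).
  by apply/measurable_EFinP; exact: measurable_indic.
have i0 (x : T) : (0 <= (\1_A x)%:E :> \bar R)%E by rewrite lee_fin.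
have := HC _ _ _ _ (dyadic_grid_through I) (dyadic_grid_through J) mi mi i0 i0.
rewrite !Lnorm_indic// -!rmassE//.
set s := rmass sigma I J; set o := rmass omega I J.
have s0 : 0 <= s by exact: mass_cst_ge0.
have o0 : 0 <= o by exact: mass_cst_ge0.
move=> H; have {H} : ((K I J * s * o)%:E <= c%:E * (s%:E `^ p^-1) * (o%:E `^ (conj_exp q)^-1))%E.
  apply: le_trans H; apply: ereal_sup_ubound; exists [set (I, J)].
    split; first exact: finite_set1.
    by move=> _ ->; split; exact: grid_through_self.
  rewrite fsbig_set1/= !integral_indic_rect// setIid.
  by rewrite -!rmassE.
rewrite !poweR_EFin -!EFinM !lee_fin => H.
(* A null rectangle contributes 0 to the supremum, the exponents 1/p' and 1/q being positive. *)
have [sz|sz] := eqVneq s 0; first by rewrite sz powR0 ?mulr0 ?gt_eqF.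
have [oz|oz] := eqVneq o 0; first by rewrite oz powR0 ?mulr0 ?mul0r ?gt_eqF.
have sp : 0 < s by rewrite lt_neqAle eq_sym sz.
have op : 0 < o by rewrite lt_neqAle eq_sym oz.
have pos : 0 < s `^ p^-1 * o `^ (conj_exp q)^-1 by rewrite mulr_gt0 ?powR_gt0.
rewrite -(ler_pM2r pos) [leRHS]mulrA; apply: le_trans H.
have split_pow (x e : R) : 0 < x -> x = x `^ (1 - e) * x `^ e.
  by move=> x0; rewrite -powRD ?(gt_eqF x0) ?implybT// subrK powRr1 ?ltW.
rewrite {3}(split_pow s p^-1 sp) {3}(split_pow o (1 / q) op) ep eq.
by rewrite le_eqVlt; apply/orP; left; apply/eqP; ring.
Qed.

End Necessity.

(** * Sufficiency of the rectangle condition *)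

Section Sufficiency.
Variables (R : realType) (m n : nat).
Local Notation T := (borel_prod R m n).
Variables sigma omega : {measure set T -> \bar R}.
Hypotheses (lfs : locally_finite sigma) (lfo : locally_finite omega).
Hypotheses (rds : product_reverse_doubling sigma).
Hypotheses (rdo : product_reverse_doubling omega).
Variables p q : R.
Hypotheses (p1 : 1 < p) (pq : p < q).
Variable K : cube R m -> cube R n -> R.
Hypothesis K0 : forall I J, 0 <= K I J.

Lemma normalized_form_bound :
  ((exists alpha beta : R,
      [/\ 0 < alpha / m%:R < 1, 0 < beta / n%:R < 1 &
          forall I J, K I J = fractional_kernel alpha beta I J])
   \/ expectation_inequality K sigma omega) ->
  (rect_characteristic p q K sigma omega < +oo)%E ->
  exists2 C, 0 <= C & forall Dm Dn (f g : T -> \bar R) (Lf Lg : R),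
    dyadic_grid Dm -> dyadic_grid Dn ->
    measurable_fun setT f -> (forall x, (0 <= f x)%E) -> 0 < Lf ->
    measurable_fun setT g -> (forall x, (0 <= g x)%E) -> 0 < Lg ->
    (\int[sigma]_x `|f x| `^ p)%E = (Lf `^ p)%:E ->
    (\int[omega]_x `|g x| `^ (conj_exp q))%E = (Lg `^ (conj_exp q))%:E ->
    (dyadic_form K sigma omega Dm Dn f g <= (C * Lf * Lg)%:E)%E.
Proof.
move=> hK charoo; have p1' := p1; have pq' := pq.
have q1 : 1 < q by lra.
have q'1 : 1 < conj_exp q by rewrite ltr_pdivlMr; lra.
have [A A0 KA] := kernel_bound lfs lfo charoo.
have [C C0 avg] := lattice_average_bound lfs lfo rds rdo p1 pq.
have lfin (mu : {measure set T -> \bar R}) (h : T -> \bar R) (r L : R) :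
    locally_finite mu -> measurable_fun setT h -> (forall x, (0 <= h x)%E) -> 1 < r ->
    (\int[mu]_x `|h x| `^ r)%E = (L `^ r)%:E ->
    forall I J, (\int[mu]_(x in rect I J) h x < +oo)%E.
  move=> lf mh h0 r1 inth I J; apply: (set_integral_lfin mh h0 r1).
  - exact: measurable_rect.
  - exact: locally_finite_rect.
  - by rewrite inth ltry.
case: hK => [[alpha [beta [ha hb KE]]]|[X [Y [c [c0 expect]]]]].
- have [kk kk0 Kd] := @fractional_kernel_double R m n alpha beta ha hb.
  exists (2 ^+ m * 2 ^+ n * kk * A * C); first by rewrite !mulr_ge0// exprn_ge0.
  move=> Dm Dn f g Lf Lg gm gn mf f0 Lf0 mg g0 Lg0 intf intg.
  have -> : 2 ^+ m * 2 ^+ n * kk * A * C * Lf * Lg =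
    2 ^+ m * 2 ^+ n * kk * A * (C * Lf * Lg) by rewrite !mulrA.
  apply: (@doubling_kernel_form_bound _ _ _ sigma omega p q K K0 f g) => //.
  + exact: (lfin _ _ p Lf).
  + exact: (lfin _ _ (conj_exp q) Lg).
  + by move=> I J I' J' sI sJ; rewrite !KE; exact: Kd.
  + by move=> I J; exact: KA.
  + by move=> J B v1 v2 h1 h2 h10 h20; exact: avg.
- exists (c^-1 * A * C); first by rewrite !mulr_ge0// invr_ge0 ltW.
  move=> Dm Dn f g Lf Lg gm gn mf f0 Lf0 mg g0 Lg0 intf intg.
  have -> : (c^-1 * A * C * Lf * Lg)%:E = (c^-1%:E * (A * (C * Lf * Lg))%:E)%E.
    by rewrite -EFinM !mulrA.
  rewrite lee_pdivlMl//; apply: (le_trans (expect Dm Dn f g gm gn mf mg f0 g0)).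
  apply: (@random_form_bound _ _ _ sigma omega lfs lfo p q) => //.
  + exact: (lfin _ _ p Lf).
  + exact: (lfin _ _ (conj_exp q) Lg).
  + by move=> I J; exact: KA.
  + by move=> J B v1 v2 h1 h2 h10 h20; exact: avg.
Qed.

(** The normalized estimate divides by both norms, so a zero norm is treated apart: Jensen's
    inequality on the rectangle forces the integral of h to vanish. *)
Lemma mass_eq0_norm (mu : {measure set T -> \bar R}) (h : T -> \bar R) (r : R) I J :
  locally_finite mu -> measurable_fun setT h -> (forall x, (0 <= h x)%E) -> 1 < r ->
  'N[mu]_r%:E [h]%E = 0%E -> (\int[mu]_(x in rect I J) h x = 0)%E.
Proof.
move=> lf mh h0 r1 N0; have r0 : r != 0 by rewrite gt_eqF//; lra.
have int0 : (\int[mu]_x `|h x| `^ r = 0)%E.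
  by rewrite -(poweR_Lnorm mu h r0) N0 poweR_EFin powR0.
have lfh I' J' : (\int[mu]_(x in rect I' J') h x < +oo)%E.
  apply: (set_integral_lfin mh h0 r1); rewrite ?int0//.
  - exact: measurable_rect.
  - exact: locally_finite_rect.
rewrite -massE//; congr EFin.
have [sz|sz] := eqVneq (mass mu (cst 1%E) I J) 0; first exact: mass_eq0.
have sp : 0 < mass mu (cst 1%E) I J by rewrite lt_neqAle eq_sym sz mass_cst_ge0.
have := @set_integral_jensen _ _ _ mu h r mh h0 r1 (rect I J) _ (mass mu h I J)
  (measurable_rect I J) sp _ _.
rewrite -(rmassE lf) -massE// => /(_ erefl erefl) H.
have : (((mass mu h I J / mass mu (cst 1%E) I J) `^ r * mass mu (cst 1%E) I J)%:E <= 0)%E.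
  apply: (le_trans H); rewrite -int0; apply: ge0_subset_integral => //.
  - exact: measurable_rect.
  - exact: measurable_abse_poweR.
  - by move=> x _; rewrite poweR_ge0.
rewrite lee_fin pmulr_lle0// => H2.
have : (mass mu h I J / mass mu (cst 1%E) I J) `^ r == 0.
  by rewrite eq_le H2 powR_ge0.
by rewrite powR_eq0 mulf_eq0 invr_eq0 (negPf sz) orbF => /andP[/eqP].
Qed.

Lemma best_constant_finite :
  ((exists alpha beta : R,
      [/\ 0 < alpha / m%:R < 1, 0 < beta / n%:R < 1 &
          forall I J, K I J = fractional_kernel alpha beta I J])
   \/ expectation_inequality K sigma omega) ->
  (rect_characteristic p q K sigma omega < +oo)%E ->
  (best_constant p q K sigma omega < +oo)%E.
Proof.
move=> hK charoo; have p1' := p1; have pq' := pq.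
have q1 : 1 < q by lra.
have q'1 : 1 < conj_exp q by rewrite ltr_pdivlMr; lra.
have [C C0 bound] := normalized_form_bound hK charoo.
(* C + 1 is positive, so the right-hand side is infinite when one norm is infinite and the other
   nonzero, even if C = 0. *)
apply: (@le_lt_trans _ _ (C + 1)%:E); last by rewrite ltry.
have C1 : 0 < C + 1 by rewrite ltr_wpDl.
apply: ereal_inf_lbound; split; first by rewrite lee_fin ltW.
move=> Dm Dn f g gm gn mf mg f0 g0.
(* As 0 times infinity is 0, the right-hand side vanishes as soon as one norm does, even when the
   other is infinite; the form has to vanish too. *)
have form0 : ('N[sigma]_p%:E [f] = 0 \/ 'N[omega]_(conj_exp q)%:E [g] = 0)%E ->
    (dyadic_form K sigma omega Dm Dn f g = 0)%E.
  move=> N0; apply: esum1 => Q _; case: N0 => N0.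
    by rewrite (mass_eq0_norm _ _ lfs mf f0 p1 N0) mule0 mul0e.
  by rewrite (mass_eq0_norm _ _ lfo mg g0 q'1 N0) mule0.
have NN (mu : {measure set T -> \bar R}) r h : (0 <= 'N[mu]_r%:E [h])%E by exact: Lnorm_ge0.
have [Nf0|Nf0] := eqVneq ('N[sigma]_p%:E [f])%E 0%E.
  by rewrite form0; [rewrite Nf0 mule0 mul0e|left].
have [Ng0|Ng0] := eqVneq ('N[omega]_(conj_exp q)%:E [g])%E 0%E.
  by rewrite form0; [rewrite Ng0 mule0|right].
have Nfp : (0 < 'N[sigma]_p%:E [f])%E by rewrite lt0e Nf0 NN.
have Ngp : (0 < 'N[omega]_(conj_exp q)%:E [g])%E by rewrite lt0e Ng0 NN.
have intf := poweR_Lnorm sigma f (lt0r_neq0 (lt_trans ltr01 p1)).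
have intg := poweR_Lnorm omega g (lt0r_neq0 (lt_trans ltr01 q'1)).
case: ('N[sigma]_p%:E [f])%E Nfp intf => [Lf| |]// Lf0 intf; last first.
  by rewrite gt0_muley ?lte_fin// gt0_mulye// leey.
case: ('N[omega]_(conj_exp q)%:E [g])%E Ngp intg => [Lg| |]// Lg0 intg; last first.
  by rewrite gt0_muley ?leey// mule_gt0.
rewrite !lte_fin in Lf0 Lg0; rewrite !poweR_EFin in intf intg.
apply: (le_trans (bound Dm Dn f g Lf Lg gm gn mf f0 Lf0 mg g0 Lg0 (esym intf) (esym intg))).
rewrite -!EFinM lee_fin ler_wpM2r ?(ltW Lg0)// ler_wpM2r ?(ltW Lf0)//.
by rewrite lerDl.
Qed.

End Sufficiency.

Theorem theorem3 (R : realType) (m n : nat) (p q : R)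
  (sigma omega : {measure set (borel_prod R m n) -> \bar R})
  (K : cube R m -> cube R n -> R) :
  (0 < m)%N -> (0 < n)%N ->
  1 < p -> p < q ->
  locally_finite sigma -> locally_finite omega ->
  product_reverse_doubling sigma -> product_reverse_doubling omega ->
  (forall I J, 0 <= K I J) ->
  ((exists alpha beta : R,
      [/\ 0 < alpha / m%:R < 1, 0 < beta / n%:R < 1 &
          forall I J, K I J = fractional_kernel alpha beta I J])
   \/ expectation_inequality K sigma omega) ->
  (best_constant p q K sigma omega < +oo)%E <->
  (rect_characteristic p q K sigma omega < +oo)%E.
Proof.
move=> _ _ p1 pq lfs lfo rds rdo K0 hK; split.
  by apply: rect_characteristic_finite => //; exact: lt_trans pq.
exact: best_constant_finite.
Qed.
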